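(* Let $\mathbb{F}$ be an algebraically closed field and $m,n\ge 1$. The fine gradings on $M(m,n)$ as a $\mathbb{Z}$-superalgebra are precisely the even fine gradings. Every such grading is equivalent to a unique $\Gamma(H)=\Gamma(H,k_0,k_1)$. Moreover, every grading $\Gamma(H)$ is fine, and $G_H$ is its universal group.
   Context: $M(m,n)$ is the associative superalgebra $M_{m+n}(\mathbb{F})=\mathrm{End}(\mathbb{F}^m\oplus\mathbb{F}^n)$ whose even (odd) part consists of the block-diagonal (block-off-diagonal) matrices. Its canonical $\mathbb{Z}$-grading has degree $0$ part the block-diagonal matrices, degree $1$ part the matrices supported in the lower left block, degree $-1$ part those supported in the upper right block; ''$M(m,n)$ as a $\mathbb{Z}$-superalgebra'' means equipped with this $\mathbb{Z}$-grading, and a grading on the $\mathbb{Z}$-superalgebra is a grading all of whose components are direct sums of their intersections with the components of the canonical $\mathbb{Z}$-grading. Only gradings by abelian groups are considered. A grading on a superalgebra by a group $G$ is an algebra grading whose components are $\mathbb{Z}_2$-graded subspaces. A grading $\Gamma'$ is a refinement of $\Gamma$ if every component of $\Gamma'$ is contained in a component of $\Gamma$, proper if some nonzero containment is strict; a grading is fine if it has no proper refinement (in the class of gradings of the given structure by abelian groups). Two gradings $A=\bigoplus_{g\in G}A_g$, $B=\bigoplus_{h\in H}B_h$ with supports $S$, $T$ are equivalent if there are an isomorphism of superalgebras $\varphi:A\to B$ and a bijection $\alpha:S\to T$ with $\varphi(A_s)=B_{\alpha(s)}$. The universal (abelian) group of a grading with support $S$ is the abelian group generated by $S$ with defining relations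 $s_1s_2=s_3$ whenever $0\neq A_{s_1}A_{s_2}\subseteq A_{s_3}$. Even gradings. A $G$-grading on $M(m,n)$ is the same as a $G\times\mathbb{Z}_2$-grading on the underlying algebra, for which $M(m,n)\cong\mathrm{End}_D(\mathcal{U})$ with $D$ a $G\times\mathbb{Z}_2$-graded division algebra (every nonzero homogeneous element invertible) and $\mathcal{U}$ a graded right $D$-module of finite rank; the grading is even if $\mathrm{supp}\,D\subseteq G\times\{\bar 0\}$. The grading $\Gamma(T,\beta,\gamma_0,\gamma_1)$. For a finite subgroup $T\subseteq G$ with nondegenerate alternating bicharacter $\beta$, let $D$ be the $G$-graded division algebra with support $T$, one-dimensional components $D_t=\mathbb{F}X_t$ and $X_uX_v=\beta(u,v)X_vX_u$ (unique up to isomorphism; a matrix algebra of size $\sqrt{|T|}$). For tuples $\gamma_0=(g_1,\dots,g_{k_0})$, $\gamma_1=(g_{k_0+1},\dots,g_{k_0+k_1})$ with $k_0\sqrt{|T|}=m$, $k_1\sqrt{|T|}=n$, identify $M(m,n)=M_{k_0+k_1}(\mathbb{F})\otimes D$ via the Kronecker product and set $\deg(E_{ij}\otimes d)=g_i(\deg d)g_j^{-1}$. The grading $\Gamma(H)$. For a finite abelian group $H$ of order not divisible by $\mathrm{char}\,\mathbb{F}$, let $\widehat{H}$ be its group of characters $H\to\mathbb{F}^\times$, $T_H=H\times\widehat{H}$ and $\beta_H((h_1,\chi_1),(h_2,\chi_2))=\chi_1(h_2)\chi_2(h_1)^{-1}$, a nondegenerate alternating bicharacter. For each natural number $\ell\mid\gcd(m,n)$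 with $\mathrm{char}\,\mathbb{F}\nmid\ell$, let $\Theta_\ell$ be a set of representatives of the isomorphism classes of abelian groups of order $\ell$, and put $k_0=m/\ell$, $k_1=n/\ell$. For $H\in\Theta_\ell$, $\Gamma(H)=\Gamma(H,k_0,k_1)$ is the $T_H\times\mathbb{Z}^{k_0+k_1}$-grading $\Gamma(T_H,\beta_H,(e_1,\dots,e_{k_0}),(e_{k_0+1},\dots,e_{k_0+k_1}))$ on $M(m,n)$, where $e_1,\dots,e_{k_0+k_1}$ is the standard basis of $\mathbb{Z}^{k_0+k_1}$. In the theorem $H$ ranges over all $\Theta_\ell$ with $\ell$ a natural number such that $\ell\mid\gcd(m,n)$ and $\mathrm{char}\,\mathbb{F}\nmid\ell$. $G_H=T_H\times\mathbb{Z}^{k_0+k_1}_0$, where $\mathbb{Z}^k_0=\{x\in\mathbb{Z}^k: x_1+\dots+x_k=0\}$; this is the subgroup generated by the support of $\Gamma(H)$. *)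

(* Defs.v *)
From HB Require Import structures.
From mathcomp Require Import all_boot all_algebra falgebra.
From mathcomp.multinomials Require Import freeg.
From mathcomp.real_closed Require Import mxtens.

Set Implicit Arguments.
Unset Strict Implicit.
Unset Printing Implicit Defensive.

Import GRing.Theory.
Local Open Scope ring_scope.

(* Abelian groups are zmodTypes, so every group law is written additively. *)

Section Gradings.

Variables (F : fieldType) (A : vectType F).

(* All spaces are finite dimensional, so a direct sum has only finitely many
   nonzero terms even when the index group is infinite. *)
Definition is_direct_sum (I : eqType) (V : I -> {vspace A}) (W : {vspace A}) :=
  exists s : seq I,
    [/\ uniq s, forall i, i \notin s -> V i = 0%VS,
        directv (\sum_(i <- s) V i)%VS & (\sum_(i <- s) V i)%VS = W].

Definition is_algebra_grading (mul : A -> A -> A) (G : zmodType)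
    (Gam : G -> {vspace A}) :=
  is_direct_sum Gam fullv /\
  forall g h a b, a \in Gam g -> b \in Gam h -> mul a b \in Gam (g + h).

Definition proper_refinement (G' G : zmodType)
    (Gam' : G' -> {vspace A}) (Gam : G -> {vspace A}) :=
  (forall g', exists g, (Gam' g' <= Gam g)%VS) /\
  (exists g' g, [/\ Gam' g' != 0%VS, (Gam' g' <= Gam g)%VS
                  & Gam' g' != Gam g]).

(* [P] is the class of gradings in which refinements are taken. *)
Definition is_fine (P : forall G : zmodType, (G -> {vspace A}) -> Prop)
    (G : zmodType) (Gam : G -> {vspace A}) :=
  P G Gam /\
  forall (G' : zmodType) (Gam' : G' -> {vspace A}),
    P G' Gam' -> ~ proper_refinement Gam' Gam.

Definition supp (G : zmodType) (Gam : G -> {vspace A}) : Type :=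
  {g : G | Gam g != 0%VS}.

End Gradings.

(* Graded division algebras and their graded right modules.  Over a finite
   dimensional D, a right D-module has finite rank iff it has finite dimension
   over F; D embeds in End_D(U) for U of positive rank, so it is no loss that D
   and U are finite dimensional when End_D(U) is a matrix algebra. *)

Definition is_graded_division (F : fieldType) (D : falgType F) (G : zmodType)
    (Dgr : G -> {vspace D}) :=
  is_algebra_grading (fun a b : D => a * b) Dgr /\
  forall g d, d \in Dgr g -> d != 0 -> d \is a GRing.unit.

Definition is_graded_right_module (F : fieldType) (D : falgType F)
    (U : vectType F) (act : U -> D -> U) (G : zmodType)
    (Dgr : G -> {vspace D}) (Ugr : G -> {vspace U}) :=
  [/\ [/\ forall u, linear (act u), forall d, linear (act^~ d),
          forall u, act u 1 = u
        & forall u d e, act u (d * e) = act (act u d) e],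
      is_direct_sum Ugr fullv
    & forall g h u d, u \in Ugr g -> d \in Dgr h -> act u d \in Ugr (g + h)].

Definition is_D_linear (F : fieldType) (D : falgType F) (U : vectType F)
    (act : U -> D -> U) (f : 'End(U)) :=
  forall u d, f (act u d) = act (f u) d.

Definition has_degree (F : fieldType) (U : vectType F) (G : zmodType)
    (Ugr : G -> {vspace U}) (g : G) (f : 'End(U)) :=
  forall h u, u \in Ugr h -> f u \in Ugr (g + h).

Section Superalgebra.

Variables (F : fieldType) (m n : nat).

Local Notation M := 'M[F]_(m + n).

Definition lower (i : 'I_(m + n)) : bool := (m <= i)%N.

Definition parity_part (p : 'Z_2) : {vspace M} :=
  (\sum_i \sum_(j | (lower i != lower j) == (p == 1%R)) <[delta_mx i j]>)%VS.

Definition canonical_part (z : int) : {vspace M} :=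
  (\sum_i \sum_(j | ((lower i)%:Z - (lower j)%:Z)%R == z) <[delta_mx i j]>)%VS.

Definition is_super_grading (G : zmodType) (Gam : G -> {vspace M}) :=
  is_algebra_grading (fun a b : M => a *m b) Gam /\
  forall g, is_direct_sum (fun p => Gam g :&: parity_part p)%VS (Gam g).

Definition is_Zsuper_grading (G : zmodType) (Gam : G -> {vspace M}) :=
  is_super_grading Gam /\
  forall g, is_direct_sum (fun z => Gam g :&: canonical_part z)%VS (Gam g).

Definition with_parity (G : zmodType) (Gam : G -> {vspace M})
    (gp : G * 'Z_2) : {vspace M} :=
  (Gam gp.1 :&: parity_part gp.2)%VS.

Definition is_even (G : zmodType) (Gam : G -> {vspace M}) :=
  exists (D : falgType F) (Dgr : (G * 'Z_2)%type -> {vspace D})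
         (U : vectType F) (act : U -> D -> U)
         (Ugr : (G * 'Z_2)%type -> {vspace U}) (phi : 'Hom(M, 'End(U))),
    [/\ is_graded_division Dgr,
        is_graded_right_module act Dgr Ugr,
        [/\ injective phi,
            forall f, is_D_linear act f <-> exists a, phi a = f,
            phi 1%:M = \1%VF
          & forall a b, phi (a *m b) = (phi a \o phi b)%VF],
        forall gp a, a \in with_parity Gam gp <-> has_degree Ugr gp (phi a)
      & forall g p, Dgr (g, p) != 0%VS -> p = 0].

Definition equivalent (G G' : zmodType)
    (Gam : G -> {vspace M}) (Gam' : G' -> {vspace M}) :=
  exists (phi : 'End(M)) (alpha : supp Gam -> supp Gam'),
    [/\ [/\ bijective phi, phi 1%:M = 1%:M,
            forall a b, phi (a *m b) = phi a *m phi b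
          & forall p, (phi @: parity_part p)%VS = parity_part p],
        bijective alpha
      & forall s, (phi @: Gam (val s))%VS = Gam' (val (alpha s))].

(* Universal group: the free abelian group on the support modulo the subgroup
   generated by the defining relators. *)

Definition defining_relation (G : zmodType) (Gam : G -> {vspace M})
    (s1 s2 s3 : supp Gam) :=
  (exists a b, [/\ a \in Gam (val s1), b \in Gam (val s2) & a *m b != 0]) /\
  (forall a b, a \in Gam (val s1) -> b \in Gam (val s2) ->
     a *m b \in Gam (val s3)).

Inductive relator_subgroup (G : zmodType) (Gam : G -> {vspace M}) :
    {freeg (supp Gam) / int} -> Prop :=
| Relator s1 s2 s3 of defining_relation s1 s2 s3 :
    relator_subgroup (<< s1 >> + << s2 >> - << s3 >>)
| Relator0 : relator_subgroup 0
| RelatorB x y of relator_subgroup x & relator_subgroup y :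
    relator_subgroup (x - y).

Definition eval_support (G : zmodType) (Gam : G -> {vspace M})
    (x : {freeg (supp Gam) / int}) : G :=
  \sum_(s <- dom x) val s *~ coeff s x.

(* The inclusion of the support in the subgroup [U] of [G] induces an
   isomorphism from the universal group onto [U]. *)
Definition is_universal_group (G : zmodType) (Gam : G -> {vspace M})
    (U : pred G) :=
  (forall g, U g <-> exists x : {freeg (supp Gam) / int}, eval_support x = g) /\
  (forall x : {freeg (supp Gam) / int},
     eval_support x = 0 <-> relator_subgroup x).

(* The grading with deg (E_ij (x) d) = g_i + deg d - g_j.  Here k * l = m + n;
   conform_mx is the cast along this equation. *)
Definition Gamma (G : zmodType) (k l : nat) (D : G -> {vspace 'M[F]_l})
    (gam : 'I_k -> G) (g : G) : {vspace M} :=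
  (\sum_i \sum_j
     linfun (fun d : 'M[F]_l => conform_mx (0 : M) (delta_mx i j *t d))
       @: D (g - gam i + gam j)%R)%VS.

End Superalgebra.

(* The character group of H, with its pointwise product written additively. *)

Section CharacterGroup.

Variables (F : fieldType) (H : finZmodType).

Definition is_group_char (chi : {ffun H -> F}) : bool :=
  (chi 0 == 1) && [forall a, forall b, chi (a + b) == chi a * chi b].

Record charGroup := CharGroup {
  char_fun :> {ffun H -> F};
  char_funP : is_group_char char_fun
}.

HB.instance Definition _ := [isSub for char_fun].
HB.instance Definition _ := [Choice of charGroup by <:].

Lemma char0 (chi : charGroup) : chi 0 = 1.
Proof. by case: chi => chi /= /andP[/eqP]. Qed.

Lemma charD (chi : charGroup) a b : chi (a + b) = chi a * chi b.
Proof. by case: chi => chi /= /andP[_ /forallP/(_ a)/forallP/(_ b)/eqP]. Qed.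

Lemma char_neq0 (chi : charGroup) a : chi a != 0.
Proof.
apply: contraTneq (oner_neq0 F) => chia0.
by rewrite negbK -(char0 chi) -(subrr a) charD chia0 mul0r.
Qed.

Lemma is_group_char1 : is_group_char [ffun=> 1].
Proof.
apply/andP; split; first by rewrite ffunE.
by apply/forallP=> a; apply/forallP=> b; rewrite !ffunE mulr1.
Qed.

Lemma is_group_charV (chi : charGroup) : is_group_char [ffun a => (chi a)^-1].
Proof.
apply/andP; split; first by rewrite ffunE char0 invr1.
by apply/forallP=> a; apply/forallP=> b; rewrite !ffunE charD invfM.
Qed.

Lemma is_group_charM (chi psi : charGroup) :
  is_group_char [ffun a => chi a * psi a].
Proof.
apply/andP; split; first by rewrite ffunE !char0 mulr1.
by apply/forallP=> a; apply/forallP=> b; rewrite !ffunE !charD mulrACA.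
Qed.

Definition char_one := CharGroup is_group_char1.
Definition char_inv chi := CharGroup (is_group_charV chi).
Definition char_mul chi psi := CharGroup (is_group_charM chi psi).

Lemma char_ext (chi psi : charGroup) : chi =1 psi -> chi = psi.
Proof. by move=> eq_chi; apply/val_inj/ffunP. Qed.

Lemma char_mulE chi psi a : char_mul chi psi a = chi a * psi a.
Proof. exact: ffunE. Qed.

Lemma char_oneE a : char_one a = 1.
Proof. exact: ffunE. Qed.

Lemma char_invE chi a : char_inv chi a = (chi a)^-1.
Proof. exact: ffunE. Qed.

Fact char_mulA : associative char_mul.
Proof. by move=> x y z; apply: char_ext => a; rewrite !char_mulE mulrA. Qed.

Fact char_mulC : commutative char_mul.
Proof. by move=> x y; apply: char_ext => a; rewrite !char_mulE mulrC. Qed.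

Fact char_mul1 : left_id char_one char_mul.
Proof.
by move=> x; apply: char_ext => a; rewrite char_mulE char_oneE mul1r.
Qed.

Fact char_mulV : left_inverse char_one char_inv char_mul.
Proof.
move=> x; apply: char_ext => a; rewrite char_mulE char_oneE char_invE.
by rewrite mulVf ?char_neq0.
Qed.

HB.instance Definition _ :=
  GRing.isZmodule.Build charGroup char_mulA char_mulC char_mul1 char_mulV.

Definition T_group : zmodType := (H * charGroup)%type.

Definition beta (u v : T_group) : F := u.2 v.1 / v.2 u.1.

(* X_(h, chi) acts on the group algebra F[H], with the basis of H, by
   e_b |-> chi(b) e_(h + b); by X_mul and X_comm these matrices realize the
   graded division algebra with support T_H and bicharacter beta_H. *)
Definition X (u : T_group) : 'M[F]_#|H| :=
  \matrix_(a, b) (u.2 (enum_val b) *+ (enum_val a == u.1 + enum_val b)).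

Lemma X_mul u v : X u *m X v = u.2 v.1 *: X (u + v).
Proof.
apply/matrixP=> a b; rewrite !mxE.
rewrite (bigD1 (enum_rank (v.1 + enum_val b))) //= !mxE !enum_rankK eqxx mulr1n.
rewrite big1 => [|c neq_c]; last first.
  rewrite !mxE [enum_val c == _](_ : _ = false) ?mulr0n ?mulr0 //.
  by apply: contraNF neq_c => /eqP <-; rewrite enum_valK.
rewrite addr0 addrA charD [(u + v).2 _]char_mulE.
by case: eqP => _; rewrite ?mulr1n ?mulr0n ?mulr0 ?mul0r // mulrA.
Qed.

Lemma X_comm u v : X u *m X v = beta u v *: (X v *m X u).
Proof.
by rewrite !X_mul scalerA [v + u]addrC /beta divfK // char_neq0.
Qed.

End CharacterGroup.

Section GammaH.

Variables (F : fieldType) (m n : nat) (H : finZmodType).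

Definition rank_H : nat := (m %/ #|H| + n %/ #|H|)%N.

Definition ambient_group : zmodType := (T_group F H * 'rV[int]_rank_H)%type.

Definition D_H (g : ambient_group) : {vspace 'M[F]_#|H|} :=
  if g.2 == 0 then <[X g.1]>%VS else 0%VS.

(* Meaningful when #|H| divides gcd(m, n). *)
Definition GammaH : ambient_group -> {vspace 'M[F]_(m + n)} :=
  Gamma m n D_H (fun i => (0, delta_mx 0 i)).

Definition G_H : pred ambient_group := fun g => \sum_i g.2 0 i == 0.

End GammaH.

Definition isomorphic (A B : zmodType) :=
  exists f : A -> B, bijective f /\ {morph f : x y / x + y}.

Definition is_representatives (l : nat) (Theta : finZmodType -> Prop) :=
  (forall H, Theta H -> #|H| = l) /\
  (forall A : finZmodType, #|A| = l -> exists! H, Theta H /\ isomorphic A H).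

Definition is_parameter (F : fieldType) (m n : nat)
    (Theta : nat -> finZmodType -> Prop) (H : finZmodType) :=
  exists l : nat, [/\ (l %| gcdn m n)%N, [pchar F]^'.-nat l & Theta l H].

(* Main.v *)
(** A grading of the Z-superalgebra M(m,n) is an algebra grading whose identity component contains
    the block idempotent [e0].  A minimal idempotent of the identity component cuts out a graded
    division corner, whose components are lines; its support [T] carries a nondegenerate alternating
    bicharacter, and a Lagrangian subgroup gives T = H x H^.  Decomposing [e0] and [1 - e0] into
    minimal idempotents and comparing their corners (homogeneous "frames") turns the grading, after
    a conjugation, into a coarsening of some Gamma(H); so the fine ones are equivalent to the
    Gamma(H).  Conversely no algebra grading properly refines Gamma(H): its off-diagonal components
    are lines, hence survive in any refinement, and they generate the algebra.

    Evenness: if a grading respecting [e0] is End_D(U), with D its corner, then D is purely even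
    because the minimal idempotent lies below [e0] or [1 - e0]; conversely, when D is purely even,
    the projection of U on its parity 0 part is D-linear of trivial degree, so it is one of [e0],
    [1 - e0].  [H] is recovered from T = H x H^ by counting [d]-torsion. *)

Require Import Defs.
From mathcomp Require Import all_boot all_algebra.
From HB Require Import structures.
From mathcomp Require Import all_fingroup all_solvable falgebra.
From mathcomp.multinomials Require Import freeg.
From mathcomp.real_closed Require Import mxtens.
From Stdlib Require Import Classical ClassicalEpsilon FunctionalExtensionality.

Set Implicit Arguments.
Unset Strict Implicit.
Unset Printing Implicit Defensive.

Import GRing.Theory.
Local Open Scope ring_scope.

(** A refinement is a mere inclusion of components, so the coarsening of [GammaH] to a given grading
    is recorded by a bare function [psi] between the two groups; fineness of the target turns every
    inclusion of a nonzero component into an equality. Nonrefinability of [GammaH] is proved against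
    all algebra gradings because a refinement inside the super class is not known beforehand to
    respect the block idempotent. Duality of finite abelian groups is obtained by counting: distinct
    characters of a group whose order is nonzero in [F] are independent, so they do not outnumber
    the elements, and a character not represented by an element would be one too many. The order of
    T is nonzero in [F] because a field of characteristic p has no nontrivial p-th roots of unity.
    As the characters do not come as a finite type, a finite copy [C] with a bijection [c] indexes
    the bases and sums. A Lagrangian subgroup is found as a subset of T, whereas H has to be a
    prescribed representative of its class; hence the matrix model is built for every H isomorphic
    to the subgroup, which avoids transporting gradings along isomorphisms afterwards. *)

Section DirectSums.

Variables (F : fieldType) (A : vectType F) (I : eqType).
Implicit Types (V : I -> {vspace A}) (W : {vspace A}).

Lemma directv_seqP V (s : seq I) : uniq s ->
  directv (\sum_(i <- s) V i)%VS <->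
  (forall u : I -> A, (forall i, u i \in V i) -> \sum_(i <- s) u i = 0 ->
     forall i, i \in s -> u i = 0).
Proof.
move=> Us; rewrite directvE /= !(big_tnth _ _ s).
transitivity (directv (\sum_(i < size s) V (tnth (in_tuple s) i))%VS).
  by rewrite directvE /=.
split=> [/directv_sum_independent dir u Vu | indep].
  rewrite big_tnth => /(dir _ (fun _ _ => Vu _)) u0 i /seq_tnthP[k ->].
  exact: u0.
apply/directv_sum_independent=> u Vu sum0 k _.
(* Converts a family indexed by positions into one indexed by values; since [s] has no repetition,
   each fibre of [tnth] holds one position. *)
pose v i := \sum_(j < size s | tnth (in_tuple s) j == i) u j.
have vE j : v (tnth (in_tuple s) j) = u j.
  rewrite /v (big_pred1 j) // => j'.
  have /tuple_uniqP inj : uniq (in_tuple s) by [].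
  exact: (inj_eq inj).
have := indep v _ _ (tnth (in_tuple s) k) (mem_tnth _ _); rewrite vE; apply.
  by move=> i; apply: memv_suml => j /eqP <-; apply: Vu.
by rewrite big_tnth -[RHS]sum0; apply: eq_bigr => j _; rewrite vE.
Qed.

(** The components of [a], minus the family concentrated at [i] with value [a], form a relation,
    which independence kills; outside [s] the spaces vanish, so the projections make sense for every
    index. *)
Lemma is_direct_sum_proj V W : is_direct_sum V W ->
  exists (s : seq I) (p : I -> 'End(A)),
    [/\ uniq s, forall i a, p i a \in V i,
        forall a, a \in W -> a = \sum_(i <- s) p i a
      & forall i j a, a \in V i -> p j a = if i == j then a else 0].
Proof.
case=> s [Us V0 dV defW].
have Wdef: W = (\sum_(i <- s | xpredT i) V i)%VS by rewrite defW.
pose p i : 'End(A) := sumv_pi_for Wdef i.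
have pV i a : p i a \in V i by apply: memv_sum_pi.
have pS a : a \in W -> a = \sum_(i <- s) p i a.
  by move=> Wa; rewrite -[LHS](sumv_pi_uniq_sum Wdef) // filter_predT.
exists s, p; split=> // i j a Va.
have [sj | sj] := boolP (j \in s); last first.
  have p0: p j a = 0 by apply/eqP; rewrite -memv0 -(V0 j sj) pV.
  rewrite p0; case: eqP => // ij.
  by apply/esym/eqP; rewrite -memv0 -(V0 j sj) -ij.
have [si | si] := boolP (i \in s); last first.
  have -> : a = 0 by apply/eqP; rewrite -memv0 -(V0 i si).
  by rewrite if_same /p linear0.
have Wa : a \in W.
  rewrite -defW; apply: subvP Va.
  by rewrite (big_rem i si) /= addvSl.
have /directv_seqP : directv (\sum_(i <- s) V i)%VS by [].
move/(_ Us)/(_ (fun k => p k a - (if i == k then a else 0))) => indep.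
apply/eqP; rewrite -subr_eq0; apply/eqP; apply: indep sj => [k|].
  by rewrite memvB //; case: eqP => [<- //|_]; apply: mem0v.
rewrite sumrB -(pS a Wa) (bigD1_seq i) //= eqxx big1 ?addr0 ?subrr // => k.
by rewrite eq_sym => /negPf->.
Qed.

(** The maps [p] only witness that the components span, so no linearity is asked of them and ad hoc
    formulas do. *)
Lemma is_direct_sum_intro V W (s : seq I) (p : I -> A -> A) :
    uniq s -> (forall i, i \notin s -> V i = 0%VS) ->
    (forall i, (V i <= W)%VS) ->
    (forall i a, a \in W -> p i a \in V i) ->
    (forall a, a \in W -> a = \sum_(i <- s) p i a) ->
    (forall u : I -> A, (forall i, u i \in V i) -> \sum_(i <- s) u i = 0 ->
     forall i, i \in s -> u i = 0) ->
  is_direct_sum V W.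
Proof.
move=> Us V0 VW pV pS indep; exists s; split=> //; first by apply/directv_seqP.
apply: subv_anti; apply/andP; split.
  apply: (big_ind (fun U => (U <= W)%VS)) => [|U1 U2 h1 h2|i _] //.
    exact: sub0v.
  by rewrite subv_add h1.
apply/subvP=> a Wa; rewrite (pS a Wa) !(big_tnth _ _ s); apply: memv_sumr => i _.
exact: pV.
Qed.

End DirectSums.

(** * Matrix spaces cut out by labels of the matrix units *)

Section LabelledParts.

Variables (F : fieldType) (N : nat) (I : eqType) (L : 'I_N -> 'I_N -> I).
Local Notation M := 'M[F]_N.

Definition label_part (z : I) : {vspace M} :=
  (\sum_i \sum_(j | L i j == z) <[delta_mx i j]>)%VS.

Definition label_proj (z : I) (a : M) : M :=
  \matrix_(i, j) (if L i j == z then a i j else 0).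

Lemma mem_label_partP z (a : M) :
  reflect (forall i j, L i j != z -> a i j = 0) (a \in label_part z).
Proof.
apply: (iffP idP) => [|a0].
  rewrite /label_part => /memv_sumP[f fP ->] i j Lij; rewrite summxE big1 // => k _.
  have /memv_sumP[h hP ->] := fP k isT; rewrite summxE big1 // => l Lkl.
  have /vlineP[c ->] := hP l Lkl; rewrite !mxE.
  by case: eqP => [ik|]; case: eqP => [jl|] //=; rewrite ?mulr0 //;
     move: Lij; rewrite ik jl Lkl.
rewrite [a]matrix_sum_delta; apply: memv_sumr => i _.
rewrite (bigID (fun j => L i j == z)) /= [X in _ + X]big1 ?addr0 => [|j Lij].
  by apply: memv_sumr => j _; rewrite memvZ ?memv_line.
by rewrite a0 // scale0r.
Qed.

Lemma label_proj_part z a : label_proj z a \in label_part z.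
Proof. by apply/mem_label_partP => i j /negPf Lij; rewrite mxE Lij. Qed.

Lemma label_proj_id z w a : a \in label_part z ->
  label_proj w a = if z == w then a else 0.
Proof.
move/mem_label_partP => a0; apply/matrixP=> i j; rewrite mxE.
case: (eqVneq z w) => [<-|zw]; first by case: eqP => // /eqP/a0.
by case: eqP => [Lij|]; rewrite mxE // a0 // Lij eq_sym.
Qed.

Lemma label_proj_delta z i j :
  label_proj z (delta_mx i j) = if L i j == z then delta_mx i j else 0.
Proof.
apply/matrixP=> k l; rewrite mxE; case: (eqVneq (L i j) z) => Lij; rewrite !mxE.
  by case: eqP => // Lkl; case: eqP => // ki; case: eqP => // lj; rewrite ki lj in Lkl.
case: eqP => // Lkl; case: eqP => // ki; case: eqP => // lj.
by rewrite ki lj in Lkl; rewrite Lkl eqxx in Lij.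
Qed.

Definition labels : seq I := undup [seq L ij.1 ij.2 | ij : 'I_N * 'I_N].

Lemma label_proj_sum a : a = \sum_(z <- labels) label_proj z a.
Proof.
apply/matrixP=> i j; rewrite summxE (bigD1_seq (L i j)) ?undup_uniq //=; last first.
  by rewrite mem_undup; apply/imageP; exists (i, j).
rewrite mxE eqxx big1 ?addr0 // => z; rewrite mxE eq_sym.
by case: eqP => // ->; rewrite eqxx.
Qed.

Lemma label_part_out z : z \notin labels -> label_part z = 0%VS.
Proof.
move=> zL; apply/eqP; rewrite -subv0; apply/subvP=> a /mem_label_partP a0.
rewrite memv0; apply/eqP/matrixP=> i j; rewrite mxE a0 //.
apply: contraNneq zL => <-; rewrite mem_undup.
by apply/imageP; exists (i, j).
Qed.

Lemma label_proj_linear z : linear (label_proj z).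
Proof.
by move=> c a b; apply/matrixP=> i j; rewrite !mxE; case: ifP; rewrite ?mulr0 ?addr0.
Qed.

(** Parity and canonical degree are both labels of matrix units, so this one criterion reduces both
    superalgebra conditions to stability under masking of entries. *)
Lemma direct_sum_labelP (W : {vspace M}) :
  is_direct_sum (fun z => W :&: label_part z)%VS W <->
  (forall z a, a \in W -> label_proj z a \in W).
Proof.
split=> [/is_direct_sum_proj[s [p [_ pV pS _]]] z a Wa | Wproj].
  have lp_lin := label_proj_linear z.
  pose lp := GRing.isLinear.Build _ _ _ _ (label_proj z) lp_lin.
  pose f : {linear M -> M} := HB.pack (label_proj z) lp.
  rewrite -[label_proj z]/(f : M -> M) (pS a Wa) linear_sum /=.
  rewrite memv_suml // => w _; have:= pV w a; rewrite memv_cap => /andP[Wp Lp].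
  by rewrite (label_proj_id _ Lp); case: eqP; rewrite ?mem0v.
apply: (@is_direct_sum_intro _ _ _ _ _ labels label_proj).
- exact: undup_uniq.
- by move=> z /label_part_out->; rewrite capv0.
- by move=> z; apply: capvSl.
- by move=> z a Wa; rewrite memv_cap Wproj ?label_proj_part.
- by move=> a _; apply: label_proj_sum.
move=> u Vu sum0 z zs; apply/matrixP=> i j.
have u0 w : w != L i j -> u w i j = 0.
  rewrite eq_sym; have := Vu w; rewrite memv_cap => /andP[_ /mem_label_partP h].
  exact: h.
have [->|zL] := eqVneq z (L i j); last by rewrite u0 ?mxE.
have := congr1 (fun a : M => a i j) sum0.
rewrite summxE (bigD1_seq (L i j)) ?undup_uniq //= ?big1 ?addr0 => [|w|].
- by [].
- exact: u0.
by rewrite mem_undup; apply/imageP; exists (i, j).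
Qed.

End LabelledParts.

(** * Group gradings of a full matrix algebra *)

Definition mx_grading (F : fieldType) (n : nat) (G : zmodType)
    (Gam : G -> {vspace 'M[F]_n}) :=
  is_algebra_grading (fun a b : 'M[F]_n => a *m b) Gam.

Section MatrixGrading.

Variables (F : fieldType) (n : nat) (G : zmodType).
Local Notation M := 'M[F]_n.
Implicit Types (Gam : G -> {vspace M}) (a b : M) (g h : G).

Definition grading_proj Gam (s : seq G) (p : G -> 'End(M)) :=
  [/\ uniq s, forall g a, p g a \in Gam g,
      forall a, a = \sum_(g <- s) p g a
    & forall g h a, a \in Gam g -> p h a = if g == h then a else 0].

Lemma mx_grading_proj Gam : mx_grading Gam -> exists s p, grading_proj Gam s p.
Proof.
case=> /is_direct_sum_proj[s [p [Us pV pS pE]]] _.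
by exists s, p; split=> // a; apply: pS; apply: memvf.
Qed.

Lemma grading_disjoint Gam g h a : mx_grading Gam ->
  a \in Gam g -> a \in Gam h -> a != 0 -> g = h.
Proof.
move=> /mx_grading_proj[s [p [_ _ _ pE]]] ag ah.
have := pE g h a ag; rewrite (pE h h _ ah) eqxx; case: eqP => // _ ->.
by rewrite eqxx.
Qed.

Section Components.

Variables (Gam : G -> {vspace M}) (gradG : mx_grading Gam).
Variables (s : seq G) (p : G -> 'End(M)) (projG : grading_proj Gam s p).

Lemma grading_mul g h a b : a \in Gam g -> b \in Gam h -> a *m b \in Gam (g + h).
Proof. by case: gradG => _; apply. Qed.

Lemma grading_mul_eq g h k a b :
  a \in Gam g -> b \in Gam h -> g + h = k -> a *m b \in Gam k.
Proof. by move=> ag bh <-; apply: grading_mul. Qed.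

Lemma proj_out g a : g \notin s -> p g a = 0.
Proof.
case: projG => Us pV pS pE gs; rewrite (pS (p g a)) big1_seq // => h /andP[_ hs].
by rewrite (pE g) //; case: eqP gs => // ->; rewrite hs.
Qed.

Lemma proj_sum_pick (f : G -> M) h : (forall k, k \notin s -> f k = 0) ->
  \sum_(k <- s) (if k == h then f k else 0) = f h.
Proof.
case: projG => Us _ _ _ f0; have [hs|hs] := boolP (h \in s).
  by rewrite (bigD1_seq h) //= eqxx big1 ?addr0 // => k /negPf->.
by rewrite f0 // big1_seq // => k /andP[_ ks]; case: eqP => // ->; apply: f0.
Qed.

Lemma proj_mulr g h a b : a \in Gam g -> p h (b *m a) = p (h - g) b *m a.
Proof.
case: projG => Us pV pS pE ag; rewrite {1}[b]pS mulmx_suml linear_sum /=.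
rewrite -(@proj_sum_pick (fun k => p k b *m a)) => [|k /proj_out->].
  apply: eq_bigr => k _; rewrite (pE (k + g)) ?grading_mul //.
  by rewrite [in RHS]eq_sym subr_eq eq_sym.
by rewrite mul0mx.
Qed.

Lemma proj_mull g h a b : a \in Gam g -> p h (a *m b) = a *m p (h - g) b.
Proof.
case: projG => Us pV pS pE ag; rewrite {1}[b]pS mulmx_sumr linear_sum /=.
rewrite -(@proj_sum_pick (fun k => a *m p k b)) => [|k /proj_out->].
  apply: eq_bigr => k _; rewrite (pE (g + k)) ?grading_mul //.
  by rewrite [in RHS]eq_sym subr_eq addrC eq_sym.
by rewrite mulmx0.
Qed.

End Components.

(** The degree 0 component of 1 acts as a left identity on each homogeneous element, because right
    multiplication by an element of degree [g] shifts projections by [g]; being a left identity, it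
    is 1. *)
Lemma grading_one Gam : mx_grading Gam -> 1%:M \in Gam 0.
Proof.
move=> gradG; have [s [p projG]] := mx_grading_proj gradG.
have [_ pV pS pE] := projG.
suff id0 a : p 0 1%:M *m a = a by rewrite -[1%:M]id0 mulmx1 pV.
rewrite [in LHS](pS a) mulmx_sumr [RHS]pS; apply: eq_bigr => g _.
by rewrite -{1}(subrr g) -(proj_mulr gradG projG) // mul1mx (pE g g) ?eqxx.
Qed.

End MatrixGrading.

(** * Superalgebra gradings in terms of the block idempotents *)

Section SuperGradings.

Variables (F : fieldType) (m n : nat).
Local Notation M := 'M[F]_(m + n).

Definition block_idem (b : bool) : M :=
  \matrix_(i, j) ((i == j) && (lower i == b))%:R.

Definition parity_label (i j : 'I_(m + n)) : 'Z_2 :=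
  if lower i != lower j then 1 else 0.

Definition degree_label (i j : 'I_(m + n)) : int :=
  (lower i)%:Z - (lower j)%:Z.

Lemma block_idem_mull b (a : M) i j :
  (block_idem b *m a) i j = if lower i == b then a i j else 0.
Proof.
rewrite mxE (bigD1 i) //= !mxE eqxx big1 ?addr0 => [|k /negPf ki].
  by case: eqP; rewrite ?mul1r ?mul0r.
by rewrite mxE eq_sym ki mul0r.
Qed.

Lemma block_idem_mulr b (a : M) i j :
  (a *m block_idem b) i j = if lower j == b then a i j else 0.
Proof.
rewrite mxE (bigD1 j) //= !mxE eqxx big1 ?addr0 => [|k /negPf kj].
  by case: eqP; rewrite ?mulr1 ?mulr0.
by rewrite mxE kj mulr0.
Qed.

Lemma block_idem_sum : block_idem false + block_idem true = 1%:M.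
Proof.
apply/matrixP=> i j; rewrite !mxE; case: eqP => //= _; last by rewrite addr0.
by case: (lower i); rewrite ?addr0 ?add0r.
Qed.

Lemma block_idemM b c : block_idem b *m block_idem c = if b == c then block_idem b else 0.
Proof.
have [<-|bc] := eqVneq b c; apply/matrixP=> i j; rewrite block_idem_mull !mxE.
  by case: (lower i == b); rewrite ?andbF.
by case: eqP => // ->; rewrite (negPf bc) andbF.
Qed.

Lemma parity_partE p : parity_part F m n p = label_part F parity_label p.
Proof.
apply: eq_bigr => i _; apply: eq_bigl => j; rewrite /parity_label.
by case: (lower i != lower j); case: p => [[|[|//]] ?]; rewrite -val_eqE.
Qed.

Lemma label_proj_even (a : M) : label_proj parity_label 0 a =
  block_idem false *m a *m block_idem false + block_idem true *m a *m block_idem true.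
Proof.
apply/matrixP=> i j; rewrite mxE [RHS]mxE !block_idem_mulr !block_idem_mull.
by rewrite /parity_label; case: (lower i); case: (lower j); rewrite ?addr0 ?add0r.
Qed.

Lemma label_proj_odd (a : M) : label_proj parity_label 1 a =
  block_idem false *m a *m block_idem true + block_idem true *m a *m block_idem false.
Proof.
apply/matrixP=> i j; rewrite mxE [RHS]mxE !block_idem_mulr !block_idem_mull.
by rewrite /parity_label; case: (lower i); case: (lower j); rewrite ?addr0 ?add0r.
Qed.

Lemma label_proj_degree0 (a : M) :
  label_proj degree_label 0 a = label_proj parity_label 0 a.
Proof.
apply/matrixP=> i j; rewrite !mxE /degree_label /parity_label.
by case: (lower i); case: (lower j).
Qed.

Lemma label_proj_degree1 (a : M) :
  label_proj degree_label 1 a = block_idem true *m a *m block_idem false.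
Proof.
apply/matrixP=> i j; rewrite mxE !block_idem_mulr !block_idem_mull /degree_label.
by case: (lower i); case: (lower j).
Qed.

Lemma label_proj_degreeN1 (a : M) :
  label_proj degree_label (-1) a = block_idem false *m a *m block_idem true.
Proof.
apply/matrixP=> i j; rewrite mxE !block_idem_mulr !block_idem_mull /degree_label.
by case: (lower i); case: (lower j).
Qed.

Lemma label_proj_degree_out z (a : M) : z \notin [:: 0; 1; -1] ->
  label_proj degree_label z a = 0.
Proof.
move=> zS; apply/matrixP=> i j; rewrite !mxE; case: eqP => // zL; move: zS.
by rewrite -zL /degree_label; case: (lower i); case: (lower j).
Qed.

Lemma super_gradingP (G : zmodType) (Gam : G -> {vspace M}) :
  is_super_grading Gam <-> mx_grading Gam /\
    forall g p a, a \in Gam g -> label_proj parity_label p a \in Gam g.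
Proof.
suff eqd g : is_direct_sum (fun p => Gam g :&: parity_part F m n p)%VS (Gam g) <->
    (forall p a, a \in Gam g -> label_proj parity_label p a \in Gam g).
  split=> -[gradG parG]; split=> // g; first by apply/eqd.
  by apply/eqd; apply: parG.
rewrite -direct_sum_labelP.
have -> // : (fun p => Gam g :&: parity_part F m n p)%VS =
             (fun p => Gam g :&: label_part F parity_label p)%VS.
by apply: functional_extensionality => p; rewrite parity_partE.
Qed.

(** Masking by canonical degree commutes with the projections of the grading, so the degree 0
    component of the block idempotent acts on off-diagonal blocks from the left exactly as the
    idempotent itself does, and this determines it. Conversely, products with block idempotents of
    degree 0 produce every mask. *)
Lemma Zsuper_gradingP (G : zmodType) (Gam : G -> {vspace M}) :
    (0 < m)%N -> (0 < n)%N ->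
  is_Zsuper_grading Gam <-> mx_grading Gam /\ block_idem false \in Gam 0.
Proof.
move=> m_gt0 n_gt0; split=> [[[gradG _] degG] | [gradG e0]].
  split=> //; have [s [p projG]] := mx_grading_proj gradG.
  have [_ pV pS pE] := projG; set c := block_idem false.
  have dG g z a : a \in Gam g -> label_proj degree_label z a \in Gam g.
    by move: z a; apply/direct_sum_labelP; apply: degG.
  have pL z g a : label_proj degree_label z (p g a) = p g (label_proj degree_label z a).
    pose lp := HB.pack_for {linear M -> M} (label_proj degree_label z)
       (GRing.isLinear.Build _ _ _ _ (label_proj degree_label z) (label_proj_linear _ z)).
    rewrite {2}[a]pS -[label_proj _ z]/(lp : M -> M) !linear_sum /=.
    rewrite -(proj_sum_pick projG (f := fun k => label_proj degree_label z (p k a))).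
      by apply: eq_bigr => k _; rewrite (pE k g (label_proj _ _ _)) ?dG.
    move=> k ks; rewrite (proj_out projG) //.
    exact: (linear0 lp).
  have c0_upper a : label_proj degree_label (-1) a = a -> p 0 c *m a = a.
    move=> ua; rewrite [in LHS](pS a) mulmx_sumr [RHS]pS; apply: eq_bigr => g _.
    rewrite -{1}(subrr g) -(proj_mulr gradG projG) // -[in LHS]ua -pL.
    rewrite label_proj_degreeN1 -!mulmxA mulmxA block_idemM eqxx mulmxA.
    by rewrite -label_proj_degreeN1 pL ua (pE g g) ?eqxx.
  have c0_lower a : label_proj degree_label 1 a = a -> p 0 c *m a = 0.
    move=> ua; rewrite [in LHS](pS a) mulmx_sumr big1 // => g _.
    rewrite -{1}(subrr g) -(proj_mulr gradG projG) // -[in LHS]ua -pL.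
    by rewrite label_proj_degree1 -!mulmxA mulmxA block_idemM mul0mx linear0.
  suff -> : c = p 0 c by [].
  (* Column [j] is read off the product with a matrix unit in row [j], whose column is taken in the
     other block to make it off-diagonal; both blocks must be nonempty for that. *)
  apply/matrixP=> i j; rewrite mxE.
  case: (boolP (lower j)) => lj.
    have := c0_lower (delta_mx j (lshift n (Ordinal m_gt0))).
    rewrite label_proj_delta /degree_label lj /lower /= leqNgt m_gt0 => /(_ erefl).
    move/matrixP/(_ i (lshift n (Ordinal m_gt0))).
    rewrite mxE (bigD1 j) //= big1 ?addr0 => [|k /negPf kj].
      rewrite !mxE !eqxx mulr1 => ->.
      by case: eqP => // ->; rewrite -[(m <= j)%N]/(lower j) lj.
    by rewrite !mxE kj mulr0.
  have := c0_upper (delta_mx j (rshift m (Ordinal n_gt0))).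
  rewrite label_proj_delta /degree_label (negPf lj) /lower /= leq_addr => /(_ erefl).
  move/matrixP/(_ i (rshift m (Ordinal n_gt0))).
  rewrite mxE (bigD1 j) //= big1 ?addr0 => [|k /negPf kj].
    rewrite !mxE !eqxx mulr1 andbT => ->.
    by case: eqP => //= ->; rewrite -[(m <= j)%N]/(lower j) (negPf lj).
  by rewrite !mxE kj mulr0.
have eb b : block_idem b \in Gam 0.
  case: b => //; have := grading_one gradG; rewrite -block_idem_sum.
  by rewrite rpredDl.
have blk g a b c : a \in Gam g -> block_idem b *m a *m block_idem c \in Gam g.
  move=> ag; rewrite -[g]add0r -[0 + g]addr0; apply: (grading_mul gradG) => //.
  exact: (grading_mul gradG).
have par g p a : a \in Gam g -> label_proj parity_label p a \in Gam g.
  move=> ag; case: p => [[|[|//]] ltp].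
    by rewrite (_ : Ordinal _ = 0) ?label_proj_even; [rewrite memvD ?blk | apply: val_inj].
  by rewrite (_ : Ordinal _ = 1) ?label_proj_odd; [rewrite memvD ?blk | apply: val_inj].
split; first by apply/super_gradingP.
move=> g; apply/(direct_sum_labelP degree_label) => z a ag.
have [|zS] := boolP (z \in [:: 0; 1; -1]); last first.
  by rewrite label_proj_degree_out ?mem0v.
rewrite !inE => /or3P[] /eqP->.
- by rewrite label_proj_degree0 par.
- by rewrite label_proj_degree1 blk.
by rewrite label_proj_degreeN1 blk.
Qed.

End SuperGradings.

Lemma linear_fun_sum (R : pzRingType) (U V : lmodType R) (f : U -> V) (J : Type)
    (r : seq J) (P : pred J) (E : J -> U) : linear f ->
  f (\sum_(i <- r | P i) E i) = \sum_(i <- r | P i) f (E i).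
Proof.
move=> f_lin; pose g : {linear U -> V} :=
  HB.pack f (GRing.isLinear.Build _ _ _ _ f f_lin).
exact: (linear_sum g).
Qed.

Lemma linear_fun0 (R : pzRingType) (U V : lmodType R) (f : U -> V) :
  linear f -> f 0 = 0.
Proof. by move=> /(_ (-1) 0 0); rewrite scaler0 addr0 scaleN1r addNr. Qed.

(** * Even gradings have a block idempotent of degree zero *)

Section Even.

Variables (F : fieldType) (m n : nat) (G : zmodType).
Local Notation M := 'M[F]_(m + n).
Variable (Gam : G -> {vspace M}).

Lemma even_block_idem : (0 < m)%N -> (0 < n)%N ->
  is_super_grading Gam -> is_even Gam -> block_idem F m n false \in Gam 0.
Proof.
move=> m_gt0 n_gt0 /super_gradingP[gradG parG].
case=> D [Dgr [U [act [Ugr [phi]]]]].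
case=> [[[Ddir _] _] [[act_linr act_linl act1 actM] Udir actG]].
case=> phi_inj phi_onto phi1 phiM phi_deg Deven.
have [s [q [Us qV qS qE]]] := is_direct_sum_proj Udir.
have [t [r [_ rV rS _]]] := is_direct_sum_proj Ddir.
pose e : 'End(U) := \sum_(k <- s | k.2 == 0) q k.
have eE k u : u \in Ugr k -> e u = if k.2 == 0 then u else 0.
  move=> uk; rewrite /e sum_lfunE; case: eqP => k2; last first.
    rewrite big1 // => l l2; rewrite (qE k) //.
    by case: eqP => // kl; rewrite kl (eqP l2) in k2.
  rewrite [RHS](qS u (memvf u)) big_mkcond; apply: eq_bigr => l _.
  rewrite (qE k) //; case: (k =P l) => [<-|]; first by rewrite k2 eqxx.
  by rewrite if_same.
have ext (f g : U -> U) : linear f -> linear g ->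
    (forall k u, u \in Ugr k -> f u = g u) -> f =1 g.
  move=> f_lin g_lin eq_fg u; rewrite (qS u (memvf u)) !linear_fun_sum //.
  by apply: eq_bigr => k _; apply: (eq_fg k).
have e_lin : is_D_linear act e.
  move=> u d; rewrite (rS d (memvf d)) !(linear_fun_sum _ _ _ (act_linr _)) linear_sum /=.
  apply: eq_bigr => -[g p] _; move: (r (g, p) d) (rV (g, p) d) => {}d dg.
  have [p0|/eqP p0] := eqVneq p 0; last first.
    have : Dgr (g, p) = 0%VS by apply/eqP; apply/contraT => /Deven.
    by move=> D0; move: dg; rewrite D0 memv0 => /eqP->; rewrite !(linear_fun0 (act_linr _)) linear0.
  subst p; move: u; apply: ext => [c u v|c u v|k u uk].
  - by rewrite act_linl linearP.
  - by rewrite linearP act_linl.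
  rewrite (eE (k + (g, 0))) ?actG // (eE k) //= addr0.
  by case: eqP => // _; rewrite (linear_fun0 (act_linl d)).
have [a phi_a] := (phi_onto e).1 e_lin.
have : a \in with_parity Gam (0, 0).
  apply/phi_deg; rewrite phi_a => k u uk; rewrite add0r (eE k) //.
  by case: eqP; rewrite ?mem0v.
rewrite memv_cap /= => /andP[a0 _].
have aa : a *m a = a.
  apply: phi_inj; rewrite phiM phi_a; apply/lfunP; apply: ext.
  - exact: linearP.
  - exact: linearP.
  move=> k u uk; rewrite comp_lfunE /= (eE k u) //; case: ifP => [k0|_]; last by rewrite linear0.
  by rewrite (eE k) // k0.
have [x [p [_ pV pS _]]] := mx_grading_proj gradG.
(* Even elements preserve the two parities of [U] and odd elements exchange them: the former commute
   with the projection [e], the latter turn it into its complement. *)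
have a_even b : label_proj (@parity_label m n) 0 b = b -> a *m b = b *m a.
  move=> eb; rewrite -eb [b](pS b).
  rewrite !(linear_fun_sum _ _ _ (label_proj_linear (@parity_label m n) 0)).
  rewrite mulmx_sumr mulmx_suml; apply: eq_bigr => g _.
  have bg : label_proj (@parity_label m n) 0 (p g b) \in with_parity Gam (g, 0).
    by rewrite memv_cap parG //= parity_partE label_proj_part.
  have /phi_deg bdeg := bg.
  apply: phi_inj; rewrite !phiM phi_a; apply/lfunP; apply: ext => [||k u uk].
  - exact: linearP.
  - exact: linearP.
  rewrite !comp_lfunE /= (eE ((g, 0) + k)) ?bdeg //= add0r (eE k) //.
  by case: ifP => //; rewrite linear0.
have a_odd b : label_proj (@parity_label m n) 1 b = b -> a *m b = b *m (1%:M - a).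
  move=> eb; rewrite -eb [b](pS b).
  rewrite !(linear_fun_sum _ _ _ (label_proj_linear (@parity_label m n) 1)).
  rewrite mulmx_sumr mulmx_suml; apply: eq_bigr => g _.
  have bg : label_proj (@parity_label m n) 1 (p g b) \in with_parity Gam (g, 1).
    by rewrite memv_cap parG //= parity_partE label_proj_part.
  have /phi_deg bdeg := bg.
  apply: phi_inj; rewrite !phiM [phi (1%:M - a)]linearB /= phi1 phi_a; apply/lfunP;
    apply: ext => [||k u uk].
  - exact: linearP.
  - exact: linearP.
  rewrite !comp_lfunE /= add_lfunE opp_lfunE id_lfunE (eE ((g, 1) + k)) ?bdeg //= (eE k) //.
  have [->|->] : k.2 = 0 \/ k.2 = 1.
      by case: k {uk} => h [[|[|//]] i] /=; [left | right]; apply: val_inj.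
    by rewrite eqxx subrr linear0.
  by rewrite subr0.
have a_col (i j k : 'I_(m + n)) : a k i = (a *m delta_mx i j) k j.
  rewrite mxE (bigD1 i) //= mxE !eqxx mulr1 big1 ?addr0 // => l /negPf li.
  by rewrite mxE li mulr0.
have row_b (i j k : 'I_(m + n)) (b : M) : (delta_mx i j *m b) k j = (b j j) *+ (k == i).
  rewrite mxE (bigD1 j) //= mxE eqxx andbT big1 ?addr0 => [|l /negPf lj].
    by case: eqP; rewrite ?mul1r ?mul0r.
  by rewrite mxE lj andbF mul0r.
(* On matrix units the two relations say that [a] is diagonal and constant on each block, and that
   the two constants add up to 1. *)
have a_same i j k : lower i = lower j -> a k i = a j j *+ (k == i).
  move=> lij; rewrite (a_col i j) a_even ?row_b //.
  by rewrite label_proj_delta /parity_label lij eqxx.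
have a_diff i j k : lower i != lower j -> a k i = (1 - a j j) *+ (k == i).
  move=> lij; rewrite (a_col i j) a_odd ?row_b ?mxE ?eqxx //.
  by rewrite label_proj_delta /parity_label lij.
pose i0 : 'I_(m + n) := lshift n (Ordinal m_gt0).
have li0 : lower i0 = false by rewrite /lower leqNgt m_gt0.
have a00 : a i0 i0 * a i0 i0 = a i0 i0.
  have /matrixP/(_ i0 i0) := aa; rewrite mxE (bigD1 i0) //= big1 ?addr0 // => k /negPf ki.
  by rewrite (a_same i0 i0 k) // ki mulr0.
have aE : a = a i0 i0 *: block_idem F m n false + (1 - a i0 i0) *: block_idem F m n true.
  apply/matrixP=> k i; rewrite !mxE; case li : (lower i); last first.
    rewrite (a_same i i0) ?li ?li0 //; case: eqP => [->|_] /=; last by rewrite !mulr0 addr0.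
    by rewrite li mulr1 mulr0 addr0.
  rewrite (a_diff i i0) ?li ?li0 //; case: eqP => [->|_] /=; last by rewrite !mulr0 addr0.
  by rewrite li mulr1 mulr0 add0r.
(* Idempotence leaves 0 and 1 for the constant. In the first case [a] is the other block idempotent,
   and the wanted one is its complement. *)
have [a1|a1] := eqVneq (a i0 i0) 0; last first.
  have {}a1 : a i0 i0 = 1 by apply: (mulfI a1); rewrite mulr1.
  by move: aE; rewrite a1 scale1r subrr scale0r addr0 => <-.
move: aE; rewrite a1 scale0r add0r subr0 scale1r => aE.
have := block_idem_sum F m n; rewrite -aE => /(canRL (addrK a))->.
by rewrite memvB // grading_one.
Qed.

End Even.

(** * Matrix gradings without nontrivial idempotents of degree zero *)

Section GradedDivisionMatrix.

Variables (F : closedFieldType) (l : nat) (G : zmodType).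
Local Notation M := 'M[F]_l.+1.
Variables (Dg : G -> {vspace M}).
Hypothesis gradD : mx_grading Dg.
Hypothesis prim : forall e : M, e \in Dg 0 -> e *m e = e -> e = 0 \/ e = 1%:M.

Lemma deg0_horner (y : M) q : y \in Dg 0 -> horner_mx y q \in Dg 0.
Proof.
move=> y0; elim/poly_ind: q => [|q c IH]; first by rewrite rmorph0 mem0v.
rewrite rmorphD rmorphM /= horner_mx_X horner_mx_C memvD //.
  exact: (grading_mul_eq gradD IH y0 (addr0 0)).
by rewrite -scalemx1 memvZ // grading_one.
Qed.

(* Fitting decomposition: the idempotent projecting onto the generalized kernel is a polynomial
   in [y]. *)
Lemma deg0_unit_or_nilpotent (y : M) : y \in Dg 0 ->
  y \in unitmx \/ exists k, y ^+ k = 0.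
Proof.
move=> y0; have [k [q qn0 qE]] := multiplicity_XsubC (char_poly y) 0.
have {qn0} qn0 : ~~ root q 0 by move: qn0; rewrite monic_neq0 ?char_poly_monic.
have cop : coprimep q (('X - 0%:P) ^+ k) by rewrite coprimep_expr // coprimep_XsubC.
have [[u v] /= uv1] := Bezout_eq1_coprimepP _ _ cop.
have hX : horner_mx y ('X - 0%:P) = y by rewrite subr0 horner_mx_X.
have CH : horner_mx y q * y ^+ k = 0.
  by rewrite -{2}hX -rmorphXn -rmorphM -qE; apply: Cayley_Hamilton.
pose e := horner_mx y (v * ('X - 0%:P) ^+ k).
have eE : e = horner_mx y v * y ^+ k by rewrite /e rmorphM rmorphXn /= hX.
have e1 : horner_mx y (u * q) = 1 - e.
  by apply/(canRL (addrK e)); rewrite -rmorphD uv1 rmorph1.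
have comm_yk p : GRing.comm (horner_mx y p) (y ^+ k).
  by rewrite /GRing.comm -{2 3}hX -rmorphXn -!rmorphM mulrC.
have ee : e * (1 - e) = 0.
  by rewrite -e1 eE -mulrA -[_ * horner_mx y _]comm_yk rmorphM -!mulrA CH !mulr0.
have : e = 0 \/ e = 1%:M.
  apply: prim; first exact: deg0_horner.
  by move/eqP: ee; rewrite mulrBr mulr1 subr_eq0 eq_sym => /eqP.
(* If [e] is 0 then [q] is invertible at [y], and Cayley-Hamilton kills [y ^+ k]. If [e] is 1 then 1
   is a multiple of [y], except when [k] is 0; then 0 is not a root of the characteristic
   polynomial. *)
case=> [e0 | e1']; [right; exists k | left].
  have uq1 : horner_mx y (u * q) = 1 by rewrite e1 e0 subr0.
  by rewrite -[_ ^+ k]mul1r -uq1 rmorphM -mulrA CH mulr0.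
case: k qE cop uv1 hX CH @e eE e1 comm_yk ee e1' => [|k] qE _ _ _ _ e eE _ comm_yk _ e1'.
  move: qn0; rewrite -[q]mulr1 -[1](expr0 ('X - 0%:P)) -qE.
  rewrite rootE horner_coef0 char_poly_det mulf_eq0 signr_eq0 /= unitmxE.
  by rewrite unitfE.
have : y *m (y ^+ k * horner_mx y v) = 1%:M.
  by rewrite mulmxE mulrA -exprS -comm_yk -eE e1'.
by case/mulmx1_unit.
Qed.

Lemma homogeneous_invmx g (x : M) : x \in Dg g -> x \in unitmx -> invmx x \in Dg (- g).
Proof.
move=> xg Ux; have [s [p projD]] := mx_grading_proj gradD; have [_ pV _ pE] := projD.
suff -> : invmx x = p (- g) (invmx x) by apply: pV.
rewrite -[RHS](mulKmx Ux) -[- g]sub0r -(proj_mull gradD projD) // mulmxV //.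
by rewrite (pE 0) ?grading_one // eqxx mulmx1.
Qed.

(** The degree 0 part is a local ring: were [x + y] invertible, its inverse times [x] would be
    nilpotent, so that 1 minus it, which is the inverse times [y], would be invertible by the
    geometric series. *)
Lemma deg0_nonunitD (x y : M) : x \in Dg 0 -> y \in Dg 0 ->
  x \notin unitmx -> y \notin unitmx -> x + y \notin unitmx.
Proof.
move=> x0 y0 Nx Ny; apply/negP => Uxy.
have ixy : invmx (x + y) \in Dg 0.
  by rewrite -oppr0; apply: homogeneous_invmx; rewrite ?oppr0 ?memvD.
have [] : invmx (x + y) *m x \in unitmx \/ exists k, (invmx (x + y) *m x) ^+ k = 0.
- exact/deg0_unit_or_nilpotent/(grading_mul_eq gradD ixy x0 (addr0 0)).
- by rewrite unitmx_mul (negPf Nx) andbF.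
case=> k xk0; have := subrX1 (invmx (x + y) *m x) k.
rewrite xk0 sub0r -[_ - 1]opprB mulNr => /oppr_inj/esym/mulmx1_unit[].
rewrite -[1]/(1%:M) -(mulVmx Uxy) -mulmxBr [x + y]addrC addrK unitmx_mul (negPf Ny).
by rewrite andbF.
Qed.

(** Simplicity of the matrix algebra against locality of its degree 0 part: if [x] were singular,
    every homogeneous product through [x] would be singular, so the degree 0 component of any
    element of the two-sided ideal of [x] would be a nonunit; but this ideal contains 1. *)
Lemma homogeneous_unit g (x : M) : x \in Dg g -> x != 0 -> x \in unitmx.
Proof.
move=> xg xn0; apply/negPn/negP => Nx.
have [s [p projD]] := mx_grading_proj gradD; have [_ pV pS pE] := projD.
pose J (y : M) := (y \in Dg 0) && (y \notin unitmx).
have N0 : (0 : M) \notin unitmx by rewrite unitmxE det0 unitr0.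
have J0 : J 0 by rewrite /J mem0v.
have JD y z : J y -> J z -> J (y + z).
  by move=> /andP[? ?] /andP[? ?]; rewrite /J memvD // deg0_nonunitD.
have Jsum (K : Type) (r : seq K) (E : K -> M) : (forall k, J (E k)) -> J (\sum_(k <- r) E k).
  by move=> JE; apply: (big_ind J).
have Jp a b : J (p 0 (a *m x *m b)).
  rewrite [a]pS !mulmx_suml linear_sum; apply: (Jsum _ _ _) => h /=.
  rewrite [b]pS mulmx_sumr linear_sum; apply: (Jsum _ _ _) => k /=.
  have D : p h a *m x *m p k b \in Dg (h + g + k) by rewrite !grading_mul.
  rewrite (pE _ _ _ D); case: eqP => // hgk; rewrite /J -{1}hgk D.
  by rewrite !unitmx_mul (negPf Nx) andbF.
have /matrix0Pn[i [j xij]] := xn0.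
(* Writes 1 as an element of the ideal of [x]: a nonzero entry of [x] is moved by matrix units to
   each diagonal position. *)
have : J (\sum_k p 0 (delta_mx k i *m x *m ((x i j)^-1 *: delta_mx j k))) by apply: Jsum.
rewrite -linear_sum /= (_ : \sum_k _ = 1%:M).
  by rewrite (pE 0) ?grading_one // eqxx /J unitmx1 andbF.
apply/matrixP=> a b; rewrite summxE !mxE (bigD1 b) //= big1 ?addr0.
  rewrite mxE (bigD1 j) //= big1 ?addr0 => [|c /negPf cj]; last by rewrite !mxE cj mulr0 mulr0.
  rewrite !mxE !eqxx mulr1 (bigD1 i) //= big1 ?addr0 => [|c /negPf ci]; last first.
    by rewrite !mxE ci andbF mul0r.
  by rewrite !mxE eqxx andbT mulrAC -mulrA mulVf // mulr1.
move=> c /negPf cb; rewrite mxE big1 // => d _.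
by rewrite !mxE eq_sym [b == c]eq_sym cb andbF !mulr0.
Qed.

(** Subtracting an eigenvalue gives a singular element of degree 0, which must vanish. *)
Lemma deg0_scalar (y : M) : y \in Dg 0 -> exists c, y = c%:M.
Proof.
move=> y0; have /closed_rootP[c] : size (char_poly y) != 1 by rewrite size_char_poly.
rewrite -eigenvalue_root_char => /eigenvalueP[v vy vn0].
exists c; apply/eqP; rewrite -subr_eq0; apply: contraNT vn0 => yc.
have /homogeneous_unit/(_ yc) Uyc : y - c%:M \in Dg 0.
  by rewrite memvB // -scalemx1 memvZ // grading_one.
by rewrite -[v](mulmxK Uyc) mulmxBr vy mul_mx_scalar subrr mul0mx.
Qed.

Lemma homogeneous_line g (x y : M) : x \in Dg g -> x != 0 -> y \in Dg g ->
  exists c, y = c *: x.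
Proof.
move=> xg xn0 yg; have Ux := homogeneous_unit xg xn0.
have /deg0_scalar[c xyc] : invmx x *m y \in Dg 0.
  exact: (grading_mul_eq gradD (homogeneous_invmx xg Ux) yg (addNr g)).
by exists c; rewrite -[y](mulKVmx Ux) xyc mul_mx_scalar.
Qed.

End GradedDivisionMatrix.

(** * Corners at primitive idempotents, and homogeneous frames *)

Lemma mxrank_retract (F : fieldType) (N r : nat) (X : 'M[F]_(N, r)) (Y : 'M[F]_(r, N)) :
  Y *m X = 1%:M -> \rank (X *m Y) = r.
Proof.
move=> YX; apply/eqP; rewrite eqn_leq; apply/andP; split.
  by rewrite (leq_trans (mxrankM_maxr _ _)) ?rank_leq_row.
rewrite -{1}(mxrank1 F r) -[1%:M]mulmx1 -YX mulmxA -[Y *m X *m Y]mulmxA.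
by rewrite (leq_trans (mxrankM_maxl _ _)) ?mxrankM_maxr.
Qed.

(** The decreasing measure for both splittings of idempotents below. With equal ranks the rows of
    [f] would be combinations of those of [e], whence [f *m e = f], although it equals [e]. *)
Lemma idem_rank_ltn (F : fieldType) (N : nat) (e f : 'M[F]_N) :
  e *m f = e -> f *m e = e -> e *m e = e -> e != f -> (\rank e < \rank f)%N.
Proof.
move=> ef fe ee e_f; apply: rank_ltmx; rewrite ltmxE -{1}ef submxMl /=.
apply: contraNN e_f => /submxP[x fx].
by apply/eqP; rewrite -fe [in LHS]fx -mulmxA ee -fx.
Qed.

Section PrimitiveCorner.

Variables (F : closedFieldType) (N : nat) (G : zmodType).
Local Notation M := 'M[F]_N.
Variables (Gam : G -> {vspace M}) (gradG : mx_grading Gam).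

(** The corner at the idempotent [R *m S] is carried to genuine square matrices through the
    factorization, so that the results on gradings of a full matrix algebra apply to it. *)
Definition corner_grading l (R : 'M[F]_(N, l)) (S : 'M[F]_(l, N)) (g : G) :
    {vspace 'M[F]_l} :=
  (linfun (mulmxr S \o mulmx R) @^-1: Gam g)%VS.

Lemma mem_corner l (R : 'M[F]_(N, l)) (S : 'M[F]_(l, N)) g d :
  (d \in corner_grading R S g) = (R *m d *m S \in Gam g).
Proof. by rewrite -memv_preim lfunE. Qed.

Section Corner.

Variables (l : nat) (R : 'M[F]_(N, l)) (S : 'M[F]_(l, N)).
Hypotheses (RS0 : R *m S \in Gam 0) (SR : S *m R = 1%:M).

Lemma corner_mulK d : S *m (R *m d *m S) *m R = d.
Proof. by rewrite !mulmxA SR mul1mx -mulmxA SR mulmx1. Qed.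

Lemma corner_mx_grading : mx_grading (corner_grading R S).
Proof.
have [s [p projG]] := mx_grading_proj gradG; have [Us pV pS pE] := projG.
split=> [|g h a b]; last first.
  rewrite !mem_corner => ag bh.
  have := grading_mul gradG ag bh.
  by rewrite -!mulmxA [S *m _]mulmxA SR mul1mx.
pose q g d := S *m p g (R *m d *m S) *m R.
(* As [R *m S] has degree 0, the projections of [Gam] preserve the corner. *)
have Rq g d : R *m q g d *m S = p g (R *m d *m S).
  rewrite /q !mulmxA -[_ *m R *m S]mulmxA -[R *m S *m _ *m _]mulmxA.
  rewrite -[X in p X]subr0 -(proj_mulr gradG projG) // -[X in p X]subr0.
  rewrite -(proj_mull gradG projG) // subr0; congr (p _ _).
  by rewrite !mulmxA -[R *m S *m R]mulmxA SR mulmx1 -[_ *m S *m R]mulmxA SR mulmx1.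
apply: (@is_direct_sum_intro _ _ _ _ _ s q).
- exact: Us.
- move=> g gs; apply/eqP; rewrite -subv0; apply/subvP=> d; rewrite mem_corner memv0.
  move=> dg; have := pE g g _ dg; rewrite eqxx (proj_out projG) // => /esym RdS.
  by rewrite -[d]corner_mulK RdS mulmx0 mul0mx.
- by move=> g; apply: subvf.
- by move=> g d _; rewrite mem_corner Rq.
- move=> d _; rewrite -[LHS]corner_mulK [R *m d *m S]pS mulmx_sumr mulmx_suml.
  by apply: eq_bigr => g _; rewrite /q.
move=> u uV sum0 g gs; have := congr1 (fun d => p g (R *m d *m S)) sum0.
rewrite mulmx0 mul0mx linear0 mulmx_sumr mulmx_suml linear_sum /=.
rewrite (bigD1_seq g) //= big1 ?addr0 => [|h hg]; last first.
  by rewrite (pE h) -?mem_corner // (negPf hg).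
by rewrite (pE g) -?mem_corner // eqxx => RuS; rewrite -[u g]corner_mulK RuS mulmx0 mul0mx.
Qed.

End Corner.

Lemma primitive_corner (f : M) : f \in Gam 0 -> f *m f = f -> f != 0 ->
  exists l (R : 'M[F]_(N, l.+1)) (S : 'M[F]_(l.+1, N)),
    [/\ R *m S \in Gam 0, S *m R = 1%:M, f *m R = R, S *m f = S
      & forall e, e \in corner_grading R S 0 -> e *m e = e -> e = 0 \/ e = 1%:M].
Proof.
have [r] := ubnP (\rank f); elim: r f => // r IH f; rewrite ltnS => rkf f0 ff fn0.
have [[e [e0 ee ef fe [en0 ne]]] | prim] := classic (exists e : M,
    [/\ e \in Gam 0, e *m e = e, e *m f = e, f *m e = e & e != 0 /\ e != f]).
  have rke := leq_trans (idem_rank_ltn ef fe ee ne) rkf.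
  have [l [R [S [RS0 SR eR Se pr]]]] := IH e rke e0 ee en0; exists l, R, S; split=> //.
    by rewrite -eR mulmxA fe.
  by rewrite -Se -mulmxA ef.
(* A full rank factorization of an idempotent: cancelling the outer factors in
   [R *m S *m R *m S = R *m S] leaves [S *m R = 1]. *)
have [R [S [defRS SR]]] : exists (R : 'M[F]_(N, \rank f)) (S : 'M[F]_(\rank f, N)),
    f = R *m S /\ S *m R = 1%:M.
  have := mulmx_base f; move: (col_base_full f) (row_base_free f).
  move: (col_base f) (row_base f) => R S Rfull Sfree RS; exists R, S; split=> //.
  apply: (row_full_inj Rfull); apply: (row_free_inj Sfree).
  by rewrite /= mulmx1 mulmxA RS -mulmxA RS.
have : (0 < \rank f)%N by rewrite lt0n mxrank_eq0.
case: (\rank f) R S defRS SR => // l R S defRS SR _.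
have fR : f *m R = R by rewrite defRS -mulmxA SR mulmx1.
have Sf : S *m f = S by rewrite defRS mulmxA SR mul1mx.
exists l, R, S; split=> //; first by rewrite -defRS.
move=> e; rewrite mem_corner => e0 ee.
have [RS0|RSn0] := eqVneq (R *m e *m S) 0.
  by left; rewrite -(corner_mulK SR e) RS0 mulmx0 mul0mx.
have [RSf|RSnf] := eqVneq (R *m e *m S) f.
  by right; rewrite -(corner_mulK SR e) RSf defRS !mulmxA SR mul1mx SR.
case: prim; exists (R *m e *m S); split=> //.
- by rewrite !mulmxA -[_ *m S *m R]mulmxA SR mulmx1 -[R *m e *m e]mulmxA ee.
- by rewrite -mulmxA Sf.
by rewrite !mulmxA fR.
Qed.

End PrimitiveCorner.

(* A frame of an idempotent [f] splits [F^N f] into [k] copies of [F^l]; entrywise it is the pair of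
   block matrices (A_0 ... A_(k-1)) and (B_0 ... B_(k-1))^T. *)
Section Frames.

Variables (F : fieldType) (N l : nat).

Definition is_frame (k : nat) (f : 'M[F]_N) (A : 'I_k -> 'M[F]_(N, l))
    (B : 'I_k -> 'M[F]_(l, N)) :=
  (forall i j, B i *m A j = if i == j then 1%:M else 0) /\ \sum_i A i *m B i = f.

Lemma frame_mull k f (A : 'I_k -> 'M[F]_(N, l)) B j : is_frame f A B -> f *m A j = A j.
Proof.
case=> BA <-; rewrite mulmx_suml (bigD1 j) //= -mulmxA BA eqxx mulmx1 big1 ?addr0 //.
by move=> i /negPf ij; rewrite -mulmxA BA ij mulmx0.
Qed.

Lemma frame_mulr k f (A : 'I_k -> 'M[F]_(N, l)) B j : is_frame f A B -> B j *m f = B j.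
Proof.
case=> BA <-; rewrite mulmx_sumr (bigD1 j) //= mulmxA BA eqxx mul1mx big1 ?addr0 //.
by move=> i /negPf ij; rewrite mulmxA BA eq_sym ij mul0mx.
Qed.

Lemma mulmx_blocks k (A : 'I_k -> 'M[F]_(N, l)) (B : 'I_k -> 'M[F]_(l, N)) :
  (\matrix_(i < N, c < (k * l)%N) A (mxtens_unindex c).1 i (mxtens_unindex c).2) *m
  (\matrix_(c < (k * l)%N, j < N) B (mxtens_unindex c).1 (mxtens_unindex c).2 j)
  = \sum_i A i *m B i.
Proof.
apply/matrixP=> i j; rewrite mxE summxE.
rewrite (reindex (@mxtens_index k l)); last first.
  by exists (@mxtens_unindex k l) => x _; rewrite ?mxtens_indexK ?mxtens_unindexK.
rewrite (eq_bigr (fun c => A c.1 i c.2 * B c.1 c.2 j)) => [|c _]; last first.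
  by rewrite !mxE mxtens_indexK.
rewrite -(pair_bigA _ (fun a b => A a i b * B a b j)).
by apply: eq_bigr => a _; rewrite mxE.
Qed.

(** For the two block idempotents this gives the divisibility of [m] and [n] by the size of the
    corner. *)
Lemma frame_rank k f (A : 'I_k -> 'M[F]_(N, l)) B : is_frame f A B -> \rank f = (k * l)%N.
Proof.
case=> BA <-; rewrite -mulmx_blocks; apply: mxrank_retract.
apply/matrixP=> c d; rewrite mxE.
under eq_bigr do rewrite !mxE.
have := BA (mxtens_unindex c).1 (mxtens_unindex d).1.
move/matrixP/(_ (mxtens_unindex c).2 (mxtens_unindex d).2); rewrite mxE => ->.
rewrite mxE -(can_eq (@mxtens_unindexK k l) c d) -pair_eqE /=.
by case: eqP => _ /=; rewrite !mxE.
Qed.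

End Frames.

Section HomogeneousFrames.

Variables (F : closedFieldType) (N : nat) (G : zmodType).
Local Notation M := 'M[F]_N.
Variables (Gam : G -> {vspace M}) (gradG : mx_grading Gam).
Variables (l : nat) (R : 'M[F]_(N, l.+1)) (S : 'M[F]_(l.+1, N)).
Hypotheses (RS0 : R *m S \in Gam 0) (SR : S *m R = 1%:M).
Hypothesis prim : forall e, e \in corner_grading Gam R S 0 -> e *m e = e -> e = 0 \/ e = 1%:M.

Let gradD := corner_mx_grading gradG RS0 SR.

Lemma mulmx_corner g h (x : 'M_(N, l.+1)) (y : 'M_(l.+1, N)) :
  x *m S \in Gam g -> R *m y \in Gam h -> x *m y \in Gam (g + h).
Proof.
move=> xg yh; have := grading_mul gradG xg yh.
by rewrite mulmxA -[x *m S *m R]mulmxA SR mulmx1.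
Qed.

(** Copies of the corner are peeled off [f]. Since the matrix algebra is simple,
    [S *m x *m f *m y *m R] is nonzero for some homogeneous [x] and [y]; it is a homogeneous element
    of the corner, hence invertible, and dividing by it makes [f *m y *m R] and [S *m x *m f] a dual
    pair. What remains of [f] is an idempotent of smaller rank. *)
Lemma homogeneous_frame (f : M) : f \in Gam 0 -> f *m f = f ->
  exists k (A : 'I_k -> 'M[F]_(N, l.+1)) (B : 'I_k -> 'M[F]_(l.+1, N)) (gam : 'I_k -> G),
    is_frame f A B /\
    forall i, A i *m S \in Gam (gam i) /\ R *m B i \in Gam (- gam i).
Proof.
have [r] := ubnP (\rank f); elim: r f => // r IH f; rewrite ltnS => rkf f0 ff.
have [fz|fn0] := eqVneq f 0.
  exists 0%N, (fun=> 0), (fun=> 0), (fun=> 0); split; last by case.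
  by split; [case | rewrite big_ord0 fz].
have [s [p [_ pV pS _]]] := mx_grading_proj gradG.
have [[x [g [y [h [xg yh d0]]]]] | none] := classic (exists x g y h,
    [/\ x \in Gam g, y \in Gam h & S *m x *m f *m y *m R != 0]); last first.
  have z x y : S *m x *m f *m y *m R = 0.
    rewrite (pS x) mulmx_sumr !mulmx_suml; apply: big1 => g _.
    rewrite (pS y) mulmx_sumr mulmx_suml; apply: big1 => h _.
    by apply/eqP/negPn/negP => d0; case: none; exists (p g x), g, (p h y), h.
  case/negP: fn0; apply/eqP/matrixP=> u v; rewrite mxE.
  have Sn0 : S != 0.
    by apply: contraNneq (oner_neq0 'M[F]_l.+1) => S0; rewrite -[1]/(1%:M) -SR S0 mul0mx.
  have Rn0 : R != 0.
    by apply: contraNneq (oner_neq0 'M[F]_l.+1) => R0; rewrite -[1]/(1%:M) -SR R0 mulmx0.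
  (* With matrix units for [x] and [y], one entry of the product is [f u v] times a nonzero entry of
     [S] and a nonzero entry of [R]. *)
  have /matrix0Pn[i [j Sij]] := Sn0; have /matrix0Pn[c [d Rcd]] := Rn0.
  have /matrixP/(_ i d) := z (delta_mx j u) (delta_mx v c).
  rewrite -!mulmxA mulmxA mxE (bigD1 u) //= big1 ?addr0 => [|w /negPf wu]; last first.
    rewrite mxE big1 ?mul0r // => t _; rewrite mxE eq_sym wu andbF mulr0 //.
  rewrite [X in X * _]mxE (bigD1 j) //= big1 ?addr0 => [|w /negPf wj]; last first.
    by rewrite mxE wj mulr0.
  rewrite mxE !eqxx mulr1 [X in _ * X]mxE (bigD1 v) //= big1 ?addr0 => [|w /negPf wv]; last first.
    by rewrite mxE big1 ?mulr0 // => t _; rewrite mxE wv mul0r.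
  rewrite [X in _ * (_ * X)]mxE (bigD1 c) //= big1 ?addr0 => [|w /negPf wc]; last first.
    by rewrite mxE wc andbF mul0r.
  rewrite !mxE !eqxx mul1r => /eqP; rewrite !mulf_eq0 (negPf Sij) (negPf Rcd) orbF /=.
  by move/eqP.
set d := S *m x *m f *m y *m R in d0.
have dD : d \in corner_grading Gam R S (g + h).
  rewrite mem_corner (_ : R *m d *m S = (R *m S) *m x *m f *m y *m (R *m S)); last first.
    by rewrite /d !mulmxA.
  rewrite (_ : g + h = 0 + g + 0 + h + 0); last by rewrite !addr0 add0r.
  by do !apply: (grading_mul gradG).
have Ud := homogeneous_unit gradD prim dD d0.
have := homogeneous_invmx gradD dD Ud; rewrite mem_corner => idD.
pose A0 := f *m y *m R; pose B0 := invmx d *m S *m x *m f.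
have fA0 : f *m A0 = A0 by rewrite /A0 !mulmxA ff.
have B0f : B0 *m f = B0 by rewrite /B0 -mulmxA ff.
have BA0 : B0 *m A0 = 1%:M.
  rewrite -(mulVmx Ud) /B0 /A0 -!mulmxA; congr (_ *m _).
  by rewrite /d -!mulmxA [f *m (f *m _)]mulmxA ff.
have A0S : A0 *m S \in Gam h.
  rewrite /A0 -mulmxA (_ : h = 0 + h + 0); last by rewrite addr0 add0r.
  by do !apply: (grading_mul gradG).
have RB0 : R *m B0 \in Gam (- h).
  rewrite /B0 !mulmxA (_ : - h = - (g + h) + g + 0); last first.
    by rewrite addr0 opprD addrAC addNr add0r.
  by apply: (grading_mul gradG) f0; apply: (grading_mul gradG) xg.
clearbody A0 B0.
pose f' := f - A0 *m B0.
have f'0 : f' \in Gam 0.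
  by rewrite memvB // -[X in Gam X](subrr h) mulmx_corner.
have fAB : f *m (A0 *m B0) = A0 *m B0 by rewrite mulmxA fA0.
have ABf : A0 *m B0 *m f = A0 *m B0 by rewrite -mulmxA B0f.
have ABAB : A0 *m B0 *m (A0 *m B0) = A0 *m B0.
  by rewrite mulmxA -[_ *m B0 *m A0]mulmxA BA0 mulmx1.
have f'f : f' *m f = f' by rewrite mulmxBl ff ABf.
have ff' : f *m f' = f' by rewrite mulmxBr ff fAB.
have f'f' : f' *m f' = f'.
  by rewrite {2}/f' mulmxBr f'f mulmxBl fAB ABAB subrr subr0.
have nf' : f' != f.
  rewrite -subr_eq0 addrAC subrr sub0r oppr_eq0.
  apply: contraNneq (oner_neq0 'M[F]_l.+1) => AB0.
  have <- : B0 *m (A0 *m B0) *m A0 = 1 by rewrite mulmxA BA0 mul1mx; apply: BA0.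
  by rewrite AB0 mulmx0 mul0mx.
have rk' := leq_trans (idem_rank_ltn f'f ff' f'f' nf') rkf.
have [k [A [B [gam [frAB homAB]]]]] := IH f' rk' f'0 f'f'.
have B0f' : B0 *m f' = 0 by rewrite mulmxBr B0f mulmxA BA0 mul1mx subrr.
have f'A0 : f' *m A0 = 0 by rewrite mulmxBl fA0 -mulmxA BA0 mulmx1 subrr.
exists k.+1, (fun i => oapp A A0 (unlift ord0 i)), (fun i => oapp B B0 (unlift ord0 i)),
  (fun i => oapp gam h (unlift ord0 i)); split; last first.
  by move=> i; case: unliftP => [j|] _ /=.
split=> [i j|]; last first.
  rewrite big_ord_recl unlift_none /= (eq_bigr (fun i => A i *m B i)) => [|i _].
    by rewrite (frAB.2) addrC subrK.
  by rewrite liftK.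
case: (unliftP ord0 i) => [i'|] ->; case: (unliftP ord0 j) => [j'|] -> /=.
- by rewrite (frAB.1) (inj_eq (@lift_inj _ _)).
- by rewrite -(frame_mulr i' frAB) -mulmxA f'A0 mulmx0.
- by rewrite -(frame_mull j' frAB) mulmxA B0f' mul0mx.
by rewrite BA0.
Qed.

End HomogeneousFrames.

(** * A frame of the identity adapted to both blocks *)

Section FrameData.

Variables (F : closedFieldType) (m n : nat) (G : zmodType).
Local Notation M := 'M[F]_(m + n).
Variable (Gam : G -> {vspace M}).

(** The corner is cut out below [blk false] only, yet it serves the frames of both block
    idempotents. Their concatenation has its first [fd_k0] members in the block of size [m]. The
    corner size is a successor because the corner idempotent is nonzero. *)
Record frame_data := FrameData {
  fd_l : nat;
  fd_R : 'M[F]_(m + n, fd_l.+1);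
  fd_S : 'M[F]_(fd_l.+1, m + n);
  fd_k0 : nat;
  fd_k1 : nat;
  fd_A : 'I_(fd_k0 + fd_k1) -> 'M[F]_(m + n, fd_l.+1);
  fd_B : 'I_(fd_k0 + fd_k1) -> 'M[F]_(fd_l.+1, m + n);
  fd_deg : 'I_(fd_k0 + fd_k1) -> G;
  fd_RS : fd_R *m fd_S \in Gam 0;
  fd_SR : fd_S *m fd_R = 1%:M;
  fd_eR : block_idem F m n false *m fd_R = fd_R;
  fd_prim : forall e, e \in corner_grading Gam fd_R fd_S 0 -> e *m e = e ->
    e = 0 \/ e = 1%:M;
  fd_m : m = (fd_k0 * fd_l.+1)%N;
  fd_n : n = (fd_k1 * fd_l.+1)%N;
  fd_frame : is_frame 1%:M fd_A fd_B;
  fd_block : forall i : 'I_(fd_k0 + fd_k1), block_idem F m n (fd_k0 <= i)%N *m fd_A i = fd_A i;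
  fd_homA : forall i, fd_A i *m fd_S \in Gam (fd_deg i);
  fd_homB : forall i, fd_R *m fd_B i \in Gam (- fd_deg i)
}.

Lemma block_idem_rank b : \rank (block_idem F m n b) = if b then n else m.
Proof.
pose X b : 'M[F]_(m + n, if b then n else m) :=
  if b return 'M[F]_(m + n, if b then n else m) then col_mx 0 1%:M else col_mx 1%:M 0.
have XX : (X b)^T *m X b = 1%:M.
  by case: b; rewrite /X tr_col_mx mul_row_col trmx0 trmx1 mul0mx mul1mx ?addr0 ?add0r.
rewrite -[RHS](mxrank_retract XX); congr (\rank _).
apply/matrixP=> i j; rewrite -(splitK i) -(splitK j).
case: b {XX}; rewrite /X tr_col_mx mul_col_row trmx0 trmx1 !(mul0mx, mulmx0, mul1mx);
case: (split i) => i'; case: (split j) => j'; rewrite /= ?block_mxEul ?block_mxEur ?block_mxEdl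
  ?block_mxEdr;
 rewrite !mxE ?eq_lrshift ?eq_rlshift ?(inj_eq (@lshift_inj _ _)) ?(inj_eq (@rshift_inj _ _)) //=;
 by rewrite /lower /= ?leq_addr ?(leqNgt m) ?ltn_ord ?andbT ?andbF.
Qed.

Lemma frame_data_exists : (0 < m)%N -> mx_grading Gam -> block_idem F m n false \in Gam 0 ->
  exists fd : frame_data, True.
Proof.
move=> m_gt0 gradG e00.
have eM b c := block_idemM F m n b c.
have [|l [R [S [RS SR eR Se prim]]]] := primitive_corner e00 (eM _ _).
  by rewrite -mxrank_eq0 block_idem_rank -lt0n.
have e10 : block_idem F m n true \in Gam 0.
  by have := grading_one gradG; rewrite -(block_idem_sum F m n) rpredDl.
have [k0 [A0 [B0 [g0 [fr0 hom0]]]]] := homogeneous_frame gradG RS SR prim e00 (eM _ _).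
have [k1 [A1 [B1 [g1 [fr1 hom1]]]]] := homogeneous_frame gradG RS SR prim e10 (eM _ _).
have mE := frame_rank fr0; have nE := frame_rank fr1.
rewrite !block_idem_rank in mE nE.
pose s (T : Type) (f0 : 'I_k0 -> T) (f1 : 'I_k1 -> T) (i : 'I_(k0 + k1)) :=
  match split i with inl j => f0 j | inr j => f1 j end.
have sl T f0 f1 j : s T f0 f1 (lshift _ j) = f0 j.
  by rewrite /s -[lshift _ j]/(unsplit (inl j)) unsplitK.
have sr T f0 f1 j : s T f0 f1 (rshift _ j) = f1 j.
  by rewrite /s -[rshift _ j]/(unsplit (inr j)) unsplitK.
unshelve eexists (@FrameData l R S k0 k1 (s _ A0 A1) (s _ B0 B1) (s _ g0 g1) _ _ _ _ _ _ _ _ _ _)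
  => //.
- split=> [i j|]; last first.
    rewrite big_split_ord /= -(block_idem_sum F m n) -fr0.2 -fr1.2.
    by congr (_ + _); apply: eq_bigr => i _; rewrite ?sl ?sr.
  rewrite -(splitK i) -(splitK j).
  case: (split i) => i'; case: (split j) => j' /=;
    rewrite ?sl ?sr ?eq_lrshift ?eq_rlshift ?(inj_eq (@lshift_inj _ _)) ?(inj_eq (@rshift_inj _ _)).
  + exact: fr0.1.
  + by rewrite -(frame_mulr i' fr0) -(frame_mull j' fr1) mulmxA -[_ *m _ *m block_idem _ _ _
    _]mulmxA eM mulmx0 mul0mx.
  + by rewrite -(frame_mulr i' fr1) -(frame_mull j' fr0) mulmxA -[_ *m _ *m block_idem _ _ _
    _]mulmxA eM mulmx0 mul0mx.
  exact: fr1.1.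
- move=> i; rewrite -(splitK i); case: (split i) => j /=; rewrite ?sl ?sr.
    by rewrite leqNgt ltn_ord; apply: frame_mull fr0.
  by rewrite leq_addr; apply: frame_mull fr1.
- by move=> i; rewrite -(splitK i); case: (split i) => j /=; rewrite ?sl ?sr;
  [case: (hom0 j) | case: (hom1 j)].
by move=> i; rewrite -(splitK i); case: (split i) => j /=; rewrite ?sl ?sr;
  [case: (hom0 j) | case: (hom1 j)].
Qed.

End FrameData.

Lemma Z2_eqE (x y : 'Z_2) : ((x != 0) == (y != 0)) = (x == y).
Proof. by case: x => [[|[|//]] ?]; case: y => [[|[|//]] ?]. Qed.

Lemma Z2_addE (x y : 'Z_2) : (x + y == 0) (+) (x != 0) = (y == 0).
Proof. by case: x => [[|[|//]] ?]; case: y => [[|[|//]] ?]. Qed.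

(** * Evenness of the gradings with a block idempotent of degree zero *)

Section ZsuperEven.

Variables (F : closedFieldType) (m n : nat) (G : zmodType).
Local Notation M := 'M[F]_(m + n).
Local Notation blk := (block_idem F m n).
Variables (Gam : G -> {vspace M}) (gradG : mx_grading Gam) (e00 : blk false \in Gam 0).
Variable (fd : frame_data Gam).

Local Notation l := (fd_l fd).
Local Notation R := (fd_R fd).
Local Notation S := (fd_S fd).
Local Notation A := (@fd_A _ _ _ _ _ fd).
Local Notation B := (@fd_B _ _ _ _ _ fd).
Local Notation gam := (@fd_deg _ _ _ _ _ fd).

Lemma parity_partP p (a : M) : reflect (blk false *m a = a *m blk (p != 0)) (a \in parity_part F
  m n p).
Proof.
rewrite parity_partE; apply: (iffP (mem_label_partP _ _ _)) => [a0|eqa i j].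
  apply/matrixP=> i j; rewrite block_idem_mull block_idem_mulr.
  have := a0 i j; rewrite /parity_label.
  by case: p {a0} => [[|[|//]] ?]; case: (lower i); case: (lower j) => //= ->.
have /matrixP/(_ i j) := eqa; rewrite block_idem_mull block_idem_mulr /parity_label.
by case: p {eqa} => [[|[|//]] ?]; case: (lower i); case: (lower j).
Qed.

Lemma parity_blk (p : 'Z_2) (a : M) b : blk false *m a = a *m blk (p != 0) ->
  blk b *m a = a *m blk (b (+) (p != 0)).
Proof.
case: b => //= ea; have bs := block_idem_sum F m n.
rewrite -[blk true](addKr (blk false)) bs mulmxDl mul1mx mulNmx ea.
rewrite -{2}[a]mulmx1 -bs; case: (p != 0) => /=; rewrite mulmxDr addrC ?addrK //.
by rewrite addrAC subrr add0r.
Qed.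

Definition fd_Dgr (k : G * 'Z_2) : {vspace 'M[F]_l.+1} :=
  if k.2 == 0 then corner_grading Gam R S k.1 else 0%VS.

(** [U] is the left ideal generated by the corner idempotent, seen through [R] and [S]. For parity 0
    it is [blk true] that has to kill [u], which leaves the rows of the block of size [m]. *)
Definition fd_Ugr (k : G * 'Z_2) : {vspace 'M[F]_(m + n, l.+1)} :=
  ((linfun (mulmxr S) @^-1: Gam k.1) :&: lker (linfun (mulmx (blk (k.2 == 0)%R))))%VS.

Lemma mem_Ugr k u : (u \in fd_Ugr k) = (u *m S \in Gam k.1) && (blk (k.2 == 0) *m u == 0).
Proof. by rewrite memv_cap -memv_preim memv_ker !lfunE. Qed.

Lemma blk_kerP b q (u : 'M[F]_(m + n, q)) : blk (~~ b) *m u = 0 -> blk b *m u = u.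
Proof.
move=> u0; rewrite -[RHS]mul1mx -(block_idem_sum F m n) mulmxDl.
by case: b u0 => /= ->; rewrite ?addr0 ?add0r.
Qed.

Lemma fd_Dgr_division : is_graded_division fd_Dgr.
Proof.
have gradD := corner_mx_grading gradG (fd_RS fd) (fd_SR fd).
split; last first.
  move=> [g p] d; rewrite /fd_Dgr /=; case: eqP => _; last first.
    by rewrite memv0 => /eqP->; rewrite eqxx.
  by move=> dg dn0; apply: (homogeneous_unit gradD (@fd_prim _ _ _ _ _ fd) dg dn0).
split=> [|[g p] [h q] a b]; last first.
  rewrite /fd_Dgr /=; case: (eqVneq p 0) => [->|_]; last first.
    by rewrite memv0 => /eqP-> _; rewrite mul0r mem0v.
  case: (eqVneq q 0) => [->|_]; last by rewrite memv0 => _ /eqP->; rewrite mulr0 mem0v.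
  by rewrite addr0 eqxx; apply: grading_mul.
have [s [p projD]] := mx_grading_proj gradD; have [Us pV pS pE] := projD.
apply: (@is_direct_sum_intro _ _ _ fd_Dgr fullv [seq (g, 0) | g <- s]
         (fun k a => if k.2 == 0 then p k.1 a else 0)).
- by rewrite map_inj_uniq // => g h [].
- move=> [g q]; rewrite /fd_Dgr /=; case: eqP => // -> gs.
  have {}gs : g \notin s by apply: contra gs => gs; apply: map_f.
  apply/eqP; rewrite -subv0; apply/subvP=> d dg; rewrite memv0.
  have := pE g g d dg; rewrite eqxx => <-.
  by rewrite (proj_out projD).
- by move=> k; apply: subvf.
- by move=> [g q] a _; rewrite /fd_Dgr /=; case: eqP; rewrite ?mem0v.
- by move=> a _; rewrite big_map; apply: pS.
move=> u uV; rewrite big_map => sum0 k /mapP[g gs ->].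
have := congr1 (p g) sum0; rewrite linear0 linear_sum /= (bigD1_seq g) //= big1 ?addr0.
  by rewrite (pE g) ?eqxx //; have := uV (g, 0); rewrite /fd_Dgr eqxx.
by move=> h /negPf hg; rewrite (pE h) ?hg //; have := uV (h, 0).
Qed.

Lemma fd_Ugr_module : is_graded_right_module (fun (u : 'M[F]_(m + n,
  l.+1)) (d : 'M[F]_l.+1) => u *m d) fd_Dgr fd_Ugr.
Proof.
have [s [p projG]] := mx_grading_proj gradG; have [Us pV pS pE] := projG.
split; first split.
- by move=> u c a b; rewrite mulmxDr -scalemxAr.
- by move=> d c a b; rewrite mulmxDl -scalemxAl.
- by move=> u; rewrite mulmx1.
- by move=> u a b; rewrite mulmxA.
- pose q (k : G * 'Z_2) (u : 'M[F]_(m + n, l.+1)) := blk (k.2 != 0) *m p k.1 (u *m S) *m R.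
  have pRS g a : p g (a *m (R *m S)) = p g a *m (R *m S).
    by rewrite (proj_mulr gradG projG _ _ (fd_RS fd)) subr0.
  have qS k u : q k u *m S = blk (k.2 != 0) *m p k.1 (u *m S).
    rewrite /q -!mulmxA -pRS; congr (_ *m p _ _).
    by rewrite -[u *m S *m _]mulmxA [S *m _]mulmxA (fd_SR fd) mul1mx.
  have e0b b : blk b \in Gam 0.
    case: b => //; have := grading_one gradG.
    by rewrite -(block_idem_sum F m n) rpredDl.
  have Us2 : uniq [seq (g, z) | g <- s, z <- [:: 0 : 'Z_2; 1]].
    by apply: allpairs_uniq => // -[? ?] [? ?].
  apply: (@is_direct_sum_intro _ _ _ _ _ [seq (g, z) | g <- s, z <- [:: 0; 1]] q).
  + exact: Us2.
  + move=> [g z] gz; have gs : g \notin s.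
      apply: contra gz => gs; apply/allpairsP; exists (g, z); split=> //.
      by case: z => [[|[|//]] ?].
    apply/eqP; rewrite -subv0; apply/subvP=> u; rewrite mem_Ugr memv0 => /andP[ug _].
    have := pE g g _ ug; rewrite eqxx (proj_out projG) // => /esym uS0.
    by rewrite -[u]mulmx1 -(fd_SR fd) mulmxA uS0 mul0mx.
  + by move=> k; apply: subvf.
  + move=> [g z] u _; rewrite mem_Ugr qS /= -[X in Gam X]add0r grading_mul //=.
    by rewrite /q !mulmxA block_idemM; case: (z == 0); rewrite !mul0mx.
  + move=> u _; rewrite big_allpairs /=.
    transitivity (\sum_(g <- s) p g (u *m S) *m R).
      by rewrite -mulmx_suml -pS -mulmxA (fd_SR fd) mulmx1.
    apply: eq_bigr => g _; rewrite !big_cons big_nil addr0 /q /= -!mulmxDl.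
    by rewrite (block_idem_sum F m n) mul1mx.
  move=> u uV sum0 [g z] gz; pose f (w : 'M[F]_(m + n, l.+1)) := p g (blk (z != 0) *m w *m S).
  have f_lin : linear f.
    by move=> c a b; rewrite /f mulmxDr mulmxDl -scalemxAr -scalemxAl linearP.
  have fE k w : w \in fd_Ugr k -> f w = if k == (g, z) then w *m S else 0.
    rewrite mem_Ugr => /andP[wk /eqP w0]; rewrite /f.
    have wb : blk (k.2 != 0) *m w = w by apply: blk_kerP; rewrite negbK.
    have zw : blk (z != 0) *m w = if (z != 0) == (k.2 != 0) then w else 0.
      by rewrite -{1}wb mulmxA block_idemM; case: eqP => [->|]; rewrite ?wb ?mul0mx.
    rewrite -pair_eqE /= [k.2 == z]eq_sym -[z == k.2]Z2_eqE zw.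
    by case: eqP => _; rewrite ?mul0mx ?linear0 ?andbF // andbT (pE k.1).
  have := congr1 f sum0; rewrite !linear_fun_sum // (linear_fun0 f_lin).
  rewrite (bigD1_seq (g, z)) //= ?Us2 //.
  rewrite big1 ?addr0 => [|k /negPf kgz]; last by rewrite (fE k) // kgz.
  rewrite (fE (g, z)) // eqxx => uS0.
  by rewrite -[u _]mulmx1 -(fd_SR fd) mulmxA uS0 mul0mx.
move=> [g z] [h y] u d; rewrite /fd_Dgr !mem_Ugr /=; case: (eqVneq y 0) => [->|_]; last first.
  by rewrite memv0 => _ /eqP->; rewrite mulmx0 mul0mx mulmx0 mem0v eqxx.
case/andP=> ug /eqP u0; rewrite mem_corner => dh; rewrite mulmxA addr0 u0 mul0mx eqxx andbT.
have := grading_mul gradG ug dh.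
by rewrite !mulmxA -[_ *m S *m R]mulmxA (fd_SR fd) mulmx1.
Qed.

Lemma Zsuper_is_even : is_even Gam.
Proof.
pose U := 'M[F]_(m + n, l.+1).
have Lmul (a : M) (u : U) : linfun (mulmx a) u = a *m u by rewrite lfunE.
pose ph (a : M) : 'End(U) := linfun (mulmx a).
have ph_lin : linear ph.
  by move=> c a b; apply/lfunP => u; rewrite add_lfunE scale_lfunE !Lmul mulmxDl -scalemxAl.
pose phl : {linear M -> 'End(U)} := HB.pack ph (GRing.isLinear.Build _ _ _ _ ph ph_lin).
pose phi := linfun phl.
have phiE a u : phi a u = a *m u by rewrite lfunE /= /ph Lmul.
have [BA AB] := fd_frame fd.
exists _, fd_Dgr, U, (fun u d => u *m d), fd_Ugr, phi; split.
- exact: fd_Dgr_division.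
- exact: fd_Ugr_module.
- split.
  + move=> a b eq_ab; rewrite -[a]mulmx1 -[b]mulmx1 -AB !mulmx_sumr.
    by apply: eq_bigr => i _; rewrite !mulmxA -!phiE eq_ab.
  + move=> f; split=> [f_lin | [a <-] u d]; last by rewrite !phiE mulmxA.
    (* The members [A i] of the frame generate [U] over [D], with coordinates given by the [B i], so
       a [D]-linear map is multiplication by this matrix. *)
    exists (\sum_i f (A i) *m B i); apply/lfunP=> u; rewrite phiE mulmx_suml.
    rewrite -{2}[u]mul1mx -AB mulmx_suml linear_sum; apply: eq_bigr => i _ /=.
    by rewrite -!mulmxA f_lin.
  + by apply/lfunP=> u; rewrite phiE mul1mx id_lfunE.
  by move=> a b; apply/lfunP=> u; rewrite comp_lfunE !phiE mulmxA.
- move=> [g z] a; rewrite memv_cap /=; split=> [/andP[ag /parity_partP az] | deg_a].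
    move=> [h y] u; rewrite !mem_Ugr phiE /= => /andP[uh /eqP u0].
    rewrite -mulmxA grading_mul //=.
    by rewrite mulmxA (parity_blk _ az) Z2_addE -mulmxA u0 mulmx0.
  (* The frame members are homogeneous in [U], and [a] is the sum of the [a *m A i *m B i]; its
     degree and parity are therefore visible on the frame. *)
  have aA i : a *m A i \in fd_Ugr ((g, z) + (gam i, if (fd_k0 fd <= i)%N then 1 else 0)).
    rewrite -phiE; apply: deg_a; rewrite mem_Ugr /= fd_homA /=.
    by rewrite -(fd_block i) mulmxA block_idemM; case: (_ <= _)%N; rewrite /= mul0mx.
  apply/andP; split.
    rewrite -[a]mulmx1 -AB mulmx_sumr; apply: memv_suml => i _; rewrite mulmxA.
    have := aA i; rewrite mem_Ugr => /andP[/= aAi _].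
    rewrite -[g](addrK (gam i)); apply: (mulmx_corner gradG (fd_SR fd)) => //.
    exact: fd_homB.
  apply/parity_partP; rewrite -[LHS]mulmx1 -[RHS]mulmx1 -AB !mulmx_sumr.
  apply: eq_bigr => i _; rewrite !mulmxA; congr (_ *m _).
  have := aA i; rewrite mem_Ugr => /andP[_ /eqP /=].
  have -> : a *m blk (z != 0) *m A i = if (z != 0) == (fd_k0 fd <= i)%N then a *m A i else 0.
    rewrite -mulmxA -{1}(fd_block i) [blk _ *m (_ *m _)]mulmxA block_idemM.
    by case: eqP => [->|_]; rewrite ?fd_block // mul0mx mulmx0.
  rewrite -mulmxA.
  case: (fd_k0 fd <= i)%N (fd_block i) => Ai;
    have [->|->] : z = 0 \/ z = 1 by case: z {deg_a aA} => [[|[|//]] ?]; [left | right];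
      apply: val_inj.
  - by rewrite add0r.
  - by rewrite /= => /(@blk_kerP false _ _)->.
  - by rewrite addr0 /= => /(@blk_kerP false _ _)->.
  by rewrite addr0.
by move=> g p; rewrite /fd_Dgr /=; case: ifP => [/eqP //|_]; rewrite eqxx.
Qed.

End ZsuperEven.

(** * Counting characters of a finite group *)

Section CharacterCount.

Variables (F : fieldType) (gT : finGroupType) (G : {group gT}).

Lemma sum_group_char (f : gT -> F) :
    {in G &, forall x y, f (x * y)%g = f x * f y} ->
  forall y, y \in G -> f y != 1 -> \sum_(x in G) f x = 0.
Proof.
move=> fM y Gy fy; have : f y * (\sum_(x in G) f x) = \sum_(x in G) f x.
  rewrite mulr_sumr [RHS](reindex_inj (mulgI y)) /=.
  by apply: eq_big => [x|x Gx]; rewrite ?fM // groupMl.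
by move/eqP; rewrite -subr_eq0 -{2}[\sum_(x in G) f x]mul1r -mulrBl mulf_eq0 subr_eq0 (negPf fy)
  => /eqP.
Qed.

(* Linear independence of characters, through their orthogonality. *)
Lemma card_group_chars (I : finType) (f : I -> gT -> F) :
    #|G|%:R != 0 :> F ->
    (forall i, {in G &, forall x y, f i (x * y)%g = f i x * f i y}) ->
    (forall i, f i 1%g = 1) ->
    (forall i j, {in G, f i =1 f j} -> i = j) ->
  (#|I| <= #|G|)%N.
Proof.
move=> G0 fM f1 f_inj.
have fV i x : x \in G -> f i x * f i x^-1%g = 1.
  by move=> Gx; rewrite -fM ?groupV // mulgV f1.
pose M := \matrix_(i < #|I|, x < #|G|) f (enum_val i) (enum_val x).
pose M' := \matrix_(x < #|G|, i < #|I|) f (enum_val i) (enum_val x)^-1%g.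
have MM : M *m M' = #|G|%:R%:M.
  apply/matrixP=> i j; rewrite mxE.
  under eq_bigr do rewrite !mxE.
  rewrite -(big_enum_val (fun x => f (enum_val i) x * f (enum_val j) x^-1%g)) mxE.
  have [<-|ij] := eqVneq i j.
    by rewrite (eq_bigr (fun=> 1)) ?sumr_const // => x; apply: fV.
  have [y [Gy fij]] : exists y, y \in G /\ f (enum_val i) y != f (enum_val j) y.
    apply: NNPP => none; case/eqP: ij; apply: enum_val_inj; apply: f_inj => y Gy.
    by apply/eqP/negPn/negP => fij; apply: none; exists y.
  apply: (@sum_group_char (fun x => f (enum_val i) x * f (enum_val j) x^-1%g) _ y) => //.
    move=> x z Gx Gz; rewrite invMg !fM ?groupV // -!mulrA; congr (_ * _).
    by rewrite [RHS]mulrC -mulrA.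
  apply: contra fij => /eqP fij1.
  by rewrite -[f (enum_val i) y]mulr1 -(fV (enum_val j) y Gy) mulrCA fij1 mulr1.
have : (\rank (#|G|%:R%:M : 'M[F]_#|I|) <= #|G|)%N.
  by rewrite -MM (leq_trans (mxrankM_maxl _ _)) ?rank_leq_col.
by rewrite -scalemx1 mxrank_scale_nz ?mxrank1.
Qed.

End CharacterCount.

Lemma expr_coprime1 (F : fieldType) (z : F) (i j : nat) : (0 < i)%N ->
  z ^+ i = 1 -> z ^+ j = 1 -> coprime i j -> z = 1.
Proof.
move=> i_gt0 zi zj /(coprimeP _ i_gt0)[[u v] /= uv].
have {uv} uv : (u * i = v * j + 1)%N.
  by rewrite -uv subnKC // ltnW // -subn_gt0 uv.
by have := congr1 (GRing.exp z) uv; rewrite exprD expr1 !(mulnC _ i,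
  mulnC _ j) !exprM zi zj !expr1n mul1r.
Qed.

(** * Lagrangian decomposition for a nondegenerate alternating bicharacter *)

Section Lagrangian.

Variables (F : fieldType) (T : finZmodType) (b : T -> T -> F).
Hypotheses (bDl : forall x y z, b (x + y) z = b x z * b y z)
  (bDr : forall x y z, b x (y + z) = b x y * b x z)
  (balt : forall x, b x x = 1).

Lemma alt_form0l y : b 0 y = 1.
Proof. by have := bDl 0 y y; rewrite add0r balt mulr1 => <-. Qed.

Lemma alt_form0r y : b y 0 = 1.
Proof. by have := bDr y 0 y; rewrite add0r balt mulr1 => <-. Qed.

Lemma alt_form_skew x y : b x y * b y x = 1.
Proof. by have := balt (x + y); rewrite bDl !bDr !balt mul1r mulr1. Qed.

Lemma alt_form_sym1 x y : b x y = 1 -> b y x = 1.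
Proof. by move=> bxy; have := alt_form_skew x y; rewrite bxy mul1r. Qed.

Lemma alt_formMn x y i : b (x *+ i) y = b x y ^+ i.
Proof. by elim: i => [|i IH]; rewrite ?alt_form0l // mulrSr bDl IH exprSr. Qed.

Lemma alt_formMnr x y i : b x (y *+ i) = b x y ^+ i.
Proof. by elim: i => [|i IH]; rewrite ?alt_form0r // mulrSr bDr IH exprSr. Qed.

Lemma alt_formN x y : b (- x) y * b x y = 1.
Proof. by rewrite -bDl addNr alt_form0l. Qed.

Hypothesis bnondeg : forall x, (forall y, b x y = 1) -> x = 0.

(** In characteristic p dividing the order, an element [x] of order p has all values [b x y] p-th
    roots of unity; the Frobenius map is injective, so they are 1 and [x] lies in the radical. *)
Lemma nondegenerate_pchar : #|T|%:R != 0 :> F.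
Proof.
apply/negP => T0; have cT : (0 < #|T|)%N by apply/card_gt0P; exists 0.
have [p pF] := natf0_pchar cT T0.
have p_pr := pcharf_prime pF.
have /(Cauchy p_pr)[x _ ox] : (p %| #|[set: T]|)%N by rewrite cardsT (dvdn_pcharf pF).
have : (1 < #[x]%g)%N by rewrite ox prime_gt1.
suff -> : x = 1%g by rewrite order1.
apply: bnondeg => y; apply/eqP; rewrite -subr_eq0.
have: pFrobenius_aut pF (b x y - 1) == 0.
  rewrite rmorphB rmorph1 /= pFrobenius_autE -alt_formMn -ox.
  by rewrite -[x *+ _]/(x ^+ _)%g expg_order alt_form0l subrr.
by rewrite pFrobenius_autE expf_eq0 prime_gt0.
Qed.

Definition isotropic (K : {set T}) := {in K &, forall x y, b x y = 1}.

(** Two isotropic subgroups in duality span a hyperbolic subgroup, which gets enlarged until it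
    fills T. *)
Definition perfect_pair (K L : {group T}) :=
  [/\ isotropic K, isotropic L,
      forall x, x \in K -> (forall y, y \in L -> b x y = 1) -> x = 0
    & forall y, y \in L -> (forall x, x \in K -> b x y = 1) -> y = 0].

Lemma card_group_neq0 (K : {group T}) : #|K|%:R != 0 :> F.
Proof.
have /dvdnP[d cT] : (#|K| %| #|T|)%N by rewrite -cardsT (cardSg (subsetT K)).
by apply: contraNneq nondegenerate_pchar => K0; rewrite cT natrM K0 mulr0.
Qed.

Lemma perfect_card_leq (K L : {group T}) :
  (forall x, x \in K -> (forall y, y \in L -> b x y = 1) -> x = 0) -> (#|K| <= #|L|)%N.
Proof.
move=> inj; have -> : #|K| = #|{: {x : T | x \in K}}| by rewrite card_sig.
apply: (@card_group_chars F T L _ (fun k => b (val k))).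
- exact: card_group_neq0.
- by move=> k x y _ _; apply: bDr.
- by move=> k; apply: alt_form0r.
move=> k k' eqb; apply: val_inj; apply/eqP; rewrite -subr_eq0; apply/eqP; apply: inj.
  by rewrite (@groupMl _ K) ?(@groupV _ K) ?(valP k) ?(valP k').
by move=> y Ly; rewrite bDl eqb // mulrC alt_formN.
Qed.

(* An extra character of [L] besides those coming from [K] would violate the bound on their
   number. *)
Lemma perfect_represent (K L : {group T}) : perfect_pair K L ->
  forall t, exists2 k, k \in K & forall y, y \in L -> b t y = b k y.
Proof.
move=> [_ _ injK injL] t; apply: NNPP => none.
have leLK : (#|L| <= #|K|)%N.
  by apply: perfect_card_leq => y Ly yK; apply: injL => // x Kx; apply: alt_form_sym1; apply: yK.
have : (#|{: option {x : T | x \in K}}| <= #|L|)%N.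
  apply: (@card_group_chars F T L _ (fun k => b (oapp val t k))).
  - exact: card_group_neq0.
  - by move=> k x y _ _; apply: bDr.
  - by move=> k; apply: alt_form0r.
  have none' k : {in L, b t =1 b (val k)} -> k = k :> {x : T | x \in K} -> False.
    by move=> tk _; apply: none; exists (val k); [apply: valP | apply: tk].
  case=> [k|] [k'|] //= eqb.
  - congr Some; apply: val_inj; apply/eqP; rewrite -subr_eq0; apply/eqP; apply: injK.
      by rewrite (@groupMl _ K) ?(@groupV _ K) ?(valP k) ?(valP k').
    by move=> y Ly; rewrite bDl eqb // mulrC alt_formN.
  - by case: (none' k) => // y Ly; rewrite eqb.
  by case: (none' k').
by rewrite card_option card_sig ltnNge leLK.
Qed.

Lemma perfect_pair_sym (K L : {group T}) : perfect_pair K L -> perfect_pair L K.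
Proof.
move=> [iK iL injK injL]; split=> // [y Ly yK|x Kx xL].
  by apply: injL => // x Kx; apply: alt_form_sym1; apply: yK.
by apply: injK => // y Ly; apply: alt_form_sym1; apply: xL.
Qed.

Lemma perfect_decomp (K L : {group T}) : perfect_pair K L -> forall t, exists k l w,
  [/\ t = k + l + w, k \in K, l \in L
    & forall x, (x \in K) || (x \in L) -> b w x = 1].
Proof.
move=> pKL t; have [iK iL _ _] := pKL.
have [k Kk tk] := perfect_represent pKL t.
have [l Ll tl] := perfect_represent (perfect_pair_sym pKL) t.
exists k, l, (t - (k + l)); split=> //; first by rewrite addrC subrK.
move=> x xKL; rewrite bDl; suff -> : b t x = b (k + l) x by rewrite mulrC alt_formN.
rewrite bDl; case/orP: xKL => [Kx | Lx].
  by rewrite (iK k x) // mul1r tl.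
by rewrite (iL l x) // mulr1 tk.
Qed.

(** The assumption on [b a x] makes its order exactly [p ^ r.+1], which bounds the orders of [a] and
    [x]: a multiple of one of them that pairs trivially with the other is already zero, so the new
    cyclic factors are in duality. *)
Lemma perfect_pair_extend (K L : {group T}) (a x : T) (p r : nat) :
    perfect_pair K L -> prime p ->
    (forall z, (z \in K) || (z \in L) -> b a z = 1) ->
    (forall z, (z \in K) || (z \in L) -> b x z = 1) ->
    a *+ (p ^ r.+1)%N = 0 -> x *+ (p ^ r.+1)%N = 0 -> b a x ^+ (p ^ r)%N != 1 ->
  perfect_pair (K <*> <[a]>)%G (L <*> <[x]>)%G /\ (#|K| < #|(K <*> <[a]>)%g|)%N.
Proof.
move=> [iK iL injK injL] p_pr aKL xKL ae xe bax.
have ord_bax i : b a x ^+ i = 1 -> (p ^ r.+1 %| i)%N.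
  move=> bi; have be : b a x ^+ (p ^ r.+1)%N = 1 by rewrite -alt_formMn ae alt_form0l.
  have pe : (0 < p ^ r.+1)%N by rewrite expn_gt0 prime_gt0.
  have [d d_prim /(dvdn_pfactor _ _ p_pr)[s]] := prim_order_exists pe be.
  rewrite leq_eqVlt => /orP[/eqP-> dE | sr dE].
    by rewrite -dE (prim_order_dvd d_prim) bi.
  case/eqP: bax; apply/eqP; rewrite -(prim_order_dvd d_prim) dE.
  by rewrite dvdn_exp2l.
have joinP (A : {group T}) (c z : T) : z \in (A <*> <[c]>)%g ->
    exists k i, k \in A /\ z = k + c *+ i.
  rewrite cent_joinEr; last exact: sub_abelian_cent2 (FinRing.zmod_abelian [set: T]) (subsetT _)
    (subsetT _).
  by case/mulsgP=> k _ Ak /cycleP[i ->] ->; exists k, i.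
have aK : a \notin K.
  apply: contra bax => aK; rewrite (injK a aK) ?alt_form0l ?expr1n // => y Ly.
  by apply: aKL; rewrite Ly orbT.
split; last first.
  apply: proper_card; rewrite properE joing_subl /=.
  by apply: contra aK => /subsetP; apply; apply: (subsetP (joing_subr _ _)); apply: cycle_id.
have bxa z : (z \in K) || (z \in L) -> b z x = 1 /\ b z a = 1.
  by move=> zKL; split; apply: alt_form_sym1; [apply: xKL | apply: aKL].
split.
- move=> _ _ /joinP[k [i [Kk ->]]] /joinP[k' [j [Kk' ->]]].
  rewrite bDl !bDr !alt_formMn !alt_formMnr balt iK // aKL ?Kk' //.
  by rewrite (bxa k _).2 ?Kk // !expr1n !mulr1.
- move=> _ _ /joinP[k [i [Lk ->]]] /joinP[k' [j [Lk' ->]]].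
  rewrite bDl !bDr !alt_formMn !alt_formMnr balt iL // xKL ?Lk' ?orbT //.
  by rewrite (bxa k _).1 ?Lk ?orbT // !expr1n !mulr1.
- move=> _ /joinP[k [i [Kk ->]]] kaL.
  have k0 : k = 0.
    apply: injK => // y Ly; have := kaL y; rewrite bDl alt_formMn aKL ?Ly ?orbT //.
    by rewrite expr1n mulr1; apply; apply: (subsetP (joing_subl _ _)).
  rewrite k0 add0r in kaL *; have /ord_bax/dvdnP[c ->] : b a x ^+ i = 1.
    rewrite -alt_formMn; apply: kaL.
    by apply: (subsetP (joing_subr _ _)); apply: cycle_id.
  by rewrite mulnC mulrnA ae mul0rn.
move=> _ /joinP[k [i [Lk ->]]] kxK.
have k0 : k = 0.
  apply: injL => // y Ky; have := kxK y; rewrite bDr alt_formMnr (bxa y _).1 ?Ky //.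
  by rewrite expr1n mulr1; apply; apply: (subsetP (joing_subl _ _)).
rewrite k0 add0r in kxK *; have /ord_bax/dvdnP[c ->] : b a x ^+ i = 1.
  rewrite -alt_formMnr; apply: kxK.
  by apply: (subsetP (joing_subr _ _)); apply: cycle_id.
by rewrite mulnC mulrnA xe mul0rn.
Qed.

Definition orth_set (K L : {group T}) : {set T} :=
  [set w | [forall x, (x \in K) || (x \in L) ==> (b w x == 1)]].

Lemma orth_setP (K L : {group T}) w : reflect (forall x,
  (x \in K) || (x \in L) -> b w x = 1) (w \in orth_set K L).
Proof.
rewrite inE; apply: (iffP forallP) => [h x xKL | h x].
  by have /implyP/(_ xKL)/eqP := h x.
by apply/implyP => xKL; rewrite h.
Qed.

Fact orth_group_set (K L : {group T}) : group_set (orth_set K L).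
Proof.
apply/group_setP; split; first by apply/orth_setP => x _; apply: alt_form0l.
move=> x y /orth_setP xo /orth_setP yo; apply/orth_setP=> z zKL.
by rewrite bDl xo // yo // mulr1.
Qed.

(** If the orthogonal complement [W] of the current pair is nontrivial, it contains a hyperbolic
    pair: an element [a] of largest order in a Sylow subgroup of [W] and a partner on which it takes
    a value of the same order. *)
Lemma exists_lagrangian_pair : exists K L : {group T}, perfect_pair K L /\
  forall t, exists k l, [/\ t = k + l, k \in K & l \in L].
Proof.
have p11 : perfect_pair 1%G 1%G.
  split=> [x y /set1P-> /set1P->|x y /set1P-> /set1P->|x /set1P-> //|x /set1P-> //];
  exact: alt_form0l.
suff ind d : forall K L : {group T}, (#|T| - #|K| < d)%N -> perfect_pair K L ->
    exists K L : {group T}, perfect_pair K L /\ forall t, exists k l, [/\ t = k + l,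
      k \in K & l \in L].
  exact: (ind _ _ _ (ltnSn _) p11).
elim: d => // d IH K L; rewrite ltnS => ltd pKL.
pose W := Group (orth_group_set K L).
have abT (A : {group T}) : abelian A by apply: FinRing.zmod_abelian.
have [W1|nW1] := eqVneq (#|W|)%N 1%N.
  exists K, L; split=> // t; have [k [l [w [-> Kk Ll /orth_setP]]]] := perfect_decomp pKL t.
  rewrite -[orth_set K L]/(gval W) (card1_trivg W1) => /set1P->; exists k, l.
  by rewrite addr0.
have p_pr : prime (pdiv #|W|) by rewrite pdiv_prime // ltn_neqAle eq_sym nW1 cardG_gt0.
move: (pdiv _) p_pr (pdiv_dvd #|W|) => p p_pr pW.
have [P sylP] := Sylow_exists p W; have [sPW pP _] := and3P sylP.
have [a Pa expP] := exponent_witness (abelian_nil (abT P)).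
have [r oa] : exists r, #[a]%g = (p ^ r.+1)%N.
  have /p_natP[[|r] oa] : p.-nat #[a]%g by apply: mem_p_elt Pa; exact: pP.
    have P1 : P :=: 1%g by apply/eqP; rewrite trivg_exponent expP oa.
    have := card_Hall sylP; rewrite P1 cards1 => /esym/eqP.
    by rewrite p_part_eq1 => /negP[]; rewrite mem_primes p_pr cardG_gt0.
  by exists r.
have aW : forall z, (z \in K) || (z \in L) -> b a z = 1.
  by apply/orth_setP; apply: (subsetP sPW).
have ae : a *+ (p ^ r.+1)%N = 0 by rewrite -oa -[a *+ _]/(a ^+ _)%g expg_order.
(* A partner exists in [W] because [a] is orthogonal to [K] and [L], so nondegeneracy on T is
   decided on [W]. *)
have [x [xW bax]] : exists x, x \in W /\ b a x ^+ (p ^ r)%N != 1.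
  apply: NNPP => none; have : a *+ (p ^ r)%N = 0.
    apply: bnondeg => t; rewrite alt_formMn.
    have [k [l [w [-> Kk Ll /orth_setP Ww]]]] := perfect_decomp pKL t.
    rewrite !bDr (aW k) ?Kk // (aW l) ?Ll ?orbT // !mul1r; apply/eqP/negPn/negP => bw.
    by apply: none; exists w.
  move/eqP; rewrite -[a *+ _]/(a ^+ _)%g -order_dvdn oa dvdn_Pexp2l ?prime_gt1 //.
  by rewrite ltnn.
(* The p'-part of [x] pairs trivially with the p-element [a], so only the p-part counts; its order
   divides the exponent of the Sylow subgroup, that is, the order of [a]. *)
pose y := (x.`_p)%g.
have Wy : y \in W by rewrite groupX.
have yP : y \in P.
  rewrite (mem_normal_Hall sylP) ?p_elt_constt //.
  by rewrite -(sub_abelian_normal P (abT W)).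
have ye : y *+ (p ^ r.+1)%N = 0.
  apply/eqP; rewrite -[y *+ _]/(y ^+ _)%g -order_dvdn -oa -expP.
  exact: (dvdn_exponent yP).
have bay : b a x = b a y.
  rewrite -(consttC p x) -[(_ * _)%g]/(_ + _) bDr -[X in _ * b a X]/(x.`_p^')%g.
  suff -> : b a (x.`_p^')%g = 1 by rewrite mulr1.
  apply: (@expr_coprime1 _ _ (p ^ r.+1)%N #[x.`_p^']%g).
  - by rewrite expn_gt0 prime_gt0.
  - by rewrite -alt_formMn ae alt_form0l.
  - rewrite -alt_formMnr; set u := (x.`_p^')%g.
    by rewrite -[u *+ _]/(u ^+ _)%g expg_order alt_form0r.
  rewrite coprime_pexpl // prime_coprime // -p'natE //.
  exact: p_elt_constt.
rewrite bay in bax.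
have yW : forall z, (z \in K) || (z \in L) -> b y z = 1 by apply/orth_setP.
have [pKL' ltK] := perfect_pair_extend pKL p_pr aW yW ae ye bax.
apply: IH pKL'; apply: leq_trans ltd; apply: ltn_sub2l => //.
by rewrite (leq_trans ltK) // max_card.
Qed.

End Lagrangian.

Section SubgroupZmod.

Variables (T : finZmodType) (K : {group T}).

Definition subgroup_zmod := {x : T | x \in K}.

HB.instance Definition _ := Finite.on subgroup_zmod.

Fact subgroup_addP (x y : subgroup_zmod) : val x + val y \in K.
Proof. exact: (@groupM _ K) (valP x) (valP y). Qed.

Fact subgroup_oppP (x : subgroup_zmod) : - val x \in K.
Proof. exact: (@groupVr _ K) (valP x). Qed.

Definition subgroup_zero : subgroup_zmod := exist (fun x => x \in K) 0 (group1 K).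
Definition subgroup_add (x y : subgroup_zmod) : subgroup_zmod :=
  exist (fun x => x \in K) _ (subgroup_addP x y).
Definition subgroup_opp (x : subgroup_zmod) : subgroup_zmod :=
  exist (fun x => x \in K) _ (subgroup_oppP x).

Fact subgroup_addA : associative subgroup_add.
Proof. by move=> x y z; apply: val_inj; apply: addrA. Qed.
Fact subgroup_addC : commutative subgroup_add.
Proof. by move=> x y; apply: val_inj; apply: addrC. Qed.
Fact subgroup_add0 : left_id subgroup_zero subgroup_add.
Proof. by move=> x; apply: val_inj; apply: add0r. Qed.
Fact subgroup_addN : left_inverse subgroup_zero subgroup_opp subgroup_add.
Proof. by move=> x; apply: val_inj; apply: addNr. Qed.

HB.instance Definition _ := GRing.isZmodule.Build subgroup_zmod
  subgroup_addA subgroup_addC subgroup_add0 subgroup_addN.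

Definition subgroup_finZmod : finZmodType := subgroup_zmod.

End SubgroupZmod.

(** * Common eigenvectors, and the dual of a finite abelian group *)

Section CommonEigenvector.

Variables (F : closedFieldType) (n : nat) (I : Type) (X : I -> 'M[F]_n).
Hypothesis X_comm : forall i j, X i *m X j = X j *m X i.

Lemma stable_eigenvector (U A : 'M[F]_n) : (U *m A <= U)%MS -> U != 0 ->
  exists c (v : 'rV_n), [/\ v != 0, (v <= U)%MS & v *m A = c *: v].
Proof.
move=> UA Un0; have /submxP[B defB] : (row_base U *m A <= row_base U)%MS.
  by rewrite eq_row_base (submx_trans _ UA) // submxMr // eq_row_base.
have r_gt0 : (0 < \rank U)%N by rewrite lt0n mxrank_eq0.
have /closed_rootP[c] : size (char_poly B) != 1 by rewrite size_char_poly eqSS -lt0n.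
rewrite -eigenvalue_root_char => /eigenvalueP[v vB vn0].
exists c, (v *m row_base U); split.
- rewrite -(mul0mx _ (row_base U)); apply: contra vn0 => /eqP vU0; apply/eqP.
  exact: (row_free_inj (row_base_free U)).
- by rewrite -(eq_row_base U) submxMl.
by rewrite -mulmxA defB mulmxA vB scalemxAl.
Qed.

(** The family may be infinite, so the induction is on the rank of [U]: a matrix that is not scalar
    on [U] has there a smaller eigenspace, stable by commutation; if all of them are scalar on [U],
    any nonzero row serves. *)
Lemma common_stable_eigenvector (U : 'M[F]_n) :
    (forall i, U *m X i <= U)%MS -> U != 0 ->
  exists v : 'rV_n, [/\ v != 0, (v <= U)%MS & forall i, exists c, v *m X i = c *: v].
Proof.
have [r] := ubnP (\rank U); elim: r U => // r IH U; rewrite ltnS => rkU UX Un0.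
have [[i nsc] | sc] := classic (exists i, forall c, exists v : 'rV_n,
  (v <= U)%MS /\ v *m X i != c *: v).
  have [c [v [vn0 vU vX]]] := stable_eigenvector (UX i) Un0.
  pose W := (U :&: eigenspace (X i) c)%MS.
  have vW : (v <= W)%MS by rewrite sub_capmx vU; apply/eigenspaceP.
  have [||| w [wn0 wW wX]] := IH W.
  - apply: leq_trans rkU; apply: rank_ltmx; rewrite ltmxE capmxSl /=.
    have [u [uU uX]] := nsc c; apply: contra uX => UW; apply/eqP/eigenspaceP.
    by apply: submx_trans uU (submx_trans UW _); apply: capmxSr.
  - move=> j; rewrite sub_capmx; apply/andP; split.
      by apply: submx_trans (UX j); rewrite submxMr // capmxSl.
    have : (W <= eigenspace (X i) c)%MS by apply: capmxSr.
    move/eigenspaceP => WX; apply/eigenspaceP.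
    by rewrite -mulmxA X_comm mulmxA WX scalemxAl.
  - by apply: contraNneq vn0 => W0; rewrite W0 submx0 in vW.
  by exists w; split=> //; apply: submx_trans wW _; apply: capmxSl.
exists (nz_row U); split; rewrite ?nz_row_eq0 ?nz_row_sub // => i.
apply: NNPP => none; apply: sc; exists i => c.
exists (nz_row U); split; rewrite ?nz_row_sub //.
by apply/negP=> /eqP e; apply: none; exists c.
Qed.

End CommonEigenvector.

Section Characters.

Variables (F : closedFieldType) (H : finZmodType).
Hypothesis H0 : #|H|%:R != 0 :> F.

Lemma char_seq_size (s : seq (charGroup F H)) : uniq s -> (size s <= #|H|)%N.
Proof.
move=> Us; rewrite -[size s]card_ord -[#|H|]cardsT.
apply: (@card_group_chars F H [set: H] _ (fun i x => tnth (in_tuple s) i x)).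
- by rewrite cardsT.
- by move=> i x y _ _; apply: charD.
- by move=> i; apply: char0.
move=> i j eq_ij; have /tuple_uniqP inj : uniq (in_tuple s) by [].
by apply: inj; apply: char_ext => x; apply: eq_ij.
Qed.

(** The bound on the number of characters stops the extension of a repetition-free list, which is
    then exhaustive; this is how finiteness of the dual is obtained. *)
Lemma complete_char_seq : exists s : seq (charGroup F H), uniq s /\ forall chi, chi \in s.
Proof.
suff ext d : forall s : seq (charGroup F H), uniq s -> (#|H| - size s < d)%N ->
    exists s : seq (charGroup F H), uniq s /\ forall chi, chi \in s.
  exact: (ext _ [::] isT (ltnSn _)).
elim: d => // d IH s Us; rewrite ltnS => sd.
have [all_s | /not_all_ex_not[chi /negP s'chi]] := classic (forall chi, chi \in s).
  by exists s.
have Us' : uniq (chi :: s) by rewrite /= s'chi.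
apply: (IH _ Us'); apply: leq_trans sd; apply: ltn_sub2l; last exact: ltnSn.
exact: char_seq_size Us'.
Qed.

Lemma char_sum_neq0 (chi : charGroup F H) : chi != 0 -> \sum_h chi h = 0.
Proof.
move=> chi0; have [y chiy] : exists y, chi y != 1.
  apply: NNPP => none; case/eqP: chi0; apply: char_ext => x; rewrite char_oneE.
  by apply/eqP/negPn/negP => chix; apply: none; exists x.
transitivity (\sum_(x in [set: H]) chi x); first by apply: eq_bigl => x; rewrite inE.
by apply: (@sum_group_char F H [set: H] chi _ y); rewrite ?inE // => x z _ _; apply: charD.
Qed.

(* A function orthogonal to every character would, the orthogonal space being stable under
   translations, yield a character orthogonal to its own inverse. *)
Lemma complete_char_size (s : seq (charGroup F H)) : uniq s -> (forall chi, chi \in s) ->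
  size s = #|H|.
Proof.
move=> Us all_s; apply/eqP; rewrite eqn_leq char_seq_size //= leqNgt; apply/negP=> lt_s.
pose C := \matrix_(b < #|H|, i < size s) tnth (in_tuple s) i (enum_val b).
have CP (f : 'rV[F]_#|H|) : (f <= kermx C)%MS ->
    forall chi : charGroup F H, \sum_h f 0 (enum_rank h) * chi h = 0.
  move=> /sub_kermxP fC chi; have /seq_tnthP[i ->] := all_s chi.
  have /matrixP/(_ 0 i) := fC; rewrite !mxE => fCi;
    rewrite -[RHS]fCi (reindex _ (onW_bij _ (@enum_val_bij H))) /=.
  by apply: eq_bigr => b _; rewrite mxE enum_valK.
pose tr (h : H) : 'M[F]_#|H| := X ((h, 0) : T_group F H).
have trE h (f : 'rV[F]_#|H|) x : (f *m tr h) 0 (enum_rank x) = f 0 (enum_rank (h + x)).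
  rewrite mxE (bigD1 (enum_rank (h + x))) //= mxE /= !enum_rankK eqxx char_oneE mulr1n mulr1.
  rewrite big1 ?addr0 // => a neq_a; rewrite mxE enum_rankK /= [_ == _](_ : _ = false) ?mulr0n
    ?mulr0 //.
  by apply: contraNF neq_a => /eqP <-; rewrite enum_valK.
have tr_comm h k : tr h *m tr k = tr k *m tr h.
  by rewrite !X_mul /= !char_oneE !scale1r addrC.
have ker_n0 : kermx C != 0.
  by rewrite -mxrank_eq0 mxrank_ker -lt0n subn_gt0 (leq_ltn_trans (rank_leq_col _)).
have ker_tr h : (kermx C *m tr h <= kermx C)%MS.
  apply/row_subP => i; rewrite row_mul; apply/sub_kermxP/matrixP=> i' j; rewrite !mxE.
  have /CP/(_ (tnth (in_tuple s) j)) := row_sub i (kermx C).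
  rewrite (reindex_inj (addrI h)) /= => /(congr1 ( *%R (tnth (in_tuple s) j (- h)))).
  rewrite mulr0 mulr_sumr => f0; rewrite -[RHS]f0 [RHS](reindex _ (onW_bij _ (@enum_val_bij H))) /=.
  apply: eq_bigr => x _; rewrite ord1 -{1}(enum_valK x) trE mxE charD mulrCA; congr (_ * _).
  by rewrite mxE mulrA -charD addNr char0 mul1r.
have [f [fn0 f_ker f_eig]] := common_stable_eigenvector tr_comm ker_tr ker_n0.
pose phi h := f 0 (enum_rank h).
have phi_tr h : exists c, forall x, phi (h + x) = c * phi x.
  by have [c fc] := f_eig h; exists c => x; rewrite /phi -trE fc mxE.
have phi0 : phi 0 != 0.
  apply: contra fn0 => /eqP p0; apply/eqP/rowP=> a; rewrite mxE -(enum_valK a).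
  by have [c fc] := phi_tr (enum_val a); have := fc 0; rewrite addr0 p0 mulr0.
have phiM h x : phi (h + x) * phi 0 = phi h * phi x.
  by have [c fc] := phi_tr h; rewrite fc -[in RHS](addr0 h) fc mulrAC.
(* A common eigenfunction of the translations is a multiple of a character; normalising its value at
   0 gives that character. *)
pose lam := [ffun h => phi h / phi 0].
have lamP : is_group_char lam.
  rewrite /is_group_char ffunE divff //=; rewrite eqxx /=.
  apply/forallP=> h; apply/forallP=> x; rewrite !ffunE.
  by apply/eqP; rewrite mulrACA -phiM -mulrA mulVKf.
have /eqP := CP f f_ker (- (CharGroup lamP)).
rewrite (eq_bigr (fun=> phi 0)) => [|h _].
  rewrite sumr_const -[_ *+ _]mulr_natr mulf_eq0 (negPf phi0) /=.
  exact/negP.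
have phih : phi h != 0.
  apply: contraNneq (char_neq0 (CharGroup lamP) h) => ph0.
  by rewrite /= ffunE ph0 mul0r.
by rewrite -[f 0 _]/(phi h) char_invE /= ffunE invf_div mulrCA mulfV // mulr1.
Qed.

Lemma char_finZmod : exists (C : finZmodType) (c : C -> charGroup F H),
  [/\ bijective c, {morph c : x y / x + y} & #|C| = #|H|].
Proof.
have [s [Us all_s]] := complete_char_seq.
have pickK : pcancel (index^~ s) (fun i => nth None (map Some s) i).
  move=> chi; rewrite (nth_map chi) ?index_mem //; congr Some.
  exact: nth_index.
have ax : Finite.axiom s by move=> chi; rewrite count_uniq_mem // all_s.
pose cnt := PCanIsCountable pickK.
pose Cc : countType := HB.pack (charGroup F H) cnt.
pose fin := @isFinite.Build Cc s ax.
pose C : finZmodType := HB.pack (charGroup F H) cnt fin.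
exists C, id; split=> //; first by exists id.
rewrite -(complete_char_size Us all_s) -(@card_uniqP C s Us).
by apply: eq_card => chi; rewrite inE; apply/esym/all_s.
Qed.

End Characters.

(** * Graded bases, and the Fourier basis of the matrices [X] *)

Section BasisParts.

Variables (F : fieldType) (V : vectType F) (J : finType) (I : eqType).
Variables (ev : J -> V) (co : J -> V -> F) (deg : J -> I).
Hypotheses (co_lin : forall j, linear (co j : V -> F^o))
  (co_ev : forall j j', co j (ev j') = (j == j')%:R)
  (co_sum : forall a, a = \sum_j co j a *: ev j).

Definition basis_part (i : I) : {vspace V} := (\sum_(j | deg j == i) <[ev j]>)%VS.

Lemma mem_basis_part i a : reflect (forall j, deg j != i -> co j a = 0) (a \in basis_part i).
Proof.
apply: (iffP idP) => [/memv_sumP[f fP ->] j ji | a0].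
  rewrite (linear_fun_sum _ _ _ (co_lin j)) big1 // => j' j'i.
  have /vlineP[x ->] := fP j' j'i.
  have := co_lin j x (ev j') 0; rewrite (linear_fun0 (co_lin j)) !addr0 => ->.
  rewrite co_ev; have [jj'|_] := eqVneq j j'; last exact: scaler0.
  by rewrite jj' j'i in ji.
rewrite [a]co_sum (bigID (fun j => deg j == i)) /= [X in _ + X]big1 ?addr0 => [|j /a0->].
  by apply: memv_sumr => j _; rewrite memvZ ?memv_line.
by rewrite scale0r.
Qed.

Lemma basis_part_ev j : ev j \in basis_part (deg j).
Proof.
apply/mem_basis_part => j' jj'; rewrite co_ev.
by have [e|//] := eqVneq j' j; rewrite e eqxx in jj'.
Qed.

Lemma basis_part_direct : is_direct_sum basis_part fullv.
Proof.
pose s := undup [seq deg j | j <- enum J].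
have ds j : deg j \in s by rewrite mem_undup map_f // mem_enum.
have Us : uniq s := undup_uniq _.
apply: (@is_direct_sum_intro _ _ _ _ _ s (fun i a => \sum_(j | deg j == i) co j a *: ev j)) => //.
- move=> i si; apply: big1 => j /eqP ji.
  by rewrite -ji ds in si.
- by move=> i; apply: subvf.
- by move=> i a _; apply: memv_sumr => j _; rewrite memvZ ?memv_line.
- move=> a _; rewrite {1}[a]co_sum (exchange_big_dep xpredT) //=.
  apply: eq_bigr => j _; rewrite big_mkcond (bigD1_seq (deg j)) //= eqxx big1 ?addr0 //.
  by move=> i; rewrite eq_sym => /negPf->.
move=> u uV sum0 i si; rewrite [u i]co_sum big1 // => j _.
have [ji|ji] := eqVneq (deg j) i; last first.
  by have /mem_basis_part -> := uV i; rewrite ?scale0r.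
have := congr1 (co j) sum0; rewrite (linear_fun0 (co_lin j)) (linear_fun_sum _ _ _ (co_lin j)).
rewrite (bigD1_seq i) //= big1 ?addr0 => [->|i' i'i]; first exact: scale0r.
by have /mem_basis_part -> := uV i'; rewrite // ji eq_sym.
Qed.

End BasisParts.

Lemma mulmx1C_eq (F : fieldType) r s (A : 'M[F]_(r, s)) (B : 'M[F]_(s, r)) :
  r = s -> A *m B = 1%:M -> B *m A = 1%:M.
Proof. by move=> rs; case: s / rs A B => A B; apply: mulmx1C. Qed.

Section XBasis.

Variables (F : closedFieldType) (H : finZmodType).
Hypothesis H0 : #|H|%:R != 0 :> F.
Variables (C : finZmodType) (c : C -> charGroup F H).
Hypotheses (c_bij : bijective c) (cD : {morph c : x y / x + y}) (cardC : #|C| = #|H|).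

Lemma char_sumE (chi psi : charGroup F H) :
  \sum_h chi h * (psi h)^-1 = if chi == psi then #|H|%:R else 0.
Proof.
have [->|cp] := eqVneq chi psi.
  rewrite (eq_bigr (fun=> 1)) ?sumr_const // => h _.
  by rewrite divff // char_neq0.
rewrite -[RHS](@char_sum_neq0 F H (chi - psi)) ?subr_eq0 //.
by apply: eq_bigr => h _; rewrite [RHS]char_mulE char_invE.
Qed.

(** The second orthogonality relation follows from the first: the character table is square, so its
    right inverse is also a left inverse. *)
Lemma char_sumCE (x y : H) :
  \sum_(k : C) c k x * (c k y)^-1 = if x == y then #|H|%:R else 0.
Proof.
pose M := \matrix_(k < #|C|, h < #|H|) c (enum_val k) (enum_val h).
pose M' := \matrix_(h < #|H|, k < #|C|) ((c (enum_val k) (enum_val h))^-1 / #|H|%:R).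
have MM : M *m M' = 1%:M.
  apply/matrixP=> k k'; rewrite !mxE.
  under eq_bigr do rewrite !mxE mulrA.
  rewrite -mulr_suml -(big_enum_val (fun h => c (enum_val k) h * (c (enum_val k') h)^-1)) char_sumE.
  rewrite (bij_eq c_bij) (inj_eq enum_val_inj); case: eqP => _; first by rewrite divff.
  by rewrite mul0r.
have /matrixP/(_ (enum_rank y) (enum_rank x)) := mulmx1C_eq cardC MM.
rewrite !mxE (inj_eq enum_rank_inj) => MMyx.
have {MMyx} : (\sum_(k : C) c k x * (c k y)^-1) / #|H|%:R = (y == x)%:R.
  rewrite -MMyx (reindex _ (onW_bij _ (@enum_val_bij C))) /= mulr_suml.
  by apply: eq_bigr => k _; rewrite !mxE !enum_rankK -mulrA mulrC mulrAC.
move/(canRL (divfK H0)) => ->; rewrite eq_sym.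
by case: eqP => _; rewrite ?mul1r ?mul0r.
Qed.

Lemma char_separates (x : H) : x != 0 -> exists chi : charGroup F H, chi x != 1.
Proof.
move=> x0; apply: NNPP => none; have := char_sumCE x 0; rewrite (negPf x0).
rewrite (eq_bigr (fun=> 1)) ?sumr_const => [/eqP|k _].
  by rewrite cardC (negPf H0).
rewrite char0 invr1 mulr1; apply/eqP/negPn/negP => ckx.
by apply: none; exists (c k).
Qed.

(** The coordinate of [d] along [X u]: the entries of [d] on the generalised diagonal shifted by
    [u.1], Fourier-transformed at the character [u.2]. *)
Definition X_coef (u : T_group F H) (d : 'M[F]_#|H|) : F :=
  #|H|%:R^-1 * \sum_b (u.2 b)^-1 * d (enum_rank (u.1 + b)) (enum_rank b).

Lemma X_coef_linear u : linear (X_coef u : _ -> F^o).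
Proof.
move=> a d e; rewrite /X_coef -[X in _ = X + _]/(a * _) mulrCA -mulrDr; congr (_ * _).
rewrite mulr_sumr -big_split /=; apply: eq_bigr => b _.
by rewrite !mxE mulrDr mulrCA.
Qed.

Lemma X_coef_X u v : X_coef u (X v) = (u == v)%:R.
Proof.
rewrite /X_coef.
under eq_bigr do rewrite mxE !enum_rankK (inj_eq (addIr _)).
rewrite -pair_eqE /=; case: (u.1 == v.1); last first.
  by rewrite big1 ?mulr0 // => b _; rewrite mulr0n mulr0.
under eq_bigr do rewrite mulr1n mulrC.
rewrite char_sumE eq_sym; case: eqP => _; last by rewrite mulr0.
by rewrite mulVf.
Qed.

Lemma X_coef_sum (d : 'M[F]_#|H|) :
  d = \sum_(p : H * C) X_coef (p.1, c p.2) d *: X (p.1, c p.2).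
Proof.
apply/matrixP=> x y; rewrite summxE.
rewrite -(pair_bigA _ (fun h k => (X_coef (h, c k) d *: X (h, c k)) x y)) /=.
rewrite (bigD1 (enum_val x - enum_val y)) //= [X in _ + X]big1 ?addr0 => [|h hxy]; last first.
  rewrite big1 // => k _; rewrite !mxE /= [_ == _](_ : _ = false) ?mulr0n ?mulr0 //.
  by apply: contraNF hxy => /eqP->; rewrite addrK.
under eq_bigr do rewrite !mxE /= subrK eqxx mulr1n /X_coef /= -mulrA mulr_suml.
rewrite -mulr_sumr exchange_big /= (bigD1 (enum_val y)) //= [X in _ + X]big1 ?addr0 => [|b bxy].
  rewrite subrK !enum_valK (eq_bigr (fun k => d x y * (c k (enum_val y) * (c k (enum_val y))^-1))).
    by rewrite -mulr_sumr char_sumCE eqxx mulrCA mulVf ?mulr1.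
  by move=> k _; rewrite [_^-1 * _]mulrC -mulrA [_^-1 * _]mulrC.
rewrite (eq_bigr (fun k => d (enum_rank (enum_val x - enum_val y + b)) (enum_rank b) * (c k
  (enum_val y) * (c k b)^-1))).
  by rewrite -mulr_sumr char_sumCE eq_sym (negPf bxy) mulr0.
by move=> k _; rewrite [_^-1 * _]mulrC -mulrA [_^-1 * _]mulrC.
Qed.

End XBasis.

(** * [GammaH] in terms of the standard frame *)

Section StandardFrame.

Variables (F : fieldType) (m n : nat) (H : finZmodType).
Hypothesis dvdH : (#|H| %| gcdn m n)%N.
Local Notation k := (rank_H m n H).
Local Notation l := #|H|.
Local Notation blk := (block_idem F m n).

Lemma rank_H_mul : (k * l = m + n)%N.
Proof.
have := dvdH; rewrite dvdn_gcd => /andP[dm dn].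
by rewrite mulnDl !divnK.
Qed.

Lemma rank_H_gt1 : (0 < m)%N -> (0 < n)%N -> (1 < k)%N.
Proof.
have := dvdH; rewrite dvdn_gcd => /andP[dm dn] m0 n0.
have l0 : (0 < l)%N by apply/card_gt0P; exists 0.
by rewrite /rank_H -(addn1 1) leq_add // divn_gt0 // dvdn_leq.
Qed.

Definition std_idx (i : 'I_k) (b : 'I_l) : 'I_(m + n) :=
  cast_ord rank_H_mul (mxtens_index (i, b)).

Lemma std_idx_inj i j a b : (std_idx i a == std_idx j b) = (i == j) && (a == b).
Proof.
rewrite (inj_eq (@cast_ord_inj _ _ _)) (can_eq (@mxtens_indexK _ _)).
by rewrite -pair_eqE.
Qed.

Lemma sum_std_idx (f : 'I_(m + n) -> F) : \sum_r f r = \sum_i \sum_b f (std_idx i b).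
Proof.
rewrite (reindex (cast_ord rank_H_mul)) /=; last first.
  by exists (cast_ord (esym rank_H_mul)) => x _; rewrite ?cast_ordK ?cast_ordKV.
rewrite (reindex (@mxtens_index k l)) /=; last first.
  by exists (@mxtens_unindex k l) => x _; rewrite ?mxtens_indexK ?mxtens_unindexK.
by rewrite pair_bigA; apply: eq_bigr => -[i b] _.
Qed.

Definition std_mx (i : 'I_k) : 'M[F]_(m + n, l) := \matrix_(r, b) (r == std_idx i b)%:R.

(** The Kronecker product of the matrix unit at [i], [j] with [d], free of any cast between
    dimensions. *)
Definition std_E (i j : 'I_k) (d : 'M[F]_l) : 'M[F]_(m + n) :=
  std_mx i *m d *m (std_mx j)^T.

Lemma std_mxT_mul i q (d : 'M[F]_(m + n, q)) : (std_mx i)^T *m d = \matrix_(b, s) d (std_idx i b) s.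
Proof.
apply/matrixP=> b s; rewrite !mxE (bigD1 (std_idx i b)) //= !mxE eqxx mul1r big1 ?addr0 //.
by move=> r /negPf ri; rewrite !mxE ri mul0r.
Qed.

Lemma std_frame : is_frame 1%:M std_mx (fun i => (std_mx i)^T).
Proof.
split=> [i j|].
  rewrite std_mxT_mul; apply/matrixP=> a b; rewrite !mxE std_idx_inj.
  by case: (i == j); rewrite !mxE.
apply/matrixP=> r s; rewrite summxE mxE.
transitivity (\sum_t (r == t)%:R * (s == t)%:R : F).
  by rewrite sum_std_idx; apply: eq_bigr => i _; rewrite mxE; apply: eq_bigr => b _; rewrite !mxE.
rewrite (bigD1 r) //= eqxx mul1r big1 ?addr0 1?eq_sym // => t /negPf tr.
by rewrite eq_sym tr mul0r.
Qed.

Lemma std_mx_block (i : 'I_k) : blk (m %/ l <= i)%N *m std_mx i = std_mx i.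
Proof.
apply/matrixP=> r b; rewrite !mxE (bigD1 r) //= big1 ?addr0 => [|s /negPf sr]; last first.
  by rewrite !mxE eq_sym sr mul0r.
rewrite !mxE eqxx /=; case: (eqVneq r (std_idx i b)) => [->|]; last by rewrite mulr0.
have := dvdH; rewrite dvdn_gcd => /andP[dm _].
have l0 : (0 < l)%N by apply: leq_ltn_trans (ltn_ord b).
have -> : lower (std_idx i b) = (m %/ l <= i)%N.
  rewrite /lower /= -{1}(divnK dm); apply/idP/idP => [h|h].
    by rewrite -ltnS -(ltn_pmul2r l0); apply: leq_ltn_trans h _; rewrite mulSn addnC ltn_add2r.
  by apply: leq_trans (leq_addr _ _); rewrite leq_mul2r h orbT.
by rewrite eqxx mulr1.
Qed.

Lemma conform_std_E i j (d : 'M[F]_l) :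
  conform_mx (0 : 'M[F]_(m + n)) (delta_mx i j *t d) = std_E i j d.
Proof.
rewrite -(conform_castmx (rank_H_mul, rank_H_mul)) conform_mx_id.
apply/matrixP=> r s; rewrite castmxE /= /std_E -mulmxA [RHS]mxE.
have idxE t : exists i1 a, t = std_idx i1 a /\ cast_ord (esym rank_H_mul) t = mxtens_index (i1, a).
  case: (mxtens_unindex (cast_ord (esym rank_H_mul) t)) (mxtens_unindexK (cast_ord (esym
    rank_H_mul) t)) => i1 a ia.
  by exists i1, a; rewrite /std_idx ia cast_ordKV.
have [i1 [a [-> ->]]] := idxE r; have [j1 [b [-> ->]]] := idxE s.
rewrite tensmxE [RHS](bigD1 a) //= big1 ?addr0 => [|t /negPf ta]; last first.
  by rewrite mxE std_idx_inj [a == t]eq_sym ta andbF mul0r.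
rewrite !mxE std_idx_inj eqxx andbT (bigD1 b) //= big1 ?addr0 => [|t /negPf tb]; last first.
  by rewrite !mxE std_idx_inj [b == t]eq_sym tb andbF mulr0.
rewrite !mxE std_idx_inj eqxx andbT.
by case: (i1 == i); case: (j1 == j); rewrite /= ?mul0r ?mulr0 ?mul1r ?mulr1.
Qed.

End StandardFrame.

Section GammaHBasis.

Variables (F : closedFieldType) (m n : nat) (H : finZmodType).
Hypothesis dvdH : (#|H| %| gcdn m n)%N.
Hypothesis H0 : #|H|%:R != 0 :> F.
Local Notation k := (rank_H m n H).
Local Notation l := #|H|.
Local Notation blk := (block_idem F m n).
Local Notation M := 'M[F]_(m + n).
Local Notation Gam := (@GammaH F m n H).
Local Notation J := (std_mx F dvdH).
Local Notation E := (std_E dvdH).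
Local Notation e i := (delta_mx 0 i : 'rV[int]_k).

Lemma std_E_linear i j : linear (E i j : 'M[F]_l -> M).
Proof. by move=> a x y; rewrite /std_E mulmxDr mulmxDl -scalemxAr -scalemxAl. Qed.

Lemma std_E_mul (i j i' j' : 'I_k) (x y : 'M[F]_l) :
  E i j x *m E i' j' y = if j == i' then E i j' (x *m y) else 0.
Proof.
rewrite /std_E -!mulmxA [(J j)^T *m (_ *m _)]mulmxA (std_frame F dvdH).1.
by case: eqP => _; rewrite ?mul0mx ?mulmx0 // mul1mx !mulmxA.
Qed.

Lemma std_E_corner (i j i' j' : 'I_k) (x : 'M[F]_l) :
  (J i)^T *m E i' j' x *m J j = if (i == i') && (j' == j) then x else 0.
Proof.
rewrite /std_E -!mulmxA (std_frame F dvdH).1 !mulmxA (std_frame F dvdH).1.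
by case: (i == i'); case: (j' == j); rewrite ?mulmx1 ?mul1mx ?mulmx0 ?mul0mx.
Qed.

Lemma std_E_sum (a : M) : a = \sum_i \sum_j E i j ((J i)^T *m a *m J j).
Proof.
have [_ J1] := std_frame F dvdH.
rewrite -[LHS]mulmx1 -[LHS]mul1mx -J1 mulmx_suml; apply: eq_bigr => i _.
by rewrite !mulmx_sumr; apply: eq_bigr => j _; rewrite /std_E !mulmxA.
Qed.

Section WithChars.

Variables (C : finZmodType) (c : C -> charGroup F H).
Hypotheses (c_bij : bijective c) (cD : {morph c : x y / x + y}) (cardC : #|C| = #|H|).

Local Notation idx := ('I_k * 'I_k * (H * C))%type.

Definition gam_chr (q : H * C) : T_group F H := (q.1, c q.2).
Definition gam_ev (q : idx) : M := E q.1.1 q.1.2 (X (gam_chr q.2)).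
Definition gam_co (q : idx) (a : M) : F :=
  X_coef (gam_chr q.2) ((J q.1.1)^T *m a *m J q.1.2).
Definition gam_deg (q : idx) : ambient_group F m n H :=
  (gam_chr q.2, e q.1.1 - e q.1.2).

Lemma gam_chr_inj : injective gam_chr.
Proof. by move=> [h x] [h' x'] [-> /(bij_inj c_bij)->]. Qed.

Lemma gam_chr_surj (t : T_group F H) : exists q, gam_chr q = t.
Proof.
have [d dK cK] := c_bij; exists (t.1, d t.2).
by rewrite /gam_chr /= cK; case: t.
Qed.

Lemma gam_co_linear q : linear (gam_co q : M -> F^o).
Proof.
move=> a x y; rewrite /gam_co mulmxDr mulmxDl -scalemxAr -scalemxAl.
exact: X_coef_linear.
Qed.

Lemma gam_co_ev q q' : gam_co q (gam_ev q') = (q == q')%:R.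
Proof.
case: q q' => [[i j] q] [[i' j'] q']; rewrite /gam_co /gam_ev std_E_corner /= !xpair_eqE.
rewrite [j' == j]eq_sym; case: (_ && _) => /=.
  by rewrite X_coef_X // (inj_eq gam_chr_inj).
by rewrite mulr0n; apply: (linear_fun0 (X_coef_linear (gam_chr q))).
Qed.

Lemma gam_co_sum a : a = \sum_q gam_co q a *: gam_ev q.
Proof.
rewrite {1}[a]std_E_sum pair_bigA /= -(pair_bigA _ (fun p q => gam_co (p, q) a *: gam_ev (p, q))).
apply: eq_bigr => -[i j] _; rewrite {1}(X_coef_sum H0 c_bij cardC (_ *m _)).
rewrite (linear_fun_sum _ _ _ (std_E_linear i j)); apply: eq_bigr => q _.
have := std_E_linear i j (gam_co (i, j, q) a) (X (gam_chr q)) 0.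
by rewrite (linear_fun0 (std_E_linear i j)) !addr0.
Qed.

Lemma GammaH_basis g : Gam g = basis_part gam_ev gam_deg g.
Proof.
have linE i j : linfun (fun d : 'M[F]_l => conform_mx (0 : M) (delta_mx i j *t d)) =
    linfun (mulmxr (J j)^T \o mulmx (J i)).
  by congr linfun; apply: functional_extensionality => d; rewrite (conform_std_E dvdH).
apply: subv_anti; apply/andP; split.
  apply/subv_sumP => i _; apply/subv_sumP => j _; rewrite linE /D_H /=.
  case: eqP => [g2|_]; last by rewrite limg0 sub0v.
  rewrite limg_line -memvE lfunE /= subr0 addr0.
  have [q qE] := gam_chr_surj g.1.
  have := basis_part_ev gam_deg gam_co_linear gam_co_ev gam_co_sum (i, j, q).
  rewrite /gam_ev /gam_deg /= qE; congr (_ \in basis_part _ _ _).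
  have {g2} g2 : g.2 = e i - e j.
    move: g2; rewrite /= => /(canRL (addrK _)); rewrite sub0r => /(canRL (subrK _)) ->.
    by rewrite addrC.
  by rewrite -g2; case: (g).
apply/subv_sumP => -[[i j] q] /eqP <-; rewrite -memvE /gam_ev /gam_deg /=.
rewrite memvE; apply: (sumv_sup i) => //; apply: (sumv_sup j) => //.
rewrite linE /D_H /= (_ : _ - _ + _ == 0) ?subr0 ?addr0.
  by rewrite limg_line lfunE.
by rewrite addrAC subrK subrr.
Qed.

End WithChars.

End GammaHBasis.

(** The homomorphism sending the r-th basis vector to [p r], evaluated at a difference of basis
    vectors; these are the only second coordinates occurring in the support of [GammaH]. *)
Lemma sum_delta_diff (V : zmodType) k (p : 'I_k -> V) i j :
  \sum_r p r *~ (delta_mx 0 i - delta_mx 0 j : 'rV[int]_k) 0 r = p i - p j.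
Proof.
rewrite (eq_bigr (fun r => (if r == i then p i else 0) - (if r == j then p j else 0))).
  by rewrite sumrB -!big_mkcond !big_pred1_eq.
move=> r _; have ifE q : p r *~ (r == q)%:R = if r == q then p q else 0.
  by case: eqP => [->|_]; rewrite ?mulr1z ?mulr0z.
by rewrite !mxE /= mulrzBr !ifE.
Qed.

(** * [GammaH] as a grading, and its refinements *)

Section GammaHGrading.

Variables (F : closedFieldType) (m n : nat) (H : finZmodType).
Hypothesis dvdH : (#|H| %| gcdn m n)%N.
Local Notation k := (rank_H m n H).
Local Notation l := #|H|.
Local Notation blk := (block_idem F m n).
Local Notation M := 'M[F]_(m + n).
Local Notation Gam := (@GammaH F m n H).
Local Notation J := (std_mx F dvdH).
Local Notation E := (std_E dvdH).
Local Notation e i := (delta_mx 0 i : 'rV[int]_k).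
Local Notation Xt t := (@X F H t).

Lemma X0 : Xt 0 = 1%:M.
Proof.
apply/matrixP=> a b; rewrite !mxE char_oneE add0r (inj_eq enum_val_inj).
by case: eqP.
Qed.

Lemma X_unit t : Xt t \in unitmx.
Proof.
have : Xt t *m (((t.2 (- t.1))^-1) *: Xt (- t)) = 1%:M.
  by rewrite -scalemxAr X_mul scalerA mulVf ?char_neq0 // scale1r subrr X0.
by case/mulmx1_unit.
Qed.

Lemma X_neq0 t : Xt t != 0.
Proof.
have l0 : (0 < l)%N by apply/card_gt0P; exists 0.
apply: contraTneq (X_unit t) => ->; rewrite unitmxE unitfE.
by case: (l) l0 => // r _; rewrite det0 eqxx.
Qed.

Lemma std_E_neq0 i j (x : 'M[F]_l) : x != 0 -> E i j x != 0.
Proof.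
apply: contraNneq => Ex; have := std_E_corner dvdH i j i j x.
by rewrite Ex mulmx0 mul0mx !eqxx /= => <-.
Qed.

(** The second alternative is the zero difference, shared by all diagonal positions; it is the
    reason why only the off-diagonal components are lines in general. *)
Lemma basis_diffP (i j i' j' : 'I_k) : e i - e j = e i' - e j' ->
  (i = i' /\ j = j') \/ (i = j /\ i' = j').
Proof.
move=> /rowP eq_e; have [ij|ij] := eqVneq i j.
  right; split=> //; have := eq_e i'; rewrite ij !mxE subrr !eqxx /=.
  by case: eqP.
left; split.
  have := eq_e i; rewrite !mxE !eqxx (negPf ij) /=.
  by case: eqP => [//|_]; case: eqP.
have := eq_e j; rewrite !mxE !eqxx [j == i]eq_sym (negPf ij) /=.
by case: (j =P j') => [//|_]; case: eqP.
Qed.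

Lemma GammaH_subP g (W : {vspace M}) :
  (forall i j, g.2 = e i - e j -> E i j (Xt g.1) \in W) -> (Gam g <= W)%VS.
Proof.
move=> EW; apply/subv_sumP => i _; apply/subv_sumP => j _.
have -> : linfun (fun d : 'M[F]_l => conform_mx (0 : M) (delta_mx i j *t d)) =
    linfun (mulmxr (J j)^T \o mulmx (J i)).
  by congr linfun; apply: functional_extensionality => d; rewrite (conform_std_E dvdH).
rewrite /D_H /=; case: eqP => [g2|_]; last by rewrite limg0 sub0v.
rewrite limg_line -memvE lfunE /= subr0 addr0; apply: EW.
move: g2 => /(canRL (addrK _)); rewrite sub0r => /(canRL (subrK _)) ->.
by rewrite addrC.
Qed.

Lemma GammaH_in i j t : E i j (Xt t) \in Gam (t, e i - e j).
Proof.
rewrite memvE; apply: (sumv_sup i) => //; apply: (sumv_sup j) => //.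
rewrite /D_H /= (_ : _ - _ + _ == 0) ?subr0 ?addr0; last by rewrite addrAC subrK subrr.
rewrite limg_line.
have -> : (fun d : 'M[F]_l => conform_mx (0 : M) (delta_mx i j *t d)) =
    (mulmxr (J j)^T \o mulmx (J i)).
  by apply: functional_extensionality => d; rewrite (conform_std_E dvdH).
by rewrite lfunE.
Qed.

Section Refinements.

Hypotheses (m_gt0 : (0 < m)%N) (n_gt0 : (0 < n)%N).

Lemma exists_other (i : 'I_k) : exists j, j != i.
Proof.
have k1 := rank_H_gt1 dvdH m_gt0 n_gt0; have k0 := ltnW k1.
have [->|] := eqVneq i (Ordinal k0); first by exists (Ordinal k1).
by rewrite eq_sym; exists (Ordinal k0).
Qed.

(* Off-diagonal components are lines, hence homogeneous for any refinement, and they generate. *)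
Lemma GammaH_refinement (G : zmodType) (Gam' : G -> {vspace M}) :
    mx_grading Gam -> mx_grading Gam' -> (forall h, exists g, (Gam' h <= Gam g)%VS) ->
  forall g, exists h, (Gam g <= Gam' h)%VS.
Proof.
move=> gradG gradG' ref g.
have [s [p projG]] := mx_grading_proj gradG; have [_ pV pS pE] := projG.
have [s' [q projG']] := mx_grading_proj gradG'; have [_ qV qS qE] := projG'.
pose gamma h := proj1_sig (constructive_indefinite_description _ (ref h)).
have gammaP h : (Gam' h <= Gam (gamma h))%VS := proj2_sig (constructive_indefinite_description _
  (ref h)).
(* Each component of the refinement lies in one component of [GammaH], so the projections of the
   refinement do not leave the components of [GammaH]. *)
have stable a g1 h : a \in Gam g1 -> q h a \in Gam g1.
  move=> ag1; have qh : q h (p (gamma h) a) = q h a.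
    rewrite {1}[a]qS !linear_sum /=.
    rewrite (eq_bigr (fun d => if d == h then q d a else 0)) => [|d _].
      by rewrite (proj_sum_pick projG' (f := fun d => q d a)) // => d /(proj_out projG').
    rewrite (pE (gamma d)) ?(subvP (gammaP d)) //.
    have [->|dh] := eqVneq d h; first by rewrite eqxx (qE h h _ (qV h a)) eqxx.
    by case: eqP; rewrite ?linear0 // (qE d h _ (qV d a)) (negPf dh).
  move: qh; rewrite (pE g1) //; case: eqP => [-> _|_ <-]; last by rewrite linear0 mem0v.
  exact: subvP (gammaP h) _ (qV h a).
have homog i j t : i != j -> exists h, E i j (Xt t) \in Gam' h.
  move=> ij; have := GammaH_in i j t; set v := E i j (Xt t) => vg.
  have line : (Gam (t, (e i - e j)%R) <= <[v]>)%VS.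
    apply: GammaH_subP => i' j' /= /basis_diffP[[<- <-]|[ij' _]]; first exact: memv_line.
    by rewrite ij' eqxx in ij.
  have vn0 : v != 0 by apply: std_E_neq0; apply: X_neq0.
  have [d qv] : exists d, q d v != 0.
    apply: NNPP => none; case/eqP: vn0; rewrite [v]qS big1 // => d _.
    by apply/eqP/negPn/negP => qv; apply: none; exists d.
  exists d; have /vlineP[x qx] := subvP line _ (stable _ _ d vg).
  have x0 : x != 0 by apply: contraNneq qv => x0; rewrite qx x0 scale0r.
  have := qV d v; rewrite qx => /(memvZ x^-1).
  by rewrite scalerA mulVf // scale1r.
have EE i j i' t : E i j (Xt t) *m E j i' (Xt 0) = E i i' (Xt t).
  by rewrite std_E_mul eqxx X0 mulmx1.
(* A diagonal element is a product of two off-diagonal ones, through a second index available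
   because both blocks are nonempty. *)
have homog' i j t : exists h, E i j (Xt t) \in Gam' h.
  have [ij|ij] := eqVneq i j; last exact: homog.
  have [j' ij'] := exists_other i.
  have [h1 h1P] : exists h, E i j' (Xt t) \in Gam' h by apply: homog; rewrite eq_sym.
  have [h2 h2P] := homog j' i 0 ij'.
  by exists (h1 + h2); rewrite -ij -(EE i j'); apply: grading_mul.
(* Factoring the same off-diagonal element through either diagonal position compares the two
   degrees; commutativity of the grading group lets the common factor cancel. *)
have diag i j t h : E i i (Xt t) \in Gam' h -> E j j (Xt t) \in Gam' h.
  move=> ih; have [h' jh'] := homog' j j t; have [h2 ij] := homog' i j 0.
  suff -> : h = h' by [].
  apply: (addIr h2); apply: (grading_disjoint gradG' (a := E i j (Xt t))).
  - by rewrite -(EE i i); apply: grading_mul.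
  - rewrite addrC (_ : E i j (Xt t) = E i j (Xt 0) *m E j j (Xt t)); first exact: grading_mul.
    by rewrite std_E_mul eqxx X0 mul1mx.
  by apply: std_E_neq0; apply: X_neq0.
have [[i [j gij]]|none] := classic (exists i j, g.2 = e i - e j); last first.
  by exists 0; apply: GammaH_subP => i j gij; case: none; exists i, j.
have [h hP] := homog' i j g.1; exists h; apply: GammaH_subP => i' j'.
rewrite gij => /basis_diffP[[<- <-]|[ij ij']] //.
by rewrite -ij' in hP *; rewrite -ij in hP; apply: diag hP.
Qed.

End Refinements.

Lemma GammaH_block : blk false \in Gam 0.
Proof.
have [_ J1] := std_frame F dvdH.
rewrite -[blk false]mulmx1 -J1 mulmx_sumr; apply: memv_suml => i _.
have -> : blk false *m (J i *m (J i)^T) =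
    if (m %/ #|H| <= i)%N then 0 else E i i (Xt 0).
  rewrite mulmxA -{1}(std_mx_block F dvdH i) mulmxA block_idemM X0 /std_E mulmx1.
  by case: (_ <= _)%N (std_mx_block F dvdH i) => /= [_|->]; rewrite ?mul0mx.
case: ifP => _; rewrite ?mem0v //.
by have := GammaH_in i i 0; rewrite subrr.
Qed.

Lemma GammaH_mx_grading (H0 : #|H|%:R != 0 :> F) : mx_grading Gam.
Proof.
have [C [c [c_bij cD cardC]]] := char_finZmod H0.
split.
  have -> : Gam = basis_part (gam_ev dvdH c) (@gam_deg F m n H C c).
    apply: functional_extensionality => g; exact: (GammaH_basis dvdH H0 c_bij cardC).
  apply: basis_part_direct.
  - exact: (gam_co_linear dvdH c).
  - exact: (gam_co_ev dvdH H0 c_bij).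
  exact: (gam_co_sum dvdH H0 c_bij cardC).
move=> g h a b ag bh.
suff /subvP/(_ a ag) : (Gam g <= linfun (mulmxr b) @^-1: Gam (g + h)%R)%VS.
  by rewrite -memv_preim lfunE.
apply: GammaH_subP => i j gij; rewrite -memv_preim lfunE /=.
suff /subvP/(_ b bh) : (Gam h <= linfun (mulmx (E i j (Xt g.1))) @^-1: Gam (g + h)%R)%VS.
  by rewrite -memv_preim lfunE.
apply: GammaH_subP => i' j' hij; rewrite -memv_preim lfunE /= std_E_mul.
case: eqP => [ji|_]; last exact: mem0v.
rewrite X_mul.
have := std_E_linear dvdH i j' (g.1.2 h.1.1) (Xt (g.1 + h.1)) 0.
rewrite (linear_fun0 (std_E_linear dvdH i j')) !addr0 => ->.
have := GammaH_in i j' (g.1 + h.1) => /(memvZ (g.1.2 h.1.1)).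
congr (_ \in Gam _); case: g h gij hij {ag bh} => [t v] [s w] /= -> ->.
by congr (_, _); rewrite ji addrA subrK.
Qed.

Lemma GammaH_Zsuper (H0 : #|H|%:R != 0 :> F) : (0 < m)%N -> (0 < n)%N ->
  is_Zsuper_grading Gam.
Proof.
move=> m0 n0; apply: (Zsuper_gradingP Gam m0 n0).2; split.
  exact: (GammaH_mx_grading H0).
exact: GammaH_block.
Qed.

End GammaHGrading.

(** * Support and structure of a graded division matrix algebra *)

Section FiniteSubgroup.

Variables (G : zmodType) (s : seq G).
Hypotheses (s0 : 0 \in s) (sB : forall x y, x \in s -> y \in s -> x - y \in s).

(** The closure proofs are arguments so that the group structure can be attached to the type: the
    sequence alone does not carry them. *)
Definition finsub (_ : 0 \in s) (_ : forall x y, x \in s -> y \in s -> x - y \in s) := seq_sub s.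
Local Notation S := (finsub s0 sB).

HB.instance Definition _ := Finite.on S.

Fact finsub_oppP (x : S) : - ssval x \in s.
Proof. by rewrite -sub0r sB // ssvalP. Qed.

Fact finsub_addP (x y : S) : ssval x + ssval y \in s.
Proof. by rewrite -[ssval y]opprK sB ?ssvalP ?finsub_oppP. Qed.

Definition finsub_zero : S := SeqSub s0.
Definition finsub_add (x y : S) : S := SeqSub (finsub_addP x y).
Definition finsub_opp (x : S) : S := SeqSub (finsub_oppP x).

Fact finsub_addA : associative finsub_add.
Proof. by move=> x y z; apply: val_inj; apply: addrA. Qed.
Fact finsub_addC : commutative finsub_add.
Proof. by move=> x y; apply: val_inj; apply: addrC. Qed.
Fact finsub_add0 : left_id finsub_zero finsub_add.
Proof. by move=> x; apply: val_inj; apply: add0r. Qed.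
Fact finsub_addN : left_inverse finsub_zero finsub_opp finsub_add.
Proof. by move=> x; apply: val_inj; apply: addNr. Qed.

HB.instance Definition _ := GRing.isZmodule.Build S
  finsub_addA finsub_addC finsub_add0 finsub_addN.

Definition finsub_finZmod : finZmodType := S.

End FiniteSubgroup.

Lemma comm_mx_all_scalar (F : fieldType) (n : nat) (a : 'M[F]_n.+1) :
  (forall b, a *m b = b *m a) -> a = (a 0 0)%:M.
Proof.
move=> a_comm; have aE i j k : a k i = a j j *+ (k == i).
  have /matrixP/(_ k j) := a_comm (delta_mx i j).
  rewrite mxE (bigD1 i) //= mxE !eqxx mulr1 big1 ?addr0 => [->|r /negPf ri]; last first.
    by rewrite mxE ri mulr0.
  rewrite mxE (bigD1 j) //= mxE eqxx andbT big1 ?addr0 => [|r /negPf rj]; last first.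
    by rewrite mxE rj andbF mul0r.
  by case: eqP; rewrite ?mul1r ?mul0r.
by apply/matrixP=> k i; rewrite mxE (aE i 0 k).
Qed.

Section DivisionSupport.

Variables (F : closedFieldType) (l : nat) (G : zmodType).
Local Notation M := 'M[F]_l.+1.
Variables (Dg : G -> {vspace M}).
Hypothesis gradD : mx_grading Dg.
Hypothesis prim : forall e : M, e \in Dg 0 -> e *m e = e -> e = 0 \/ e = 1%:M.

Lemma homogeneous_mul_neq0 g h (x y : M) :
  x \in Dg g -> y \in Dg h -> x != 0 -> y != 0 -> x *m y != 0.
Proof.
move=> xg yh x0 y0; have Ux := homogeneous_unit gradD prim xg x0.
by apply: contraNneq y0 => xy0; rewrite -[y](mulKmx Ux) xy0 mulmx0.
Qed.

(** Invertibility of homogeneous elements makes the support a subgroup; its components being lines,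
    its order is the dimension of the matrix algebra. *)
Lemma division_support_finite : exists s : seq G,
  [/\ uniq s, forall g, (g \in s) = (Dg g != 0%VS), 0 \in s,
      forall x y, x \in s -> y \in s -> x - y \in s & size s = (l.+1 * l.+1)%N].
Proof.
have [[s [Us V0 dV sV]] _] := gradD; exists [seq g <- s | Dg g != 0%VS].
have memE g : (g \in [seq g <- s | Dg g != 0%VS]) = (Dg g != 0%VS).
  by rewrite mem_filter; case: eqP => //= /eqP D0; apply: contraT => /V0/eqP; rewrite (negPf D0).
have nz g x : x \in Dg g -> x != 0 -> Dg g != 0%VS.
  by move=> xg; apply: contraNneq => D0; rewrite D0 memv0 in xg.
split.
- exact: filter_uniq.
- exact: memE.
- by rewrite memE; apply: (nz _ 1%:M (grading_one gradD)); apply: oner_neq0.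
- move=> x y; rewrite !memE -!vpick0 => Dx Dy.
  have [ux uy] := (memv_pick (Dg x), memv_pick (Dg y)).
  have Uy := homogeneous_unit gradD prim uy Dy.
  rewrite vpick0; apply: (nz _ (vpick (Dg x) *m invmx (vpick (Dg y)))).
    by apply: grading_mul => //; apply: homogeneous_invmx.
  apply: (homogeneous_mul_neq0 ux (homogeneous_invmx gradD uy Uy)) => //.
  by apply: contraTneq Uy => i0; rewrite -(unitmx_inv) i0 unitmxE det0 unitr0.
move: dV; rewrite directvE /= sV dimvf /dim /= => /eqP->.
rewrite size_filter -sum1_count big_mkcond /=; apply: eq_bigr => g _.
case: eqP => [->|/eqP]; first by rewrite dimv0.
rewrite -vpick0 => Dg0; have vg := memv_pick (Dg g).
have -> : Dg g = <[vpick (Dg g)]>%VS.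
  apply: subv_anti; rewrite -memvE vg andbT; apply/subvP=> x xg.
  by have [c ->] := homogeneous_line gradD prim vg Dg0 xg; rewrite memvZ ?memv_line.
by rewrite dim_vline Dg0.
Qed.

Lemma commutation_factor : exists b : G -> G -> F, forall g h x y,
  x \in Dg g -> y \in Dg h -> x *m y = b g h *: (y *m x).
Proof.
suff ex g h : exists c, forall x y, x \in Dg g -> y \in Dg h -> x *m y = c *: (y *m x).
  exists (fun g h => proj1_sig (constructive_indefinite_description _ (ex g h))).
  by move=> g h; apply: (proj2_sig (constructive_indefinite_description _ (ex g h))).
(* Off the support both products vanish, and 0 is a default value. *)
have [x0|x0] := eqVneq (vpick (Dg g)) 0.
  exists 0 => x y; move/eqP: x0; rewrite vpick0 => /eqP->.
  by rewrite memv0 => /eqP-> _; rewrite mul0mx mulmx0 scaler0.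
have [y0|y0] := eqVneq (vpick (Dg h)) 0.
  exists 0 => x y _; move/eqP: y0; rewrite vpick0 => /eqP->.
  by rewrite memv0 => /eqP->; rewrite mul0mx mulmx0 scaler0.
have [xg yh] := (memv_pick (Dg g), memv_pick (Dg h)).
have yx0 := homogeneous_mul_neq0 yh xg y0 x0.
have xyg : vpick (Dg g) *m vpick (Dg h) \in Dg (h + g).
  by rewrite addrC; apply: grading_mul.
have [c cP] := homogeneous_line gradD prim (grading_mul gradD yh xg) yx0 xyg.
exists c => x y /(homogeneous_line gradD prim xg x0)[a ->].
move=> /(homogeneous_line gradD prim yh y0)[d ->].
rewrite -!scalemxAl -!scalemxAr -?scalemxAl cP !scalerA; congr (_ *: _).
by rewrite mulrC mulrA mulrAC.
Qed.

(* An isotropic family of degrees lifts to homogeneous elements multiplying exactly: normalise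
   them to
   fix a common eigenvector. *)
Lemma isotropic_lift (I : zmodType) (d : I -> G) : {morph d : x y / x + y} ->
    (forall i, Dg (d i) != 0%VS) ->
    (forall i j x y, x \in Dg (d i) -> y \in Dg (d j) -> x *m y = y *m x) ->
  exists (Y : I -> M) (w : 'cV[F]_l.+1),
    [/\ w != 0, forall i, Y i \in Dg (d i), forall i, Y i *m w = w,
        forall i j, Y i *m Y j = Y (i + j) & forall i, Y i != 0].
Proof.
move=> dD Dn0 comm; pose x i := vpick (Dg (d i)).
have xD i : x i \in Dg (d i) by apply: memv_pick.
have xn0 i : x i != 0 by rewrite vpick0.
have Ux i := homogeneous_unit gradD prim (xD i) (xn0 i).
have [|||v [vn0 _ vx]] := @common_stable_eigenvector F _ I (fun i => (x i)^T) _ (1%:M).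
- by move=> i j; rewrite -!trmx_mul (comm j i).
- by move=> i; rewrite submx1.
- exact: oner_neq0.
have xw i : exists c, c != 0 /\ x i *m v^T = c *: v^T.
  have [c cP] := vx i; exists c; have xv : x i *m v^T = c *: v^T.
    by rewrite -[x i]trmxK -trmx_mul cP linearZ.
  split=> //; apply: contraNneq vn0 => c0; rewrite -trmx_eq0 -[v^T](mulKmx (Ux i)).
  by rewrite xv c0 scale0r mulmx0.
pose c i := proj1_sig (constructive_indefinite_description _ (xw i)).
have [c0 cP] : (forall i, c i != 0) /\ (forall i, x i *m v^T = c i *: v^T).
  by split=> i; rewrite /c; case: constructive_indefinite_description => ? [].
pose Y i := (c i)^-1 *: x i.
have YD i : Y i \in Dg (d i) by rewrite memvZ.
have Yw i : Y i *m v^T = v^T by rewrite -scalemxAl cP scalerA mulVf // scale1r.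
have Yn0 i : Y i != 0 by rewrite scaler_eq0 invr_eq0 (negPf (c0 i)) (negPf (xn0 i)).
have w0 : v^T != 0 by rewrite trmx_eq0.
exists Y, v^T; split=> // i j.
have YijD : Y i *m Y j \in Dg (d (i + j)) by rewrite dD grading_mul.
have [a aP] := homogeneous_line gradD prim (YD (i + j)) (Yn0 _) YijD.
have av : a *: v^T = v^T by rewrite -{1}(Yw (i + j)) scalemxAl -aP -mulmxA !Yw.
have : (a - 1) *: v^T == 0 by rewrite scalerBl av scale1r subrr.
by rewrite scaler_eq0 (negPf w0) orbF subr_eq0 aP => /eqP->; rewrite scale1r.
Qed.

End DivisionSupport.

Section DivisionStructure.

Variables (F : closedFieldType) (l : nat) (G : zmodType).
Local Notation M := 'M[F]_l.+1.
Variables (Dg : G -> {vspace M}).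
Hypothesis gradD : mx_grading Dg.
Hypothesis prim : forall e : M, e \in Dg 0 -> e *m e = e -> e = 0 \/ e = 1%:M.

(** Bimultiplicativity comes from moving an element across a nonzero triple product in two ways. An
    element whose degree is in the radical commutes with every component, hence is scalar and of
    degree 0. *)
Lemma division_form : exists (T : finZmodType) (v : T -> G) (b : T -> T -> F),
  [/\ [/\ {morph v : x y / x + y}, forall g, Dg g != 0%VS <-> exists t, v t = g
        & #|T| = (l.+1 * l.+1)%N],
      [/\ forall x y z, b (x + y) z = b x z * b y z,
          forall x y z, b x (y + z) = b x y * b x z,
          forall x, b x x = 1 & forall x, (forall y, b x y = 1) -> x = 0]
    & forall t u x y, x \in Dg (v t) -> y \in Dg (v u) -> x *m y = b t u *: (y *m x)].
Proof.
have [s [Us memS s0 sB size_s]] := division_support_finite gradD prim.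
have [b bP] := commutation_factor gradD prim.
pose T : finZmodType := finsub_finZmod s0 sB.
pose v (t : T) : G := ssval t.
pose x (t : T) := vpick (Dg (v t)).
have xD t : x t \in Dg (v t) by apply: memv_pick.
have xn0 t : x t != 0 by rewrite vpick0 -memS ssvalP.
have vD : {morph v : y z / y + z} by [].
have mulxn0 t u : x t *m x u != 0 by apply: (homogeneous_mul_neq0 gradD prim (xD t) (xD u)).
have inj (a c : F) (y : M) : y != 0 -> a *: y = c *: y -> a = c.
  move=> y0 /eqP; rewrite -subr_eq0 -scalerBl scaler_eq0 (negPf y0) orbF subr_eq0.
  by move/eqP.
have mulx3n0 t u w : x t *m (x u *m x w) != 0.
  apply: (homogeneous_mul_neq0 gradD prim (xD t)) (mulxn0 u w) => //.
  exact: (grading_mul gradD (xD u) (xD w)).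
exists T, v, (fun t u => b (v t) (v u)); split; last first.
- by move=> t u y z; apply: bP.
- split.
  + move=> t u w; apply: (inj _ _ _ (mulx3n0 w t u)).
    rewrite vD -(bP _ _ _ _ (grading_mul gradD (xD t) (xD u)) (xD w)).
    rewrite -mulmxA (bP _ _ _ _ (xD u) (xD w)) -scalemxAr [x t *m (_ *m _)]mulmxA.
    by rewrite (bP _ _ _ _ (xD t) (xD w)) -scalemxAl scalerA mulrC -mulmxA.
  + move=> t u w; apply: (inj _ _ _ (mulx3n0 u w t)).
    rewrite vD mulmxA -(bP _ _ _ _ (xD t) (grading_mul gradD (xD u) (xD w))).
    rewrite mulmxA (bP _ _ _ _ (xD t) (xD u)) -scalemxAl -mulmxA.
    by rewrite (bP _ _ _ _ (xD t) (xD w)) -scalemxAr scalerA mulmxA.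
  + move=> t; apply: (inj _ _ _ (mulxn0 t t)).
    by rewrite -(bP _ _ _ _ (xD t) (xD t)) scale1r.
  move=> t bt1; have [r [p projD]] := mx_grading_proj gradD; have [_ pV pS _] := projD.
  have x_comm y : x t *m y = y *m x t.
    rewrite [y]pS mulmx_sumr mulmx_suml; apply: eq_bigr => g _.
    have [gs|gs] := boolP (g \in s).
      by rewrite (bP _ _ _ _ (xD t) (pV g y)) (bt1 (SeqSub gs)) scale1r.
    move: (pV g y); move: gs; rewrite memS negbK => /eqP->; rewrite memv0 => /eqP->.
    by rewrite mulmx0 mul0mx.
  have x0 : x t \in Dg 0.
    by rewrite (comm_mx_all_scalar x_comm) -scalemx1 memvZ // grading_one.
  by apply: val_inj; apply: (grading_disjoint gradD (xD t) x0 (xn0 t)).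
split=> //.
  move=> g; rewrite -memS; split=> [gs | [t <-]]; last exact: ssvalP.
  by exists (SeqSub gs).
by rewrite -size_s -(card_seq_sub Us).
Qed.

(** The Lagrangian halves K and L lift to multiplicative families [Y] and [Z], and all [Z chi] fix a
    vector [w]. In the basis of the [Y h *m w], [Y] translates the indices and [Z chi] scales by
    values of [chi]: these are the matrices [X], and [Q] is the change of basis. *)
Lemma division_structure : exists K : finZmodType,
  [/\ #|K| = l.+1, #|K|%:R != 0 :> F
    & forall H : finZmodType, isomorphic K H ->
      exists (f : T_group F H -> G) (Q : 'M[F]_(l.+1, #|H|)) (Q' : 'M[F]_(#|H|, l.+1)),
        [/\ {morph f : x y / x + y}, Q *m Q' = 1%:M, Q' *m Q = 1%:M
          & forall t, Q *m X t *m Q' \in Dg (f t)]].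
Proof.
have [T [v [b [[vD vS cardT] [bDl bDr balt bnd] bP]]]] := division_form.
have [K [L [[iK iL injK injL] KLT]]] := exists_lagrangian_pair bDl bDr balt bnd.
have bsym := alt_form_sym1 bDl bDr balt.
have b0l := alt_form0l bDl balt; have b0r := alt_form0r bDr balt.
have leKL : (#|K| <= #|L|)%N by apply: (perfect_card_leq bDl bDr balt bnd).
have leLK : (#|L| <= #|K|)%N.
  apply: (perfect_card_leq bDl bDr balt bnd) => y Ly yK.
  by apply: injL => // z Kz; apply/bsym/yK.
have cardKL : #|K| = #|L| by apply/eqP; rewrite eqn_leq leKL.
have K0 : #|K|%:R != 0 :> F by apply: (card_group_neq0 bDl balt bnd).
have disjKL x : x \in K -> x \in L -> x = 0.
  by move=> Kx Lx; apply: injK => // y Ly; apply: iL.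
have cardK : #|K| = l.+1.
  (* T is the direct sum of K and L, which have the same order, so the order of K is the square root
     of that of T. *)
  have : #|setX K L| = #|T|.
    pose h (u : T * T) := u.1 + u.2; rewrite -[RHS]cardsT.
    have <- : h @: setX K L = [set: T].
      apply/setP=> t; rewrite inE; have [k [u [-> Kk Lu]]] := KLT t.
      by apply/imsetP; exists (k, u); rewrite // inE Kk.
    rewrite card_in_imset // => -[k u] [k' u']; rewrite !inE /= => /andP[Kk Lu] /andP[Kk' Lu'].
    rewrite /h /= => /(canRL (addrK _)) kE.
    have kk : k - k' = u' - u by rewrite kE -[k' + u' - u]addrA [k' + _]addrC addrK.
    have : k - k' = 0.
      apply: disjKL; first by rewrite (@groupM _ K) ?(@groupVr _ K).
      by rewrite kk (@groupM _ L) ?(@groupVr _ L).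
    move=> kk0; have /eqP := kk; rewrite kk0 eq_sym subr_eq0 => /eqP->.
    by move/eqP: kk0; rewrite subr_eq0 => /eqP->.
  rewrite cardsX -cardKL cardT => /eqP.
  rewrite -[(#|K| * _)%N]/(#|K| ^ 2)%N -[(l.+1 * _)%N]/(l.+1 ^ 2)%N eqn_exp2r //.
  by move/eqP.
exists (subgroup_finZmod K); rewrite !card_sig; split=> // H [i0 [[i1 i1K i0K] i0D]].
have i1D : {morph i1 : x y / x + y}.
  by move=> x y; apply: (can_inj i1K); rewrite i0D !i0K.
pose i (h : H) : T := val (i1 h).
have iD : {morph i : x y / x + y} by move=> x y; rewrite /i i1D.
have iK' h : i h \in K by apply: valP.
have cardH : #|H| = l.+1.
  by rewrite -cardK -(card_sig (fun x => x \in K)); apply: bij_eq_card; exists i0.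
have i_surj x : x \in K -> exists h, i h = x.
  by move=> Kx; exists (i0 (exist _ x Kx)); rewrite /i i1K.
(* Every character of H is represented by a unique element of L, again by counting characters. *)
have jex (chi : charGroup F H) : exists y, y \in L /\ forall h, b y (i h) = chi h.
  apply: NNPP => none.
  have : (#|{: option {y : T | y \in L}}| <= #|[set: H]|)%N.
    apply: (@card_group_chars F H [set: H] _ (fun o h => if o is Some y then b (val y) (i h) else
      chi h)).
    - by rewrite cardsT cardH -cardK.
    - by case=> [y|] h h' _ _; rewrite -[(h * h')%g]/(h + h') ?iD ?bDr ?charD.
    - by case=> [y|]; rewrite -[1%g]/(0 : H) ?char0 // (_ : i 0 = 0) //; apply: (addrI (i 0));
      rewrite -iD !addr0.
    have some_none (y : {y : T | y \in L}) : (forall h, b (val y) (i h) = chi h) -> False.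
      by move=> eq_y; apply: none; exists (val y); split=> //; apply: valP.
    case=> [y|] [y'|] // eq_f.
    - congr Some; apply: val_inj; apply/eqP; rewrite -subr_eq0; apply/eqP; apply: injL.
        by rewrite (@groupM _ L) ?(@groupVr _ L) ?(valP y) ?(valP y').
      move=> k Kk; apply: bsym; have [h <-] := i_surj k Kk.
      by rewrite bDl eq_f ?inE // mulrC (alt_formN bDl balt).
    - by case: (some_none y) => h; rewrite eq_f ?inE.
    by case: (some_none y') => h; rewrite -eq_f ?inE.
  by rewrite card_option card_sig cardsT cardH -cardKL cardK ltnn.
pose j chi := proj1_sig (constructive_indefinite_description _ (jex chi)).
have [jL jP] : (forall chi, j chi \in L) /\ (forall chi h, b (j chi) (i h) = chi h).
  by split=> chi; rewrite /j; case: constructive_indefinite_description => ? [].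
have j_uniq y (chi : charGroup F H) : y \in L -> (forall h, b y (i h) = chi h) -> y = j chi.
  move=> Ly yP; apply/eqP; rewrite -subr_eq0; apply/eqP; apply: injL.
    by rewrite (@groupM _ L) ?(@groupVr _ L).
  move=> k Kk; apply: bsym; have [h <-] := i_surj k Kk.
  by rewrite bDl yP -jP mulrC (alt_formN bDl balt).
have jD : {morph j : x y / x + y}.
  move=> x y; apply/esym/j_uniq; first by rewrite (@groupM _ L).
  by move=> h; rewrite bDl !jP char_mulE.
have j_surj y : y \in L -> exists chi, j chi = y.
  move=> Ly; have cP : is_group_char [ffun h => b y (i h)].
    rewrite /is_group_char ffunE (_ : i 0 = 0) ?b0r ?eqxx /=.
      by apply/forallP=> h; apply/forallP=> h'; rewrite !ffunE iD bDr.
    by apply: (addrI (i 0)); rewrite -iD !addr0.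
  by exists (CharGroup cP); apply/esym/j_uniq => // h; rewrite /= ffunE.
have vn0 t : Dg (v t) != 0%VS by apply/vS; exists t.
have [Y [wY [_ YD _ YM Yn0]]] : exists (Y : H -> M) (w : 'cV[F]_l.+1),
    [/\ w != 0, forall h, Y h \in Dg (v (i h)), forall h, Y h *m w = w,
        forall h h', Y h *m Y h' = Y (h + h') & forall h, Y h != 0].
  apply: (isotropic_lift gradD prim) => [x y|h|h h' x y xD yD]; rewrite ?iD ?vD //.
  by rewrite (bP _ _ _ _ xD yD) iK // scale1r.
have [Z [w [wn0 ZD Zw ZM Zn0]]] : exists (Z : charGroup F H -> M) (w : 'cV[F]_l.+1),
    [/\ w != 0, forall h, Z h \in Dg (v (j h)), forall h, Z h *m w = w,
        forall h h', Z h *m Z h' = Z (h + h') & forall h, Z h != 0].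
  apply: (isotropic_lift gradD prim) => [x y|h|h h' x y xD yD]; rewrite ?jD ?vD //.
  by rewrite (bP _ _ _ _ xD yD) iL // scale1r.
have ZY chi h : Z chi *m Y h = chi h *: (Y h *m Z chi).
  by rewrite (bP _ _ _ _ (ZD chi) (YD h)) jP.
pose Q : 'M[F]_(l.+1, #|H|) := \matrix_(r, c) (Y (enum_val c) *m w) r 0.
have colQ h : col (enum_rank h) Q = Y h *m w.
  by apply/matrixP=> r c; rewrite !mxE enum_rankK ord1.
(* Each component is spanned by some [Y h *m Z chi], and [Z chi] fixes [w]; so a row killing every
   [Y h *m w] kills the image of [w] under the whole matrix algebra. *)
have free_Q : row_free Q.
  rewrite -kermx_eq0 -submx0; apply/row_subP => r0.
  move: (row r0 _) (row_sub r0 (kermx Q)) => r /sub_kermxP rQ.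
  have rY h : r *m (Y h *m w) = 0 by rewrite -colQ colE mulmxA rQ mul0mx.
  have rd (d : M) : r *m d *m w = 0.
    have [s [p projD]] := mx_grading_proj gradD; have [_ pV pS _] := projD.
    rewrite [d]pS mulmx_sumr mulmx_suml big1 // => g _.
    have [->|pn0] := eqVneq (p g d) 0; first by rewrite mulmx0 mul0mx.
    have /vS[t tg] : Dg g != 0%VS.
      by apply: contraNneq pn0 => D0; rewrite -memv0 -D0 pV.
    have [k [u [tE Kk Lu]]] := KLT t.
    have [h hk] := i_surj k Kk; have [chi chiu] := j_surj u Lu.
    have YZD : Y h *m Z chi \in Dg g.
      by rewrite -tg tE vD -hk -chiu grading_mul.
    have YZn0 := homogeneous_mul_neq0 gradD prim (YD h) (ZD chi) (Yn0 h) (Zn0 chi).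
    have [a ->] := homogeneous_line gradD prim YZD YZn0 (pV g d).
    by rewrite -scalemxAr -scalemxAl -mulmxA -mulmxA Zw rY scaler0.
  have /matrix0Pn[a [b' wab]] := wn0; rewrite ord1 in wab.
  rewrite submx0; apply/eqP/rowP=> c; rewrite mxE.
  have /matrixP/(_ 0 0) := rd (delta_mx c a).
  rewrite mxE (bigD1 a) //= [X in _ + X]big1 ?addr0 => [|d /negPf da]; last first.
    by rewrite mxE big1 ?mul0r // => d' _; rewrite mxE da andbF mulr0.
  rewrite [X in X * _]mxE (bigD1 c) //= [X in _ + X]big1 ?addr0 => [|d /negPf dc]; last first.
    by rewrite mxE dc mulr0.
  rewrite !mxE !eqxx mulr1 => /eqP; rewrite mulf_eq0 (negPf wab) orbF.
  by move/eqP.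
have /row_freeP[Q' QQ'] := free_Q.
have Q'Q : Q' *m Q = 1%:M by apply: mulmx1C_eq QQ'.
exists (fun t => v (i t.1 + j t.2)), Q, Q'; split=> //.
  by move=> x y; rewrite -vD /= iD jD addrACA.
move=> t; suff -> : Q *m X t = Y t.1 *m Z t.2 *m Q.
  by rewrite -mulmxA QQ' mulmx1 vD grading_mul.
apply/matrixP=> r c; rewrite -(enum_valK c); move: (enum_val c) => h.
transitivity ((Y t.1 *m Z t.2 *m col (enum_rank h) Q) r 0); last first.
  by rewrite colE mulmxA -colE mxE.
rewrite colQ -mulmxA [Z _ *m _]mulmxA ZY -scalemxAl -mulmxA Zw -scalemxAr mulmxA YM -colQ.
rewrite mxE (bigD1 (enum_rank (t.1 + h))) //= big1 ?addr0 => [|a neq_a].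
  by rewrite !mxE !enum_rankK eqxx mulr1n mulrC.
rewrite [X t _ _]mxE enum_rankK [_ == _](_ : _ = false) ?mulr0n ?mulr0 //.
by apply: contraNF neq_a => /eqP <-; rewrite enum_valK.
Qed.

End DivisionStructure.

(** * Conjugating [GammaH] into a given grading *)

Section Coarsening.

Variables (F : closedFieldType) (m n : nat) (G : zmodType).
Local Notation M := 'M[F]_(m + n).
Local Notation blk := (block_idem F m n).
Variables (Gam : G -> {vspace M}).

Lemma block_idemT b : (blk b)^T = blk b.
Proof.
by apply/matrixP=> i j; rewrite !mxE; case: (eqVneq i j) => [->|].
Qed.

(** [P] carries the standard frame to the homogeneous one twisted by [Q]. Both frames pass from the
    first block to the second at the same index, [fd_k0], which makes [P] commute with the block
    idempotent. *)
Lemma GammaH_coarsening (m_gt0 : (0 < m)%N) : mx_grading Gam -> blk false \in Gam 0 ->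
  exists K : finZmodType, [/\ (#|K| %| gcdn m n)%N, #|K|%:R != 0 :> F
    & forall H : finZmodType, isomorphic K H ->
      exists (P P' : M) (psi : ambient_group F m n H -> G),
        [/\ P *m P' = 1%:M, P *m blk false = blk false *m P
          & forall g a, a \in @GammaH F m n H g -> P *m a *m P' \in Gam (psi g)]].
Proof.
move=> gradG e00; have [fd _] := frame_data_exists m_gt0 gradG e00.
have gradD := corner_mx_grading gradG (fd_RS fd) (fd_SR fd).
have [K [cardK K0 KH]] := division_structure gradD (@fd_prim _ _ _ _ _ fd).
have dvdK : (#|K| %| gcdn m n)%N.
  rewrite dvdn_gcd cardK; apply/andP.
  by split; apply/dvdnP; [exists (fd_k0 fd); apply: fd_m | exists (fd_k1 fd); apply: fd_n].
exists K; split=> // H KHiso; have [f [Q [Q' [fD QQ' Q'Q QX]]]] := KH H KHiso.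
have cardH : #|H| = #|K|.
  by case: KHiso => i [ib _]; rewrite (bij_eq_card ib).
have dvdH : (#|H| %| gcdn m n)%N by rewrite cardH.
have divE q r p : p = (q * r.+1)%N -> (p %/ r.+1 = q)%N by move=> ->; rewrite mulnK.
have k0E : (m %/ #|H| = fd_k0 fd)%N by rewrite cardH cardK (divE _ _ _ (fd_m fd)).
have k1E : (n %/ #|H| = fd_k1 fd)%N by rewrite cardH cardK (divE _ _ _ (fd_n fd)).
have kE : rank_H m n H = (fd_k0 fd + fd_k1 fd)%N by rewrite /rank_H k0E k1E.
pose ci := cast_ord kE; pose J := std_mx F dvdH.
pose A i := fd_A (ci i) *m Q; pose B i := Q' *m fd_B (ci i).
have [BA AB] := fd_frame fd; have [JJ J1] := std_frame F dvdH.
pose P : M := \sum_i A i *m (J i)^T; pose P' : M := \sum_i J i *m B i.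
have PE i : P *m J i = A i.
  rewrite mulmx_suml (bigD1 i) //= -mulmxA JJ eqxx mulmx1 big1 ?addr0 // => j /negPf ji.
  by rewrite -mulmxA JJ ji mulmx0.
have P'E i : (J i)^T *m P' = B i.
  rewrite mulmx_sumr (bigD1 i) //= mulmxA JJ eqxx mul1mx big1 ?addr0 // => j /negPf ji.
  by rewrite mulmxA JJ eq_sym ji mul0mx.
exists P, P', (fun g : ambient_group F m n H => f g.1 + \sum_i fd_deg (ci i) *~ g.2 0 i); split.
- rewrite mulmx_sumr (eq_bigr (fun i => fd_A (ci i) *m fd_B (ci i))) => [|i _]; last first.
    by rewrite mulmxA PE /A /B mulmxA -[_ *m Q *m Q']mulmxA QQ' mulmx1.
  rewrite -AB [RHS](reindex ci) //=.
  by exists (cast_ord (esym kE)) => x _; rewrite /ci ?cast_ordK ?cast_ordKV.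
- rewrite mulmx_suml mulmx_sumr; apply: eq_bigr => i _.
  have JT : (J i)^T *m blk (fd_k0 fd <= ci i)%N = (J i)^T.
    have Jb : blk (m %/ #|H| <= i)%N *m J i = J i := std_mx_block F dvdH i.
    by rewrite -[in RHS]Jb trmx_mul block_idemT k0E.
  case: (_ <= _)%N JT (fd_block (ci i)) => JT bA; last by rewrite -mulmxA JT /A !mulmxA bA.
  have JT0 : (J i)^T *m blk false = 0 by rewrite -JT -mulmxA block_idemM mulmx0.
  have bA0 : blk false *m fd_A (ci i) = 0 by rewrite -bA mulmxA block_idemM mul0mx.
  by rewrite -mulmxA JT0 mulmx0 /A !mulmxA bA0 !mul0mx.
move=> g a ag; set g' := _ + _.
suff /subvP/(_ a ag) : (@GammaH F m n H g <= linfun (mulmxr P' \o mulmx P) @^-1: Gam g')%VS.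
  by rewrite -memv_preim lfunE.
apply: (@GammaH_subP F m n H dvdH g) => i j gij; rewrite -memv_preim lfunE /=.
have -> : P *m std_E dvdH i j (X g.1) *m P' = A i *m X g.1 *m B j.
  by rewrite -P'E -PE !mulmxA.
rewrite /A /B.
have -> : g' = fd_deg (ci i) + f g.1 - fd_deg (ci j).
  rewrite /g' gij [fd_deg _ + f _]addrC -addrA; congr (_ + _).
  exact: (sum_delta_diff (fun r => fd_deg (ci r))).
have := QX g.1; rewrite mem_corner => dX.
(* Inserting [S *m R = 1] twice displays the element as a product of three homogeneous matrices, of
   degrees given by the frame, the corner and the frame. *)
have -> : fd_A (ci i) *m Q *m X g.1 *m (Q' *m fd_B (ci j)) =
    fd_A (ci i) *m fd_S fd *m (fd_R fd *m (Q *m X g.1 *m Q') *m fd_S fd) *m (fd_R fd *m fd_B (ci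
      j)).
  rewrite !mulmxA -[_ *m fd_S fd *m fd_R fd]mulmxA (fd_SR fd) mulmx1.
  by rewrite -[_ *m fd_S fd *m fd_R fd]mulmxA (fd_SR fd) mulmx1.
exact: (grading_mul gradG (grading_mul gradG (@fd_homA _ _ _ _ _ fd (ci i)) dX) (@fd_homB _ _ _ _
  _ fd (ci j))).
Qed.

End Coarsening.

(** * Free abelian groups and the universal group of [GammaH] *)

Section FreeGroup.

Variables (K : choiceType).
Local Notation Fg := {freeg K / int}.

Lemma freeg_sub_ind (Q : Fg -> Prop) :
  (forall x y, Q x -> Q y -> Q (x - y)) -> (forall s, Q << s >>) -> Q 0 -> forall x, Q x.
Proof.
move=> QB QU Q0 x.
have QN y : Q y -> Q (- y) by move=> Qy; rewrite -sub0r; apply: QB.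
have QD y z : Q y -> Q z -> Q (y + z) by move=> Qy Qz; rewrite -[z]opprK; apply: QB => //;
  apply: QN.
rewrite -(freeg_sumE x); apply: (big_ind Q) => // s _.
rewrite -[coeff s x]intz -freegU_mulz.
case: (coeff s x) => c; last rewrite NegzE mulrNz; last apply: QN.
  by rewrite -pmulrn; elim: c => [|c IH]; rewrite ?mulr0n // mulrS; apply: QD.
by rewrite -pmulrn; elim: c => [|c IH]; rewrite ?mulr1n // mulrS; apply: QD.
Qed.

End FreeGroup.

Section UniversalGroup.

Variables (F : closedFieldType) (m n : nat) (G : zmodType).
Local Notation M := 'M[F]_(m + n).
Variables (Gam : G -> {vspace M}).
Local Notation Fg := {freeg (supp Gam) / int}.

Lemma eval_support_ext (x : Fg) (r : seq (supp Gam)) : uniq r -> {subset dom x <= r} ->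
  eval_support x = \sum_(s <- r) val s *~ coeff s x.
Proof.
move=> Ur xr; rewrite [RHS](bigID (mem (dom x))) /= [X in _ + X]big1 ?addr0 => [|s sx].
  rewrite -[RHS]big_filter; apply: perm_big; apply: uniq_perm.
  - exact: uniq_dom.
  - exact: filter_uniq.
  by move=> s; rewrite mem_filter /=; case sx : (s \in dom x) => //=; rewrite xr.
by rewrite coeff_outdom // mulr0z.
Qed.

Lemma eval_supportB (x y : Fg) : eval_support (x - y) = eval_support x - eval_support y.
Proof.
pose r := undup (dom x ++ dom y ++ dom (x - y)).
have sub (z : Fg) : z \in [:: x; y; x - y] -> {subset dom z <= r}.
  move=> zxy s sz; rewrite mem_undup !mem_cat; move: zxy; rewrite !inE.
  by case/or3P => /eqP zE; rewrite -zE sz ?orbT.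
have ext z := @eval_support_ext z r (undup_uniq _).
rewrite (ext (x - y)) ?(ext x) ?(ext y); try by apply: sub; rewrite !inE eqxx ?orbT.
rewrite -sumrB; apply: eq_bigr => s _.
by rewrite coeffB mulrzBr.
Qed.

Lemma eval_support0 : eval_support (0 : Fg) = 0.
Proof. by rewrite -[0 in LHS](subrr 0) eval_supportB subrr. Qed.

Lemma eval_supportU (s : supp Gam) : eval_support (<< s >> : Fg) = val s.
Proof. by rewrite /eval_support domU1 big_seq1 coeffU eqxx mulr1. Qed.

Lemma relator_subgroupN (x : Fg) : relator_subgroup x -> relator_subgroup (- x).
Proof. by move=> Rx; rewrite -sub0r; apply: RelatorB => //; apply: Relator0. Qed.

Lemma relator_subgroupD (x y : Fg) :
  relator_subgroup x -> relator_subgroup y -> relator_subgroup (x + y).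
Proof.
by move=> Rx Ry; rewrite -[y]opprK; apply: RelatorB => //; apply: relator_subgroupN.
Qed.

Lemma relator_eval0 (x : Fg) : mx_grading Gam -> relator_subgroup x -> eval_support x = 0.
Proof.
move=> gradG; elim=> [s1 s2 s3 [[a [b [as1 bs2 ab0]]] s123]||{}x y _ x0 _ y0].
- rewrite eval_supportB -[<< s2 >>]opprK eval_supportB -[- << s2 >>]sub0r eval_supportB.
  rewrite eval_support0 sub0r opprK !eval_supportU.
  rewrite (grading_disjoint gradG (grading_mul gradG as1 bs2) (s123 _ _ as1 bs2) ab0).
  by rewrite subrr.
- exact: eval_support0.
by rewrite eval_supportB x0 y0 subrr.
Qed.

(* The generator of the free group at [g], or 0 when [g] is not in the support. *)
Definition supp_gen (g : G) : Fg := oapp (fun s : supp Gam => << s >>) 0 (insub g).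

Lemma supp_gen_val (s : supp Gam) : supp_gen (val s) = << s >>.
Proof. by rewrite /supp_gen valK. Qed.

Lemma supp_gen_relator g h (a b : M) : mx_grading Gam -> a \in Gam g -> b \in Gam h ->
  a *m b != 0 -> relator_subgroup (supp_gen g + supp_gen h - supp_gen (g + h)).
Proof.
move=> gradG ag bh ab0.
have nz k (c : M) : c \in Gam k -> c != 0 -> Gam k != 0%VS.
  by move=> ck; apply: contraNneq => Gk; rewrite Gk memv0 in ck.
have gn0 : Gam g != 0%VS by apply: (nz g a) => //; apply: contraNneq ab0 => ->; rewrite mul0mx.
have hn0 : Gam h != 0%VS by apply: (nz h b) => //; apply: contraNneq ab0 => ->; rewrite mulmx0.
have ghn0 : Gam (g + h) != 0%VS by apply: (nz _ _ (grading_mul gradG ag bh)).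
pose sg : supp Gam := exist _ g gn0; pose sh : supp Gam := exist _ h hn0.
pose sgh : supp Gam := exist _ (g + h) ghn0.
rewrite -[g]/(val sg) -[h]/(val sh) -[X in _ - supp_gen X]/(val sgh) !supp_gen_val.
apply: Relator; split; first by exists a, b.
by move=> c d; apply: grading_mul.
Qed.

End UniversalGroup.

Lemma zmod_cancel (V : zmodType) (a b c x y : V) :
  a + (x - y) - ((b + x) - (c + y)) = a + c - b.
Proof.
have -> : b + x - (c + y) = (b - c) + (x - y) by rewrite opprD addrACA.
by rewrite opprD [- (b - c) - _]addrC addrA addrK opprB addrA.
Qed.

Lemma zmod_cancel2 (V : zmodType) (a p q x y : V) :
  (x + q - y) - (a + p - y) = x - (a + (p - q)).
Proof. by rewrite opprB addrA subrK addrA opprB addrA. Qed.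

Section GammaHUniversal.

Variables (F : closedFieldType) (m n : nat) (H : finZmodType).
Hypotheses (dvdH : (#|H| %| gcdn m n)%N) (H0 : #|H|%:R != 0 :> F).
Hypotheses (m_gt0 : (0 < m)%N) (n_gt0 : (0 < n)%N).
Local Notation k := (rank_H m n H).
Local Notation M := 'M[F]_(m + n).
Local Notation Gam := (@GammaH F m n H).
Local Notation E := (std_E dvdH).
Local Notation e i := (delta_mx 0 i : 'rV[int]_k).
Local Notation Fg := {freeg (supp Gam) / int}.
Local Notation A := (ambient_group F m n H).

Let gradG : mx_grading Gam := GammaH_mx_grading dvdH H0.
Let i0 : 'I_k := Ordinal (ltnW (rank_H_gt1 dvdH m_gt0 n_gt0)).

Lemma GammaH_supp g : Gam g != 0%VS -> exists i j, g.2 = e i - e j.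
Proof.
move=> Gn0; apply: NNPP => none; case/eqP: Gn0; apply/eqP; rewrite -subv0.
by apply: (@GammaH_subP F m n H dvdH g) => i j gij; case: none; exists i, j.
Qed.

Lemma GammaH_gen_relator t u i j r :
  relator_subgroup (supp_gen Gam (t, e i - e j) + supp_gen Gam (u, e j - e r)
                    - supp_gen Gam (t + u, e i - e r)).
Proof.
have -> : (t + u, e i - e r) = (t, e i - e j) + (u, e j - e r) :> A.
  by congr (_, _); rewrite addrA subrK.
apply: (supp_gen_relator gradG (GammaH_in dvdH i j t) (GammaH_in dvdH j r u)).
rewrite std_E_mul eqxx; apply: std_E_neq0; rewrite X_mul scaler_eq0.
by rewrite (negPf (char_neq0 _ _)) (negPf (X_neq0 _)).
Qed.

Lemma GammaH_gen_diag t u :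
  relator_subgroup (supp_gen Gam (t, 0) + supp_gen Gam (u, 0) - supp_gen Gam (t + u, 0)).
Proof. by have := GammaH_gen_relator t u i0 i0 i0; rewrite (subrr (e i0)). Qed.

(* Modulo the relators every element of the free group is the value of [gam_lift] at its
   evaluation. *)
Definition gam_lift (g : A) : Fg :=
  supp_gen Gam (g.1, 0) + \sum_i supp_gen Gam (0, e i - e i0) *~ g.2 0 i.

Local Notation "x ~ y" := (relator_subgroup (x - y)) (at level 70).

Lemma relator_trans (y x z : Fg) : x ~ y -> y ~ z -> x ~ z.
Proof. by move=> xy /(relator_subgroupD xy); rewrite addrA subrK. Qed.

Lemma relator_sym (x y : Fg) : x ~ y -> y ~ x.
Proof. by move/relator_subgroupN; rewrite opprB. Qed.

Lemma relator_sub (x y x' y' : Fg) : x ~ x' -> y ~ y' -> (x - y) ~ (x' - y').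
Proof. by move=> xx yy; have := RelatorB xx yy; rewrite !opprD !opprK addrACA. Qed.

Lemma gam_liftB g h : gam_lift (g - h) ~ (gam_lift g - gam_lift h).
Proof.
rewrite /gam_lift /=.
have -> : \sum_i supp_gen Gam (0, e i - e i0) *~ (g.2 - h.2) 0 i =
    \sum_i supp_gen Gam (0, e i - e i0) *~ g.2 0 i - \sum_i supp_gen Gam (0, e i - e i0) *~ h.2 0 i.
  by rewrite -sumrB; apply: eq_bigr => i _; rewrite !mxE mulrzBr.
rewrite zmod_cancel; have := GammaH_gen_diag (g.1 - h.1) h.1.
by rewrite (subrK h.1 g.1).
Qed.

Lemma gam_lift0 : gam_lift 0 ~ 0.
Proof.
rewrite /gam_lift subr0 big1 ?addr0 => [|i _]; last by rewrite mxE mulr0z.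
by have := GammaH_gen_diag 0 0; rewrite addr0 addrK.
Qed.

Lemma gam_lift_gen (s : supp Gam) : << s >> ~ gam_lift (val s).
Proof.
rewrite -supp_gen_val; have [i [j]] := GammaH_supp (valP s).
case: (val s) => t v /= ->; rewrite /gam_lift /=.
rewrite (sum_delta_diff (fun r => supp_gen Gam (0, e r - e i0))).
(* Both relators end in the generator at [(t, e i - e i0)], reached from [e i - e j] in one and from
   the diagonal in the other; it cancels in their difference. *)
have := RelatorB (GammaH_gen_relator t 0 i j i0) (GammaH_gen_relator t 0 i i i0).
by rewrite !addr0 (subrr (e i)) zmod_cancel2.
Qed.

Lemma gam_lift_eval (x : Fg) : x ~ gam_lift (eval_support x).
Proof.
elim/freeg_sub_ind: x => [x y xr yr|s|].
- rewrite eval_supportB; apply: relator_trans (relator_sub xr yr) _.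
  exact/relator_sym/gam_liftB.
- by rewrite eval_supportU; apply: gam_lift_gen.
by rewrite eval_support0; apply/relator_sym/gam_lift0.
Qed.

Lemma eval_supp_gen g (a : M) : a \in Gam g -> a != 0 -> eval_support (supp_gen Gam g) = g.
Proof.
move=> ag a0; have gn0 : Gam g != 0%VS.
  by apply: contraNneq a0 => Gg; rewrite Gg memv0 in ag.
by rewrite -[g in LHS]/(val (exist _ g gn0 : supp Gam)) supp_gen_val eval_supportU.
Qed.

Lemma eval_gam_lift (g : A) : \sum_i g.2 0 i = 0 -> eval_support (gam_lift g) = g.
Proof.
move=> g0; pose ev : {additive Fg -> A} := HB.pack (@eval_support F m n A Gam)
  (GRing.isZmodMorphism.Build _ _ (@eval_support F m n A Gam) (@eval_supportB F m n A Gam)).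
have inB : {morph (fun w : 'rV[int]_k => (0, w) : A) : x y / x - y}.
  by move=> x y; congr (_, _); rewrite subr0.
pose inr : {additive 'rV[int]_k -> A} := HB.pack (fun w : 'rV[int]_k => (0, w) : A)
  (GRing.isZmodMorphism.Build _ _ (fun w : 'rV[int]_k => (0, w) : A) inB).
have evE t i j : eval_support (supp_gen Gam (t, e i - e j)) = (t, e i - e j).
  by apply: (eval_supp_gen (GammaH_in dvdH i j t)); apply: std_E_neq0; apply: X_neq0.
rewrite /gam_lift -[eval_support _]/(ev _) raddfD raddf_sum.
have -> : ev (supp_gen Gam (g.1, 0)) = (g.1, 0).
  by have := evE g.1 i0 i0; rewrite (subrr (e i0)).
rewrite (eq_bigr (fun i => inr (g.2 0 i *: (e i - e i0)))) => [|i _]; last first.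
  by rewrite raddfMz -[in RHS](intz (g.2 0 i)) scaler_int raddfMz; congr (_ *~ _); apply: evE.
(* The multiples of [e i0] contributed by the base point add up to the sum of the coordinates, which
   vanishes on [G_H]. *)
rewrite -raddf_sum; under eq_bigr do rewrite scalerBr.
rewrite sumrB -scaler_suml g0 scale0r subr0 -row_sum_delta.
by case: (g) => t v; congr (_, _); rewrite ?addr0 ?add0r.
Qed.

Lemma GammaH_universal : is_universal_group Gam (@G_H F m n H).
Proof.
split=> [g|x]; last first.
  split=> [x0|/(relator_eval0 gradG) //].
  have := gam_lift_eval x; rewrite x0 => /relator_trans/(_ gam_lift0).
  by rewrite subr0.
split=> [/eqP g0 | [x <-]]; first by exists (gam_lift g); apply: eval_gam_lift.
rewrite /G_H; elim/freeg_sub_ind: x => [x y /eqP x0 /eqP y0|s|].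
- by rewrite eval_supportB; under eq_bigr do rewrite !mxE; rewrite sumrB x0 y0 subrr.
- rewrite eval_supportU; have [i [j ->]] := GammaH_supp (valP s).
  have := sum_delta_diff (fun=> 1 : int) i j; rewrite subrr => /eqP.
  by under eq_bigr do rewrite intz.
by rewrite eval_support0 big1 // => i _; rewrite mxE.
Qed.

End GammaHUniversal.

(** * Finite abelian groups are determined by their torsion counts *)

Section AbelianCounts.

Local Open Scope group_scope.

Lemma card_Ldiv_dprod (gT : finGroupType) (A B G : {group gT}) d :
  abelian G -> A \x B = G -> #|'Ldiv_d(G)| = (#|'Ldiv_d(A)| * #|'Ldiv_d(B)|)%N.
Proof.
move=> abG defG; have [_ AB cAB tiAB] := dprodP defG.
have sAG : A \subset G by rewrite -AB mulG_subl.
have sBG : B \subset G by rewrite -AB mulG_subr.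
have gA := group_Ldiv d (abelianS sAG abG); have gB := group_Ldiv d (abelianS sBG abG).
have -> : 'Ldiv_d(G) = Group gA * Group gB.
  apply/setP=> x; rewrite !inE; apply/andP/mulsgP => [[]|[a b]].
    rewrite -AB => /mulsgP[a b Aa Bb ->].
    have cab : commute a b by apply: (centsP abG); rewrite ?(subsetP sAG a) ?(subsetP sBG b).
    rewrite expgMn // => /eqP ab1; have ad : a ^+ d = 1.
      apply/set1gP; rewrite -tiAB inE groupX //=.
      by rewrite -groupV (mulg1_eq ab1) groupX.
    have bd : b ^+ d = 1 by move: ab1; rewrite ad mul1g.
    by exists a b; rewrite // !inE ?Aa ?Bb ?ad ?bd eqxx.
  rewrite !inE => /andP[Aa /eqP ad] /andP[Bb /eqP bd] ->.
  rewrite groupM ?(subsetP sAG a) ?(subsetP sBG b) //.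
  have cab : commute a b by apply: (centsP abG); rewrite ?(subsetP sAG a) ?(subsetP sBG b).
  by rewrite expgMn // ad bd mulg1 eqxx.
have tiL : Group gA :&: Group gB = 1.
  by apply/trivgP; rewrite /= -tiAB setISS ?subsetIl.
exact: (TI_cardMg tiL).
Qed.

Lemma isog_card_Ldiv (gT hT : finGroupType) (G : {group gT}) (K : {group hT}) d :
  G \isog K -> #|'Ldiv_d(G)| = #|'Ldiv_d(K)|.
Proof.
case/isogP=> f injf <-.
by rewrite -(injm_Ldiv injf) card_injm ?subsetIl.
Qed.

(** The counts determine order and exponent. A cyclic subgroup of order the exponent splits off both
    groups; its counts cancel, and the complements are smaller. *)
Lemma abelian_isog_Ldiv (gT hT : finGroupType) (G : {group gT}) (K : {group hT}) :
    abelian G -> abelian K -> (forall d, #|'Ldiv_d(G)| = #|'Ldiv_d(K)|) -> G \isog K.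
Proof.
have [r] := ubnP #|G|; elim: r gT hT G K => // r IH gT hT G K; rewrite ltnS => rG abG abK eqL.
have Ldiv_full (T : finGroupType) (A : {group T}) d : (exponent A %| d)%N = (#|'Ldiv_d(A)| == #|A|).
  apply/exponentP/eqP => [Ad|Ad x Ax].
    by congr #|pred_of_set _|; apply/setIidPl/subsetP => x Ax; rewrite inE Ad.
  have /eqP eqA : 'Ldiv_d(A) == A :> {set T} by rewrite eqEcard subsetIl Ad /=.
  by have : x \in 'Ldiv_d(A) by [rewrite eqA]; rewrite !inE => /andP[_ /eqP].
have cardGK : #|G| = #|K|.
  (* The product of the two orders is a multiple of both exponents, so its torsion is the whole of
     either group. *)
  have /eqP <- : #|'Ldiv_(#|G| * #|K|)(G)| == #|G|.
    by rewrite -Ldiv_full dvdn_mulr ?exponent_dvdn.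
  by rewrite eqL; apply/eqP; rewrite -Ldiv_full dvdn_mull ?exponent_dvdn.
have expGK : exponent G = exponent K.
  apply/eqP; rewrite eqn_dvd; apply/andP; split.
    by rewrite Ldiv_full eqL cardGK -Ldiv_full.
  by rewrite Ldiv_full -eqL -cardGK -Ldiv_full.
have [G1|G1] := eqVneq #|G| 1%N.
  have /(@card1_trivg _ _) K1 : #|K| = 1%N by rewrite -cardGK.
  have cG : cyclic G by rewrite (card1_trivg G1) cyclic1.
  have cK : cyclic K by rewrite K1 cyclic1.
  by rewrite isog_cyclic_card // cK cardGK eqxx.
have [a Ga oa] := exponent_witness (abelian_nil abG).
have [b Kb ob] := exponent_witness (abelian_nil abK).
have /splitsP[A /complP[tiA defG]] := abelian_splits Ga (esym oa) abG.
have /splitsP[B /complP[tiB defK]] := abelian_splits Kb (esym ob) abK.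
have sAG : A \subset G by rewrite -defG mulG_subr.
have sBK : B \subset K by rewrite -defK mulG_subr.
have dG : <[a]> \x A = G.
  by rewrite dprodE // (sub_abelian_cent2 abG) ?cycle_subG.
have dK : <[b]> \x B = K.
  by rewrite dprodE // (sub_abelian_cent2 abK) ?cycle_subG.
have isoab : <[a]> \isog <[b]>.
  by rewrite isog_cyclic_card ?cycle_cyclic //= -!orderE -oa -ob expGK.
apply: (isog_dprod dG dK isoab); apply: IH.
- apply: leq_trans rG; rewrite -(dprod_card dG) -[X in (X < _)%N]mul1n ltn_pmul2r ?cardG_gt0 //.
  rewrite -orderE -oa; apply: contraR G1; rewrite -leqNgt => exp1.
  have : (exponent G %| 1)%N by rewrite dvdn1 eqn_leq exp1 exponent_gt0.
  by rewrite -trivg_exponent => /eqP->; rewrite cards1.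
- exact: abelianS abG.
- exact: abelianS abK.
move=> d; apply/eqP; rewrite -(eqn_pmul2l (_ : 0 < #|'Ldiv_d(<[a]>)|)%N).
  by rewrite -(card_Ldiv_dprod d abG dG) (isog_card_Ldiv d isoab) -(card_Ldiv_dprod d abK dK) eqL.
by apply/card_gt0P; exists 1; rewrite !inE group1 expg1n eqxx.
Qed.

End AbelianCounts.

Section TorsionCounts.

Variable (F : fieldType).

Definition torsion (A : finZmodType) (d : nat) : {set A} := [set x | x *+ d == 0].

(* The characters [b x] with [x] of order dividing [d] are those of the quotient of [B] by its
   [d]-multiples, whose order is the number of elements of [B] of order dividing [d]. *)
Lemma pairing_torsion_leq (A B : finZmodType) (b : A -> B -> F) d :
    #|B|%:R != 0 :> F ->
    (forall x y z, b (x + y) z = b x z * b y z) ->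
    (forall x y z, b x (y + z) = b x y * b x z) ->
    (forall x y, b x y != 0) -> (forall x, (forall y, b x y = 1) -> x = 0) ->
  (#|torsion A d| <= #|torsion B d|)%N.
Proof.
move=> B0 bDl bDr bn0 bnd.
have b0r x : b x 0 = 1.
  by apply: (mulfI (bn0 x 0)); rewrite -bDr addr0 mulr1.
have b0l y : b 0 y = 1.
  by apply: (mulfI (bn0 0 y)); rewrite -bDl addr0 mulr1.
have bMn x y i : b (x *+ i) y = b x (y *+ i).
  by elim: i => [|i IH]; rewrite ?mulr0n ?b0l ?b0r // !mulrS bDl bDr IH.
have bNl x y : b (- x) y * b x y = 1 by rewrite -bDl addNr b0l.
have dM : {in [set: B] &, {morph (fun x : B => x *+ d) : x y / (x * y)%g}}.
  by move=> x y _ _; apply: mulrnDl.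
pose f := Morphism dM; pose D := (f @* [set: B])%G.
have cardD : (#|D| * #|torsion B d|)%N = #|[set: B]|.
  have kerE : ('ker f)%g = torsion B d by apply/setP=> x; rewrite !inE.
  by rewrite card_morphim setTI mulnC -kerE Lagrange ?subsetT.
have cardQ : #|([set: B] / D)%g| = #|torsion B d|.
  have nD : (D <| [set: B])%g by rewrite -sub_abelian_normal ?subsetT // FinRing.zmod_abelian.
  apply/eqP; rewrite -(eqn_pmul2l (cardG_gt0 D)) card_quotient ?normal_norm //.
  by rewrite Lagrange ?subsetT // cardD.
rewrite -cardQ.
have -> : #|torsion A d| = #|{: {x | x \in torsion A d}}| by rewrite card_sig.
have nD y : y \in ('N(D))%g.
  by apply: (subsetP (sub_abelian_norm (FinRing.zmod_abelian [set: B]) (subsetT D))); rewrite inE.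
have b_coset (x : {x | x \in torsion A d}) y : b (val x) (repr (coset D y)) = b (val x) y.
  have /rcoset_kercosetP/rcosetP[//|//|z /morphimP[e _ _ ->] ->] :
    coset D (repr (coset D y)) = coset D y by rewrite coset_reprK.
  rewrite -[(_ * y)%g]/(e *+ d + y) bDr -bMn.
  by have := valP x; rewrite inE => /eqP->; rewrite b0l mul1r.
apply: (@card_group_chars F _ ([set: B] / D)%G _ (fun x q => b (val x) (repr q))).
- rewrite cardQ; apply: contraNneq B0 => t0.
  by rewrite -cardsT -cardD natrM t0 mulr0.
- move=> x q1 q2 _ _; rewrite -bDr -(b_coset x (_ + _)); congr (b _ (repr _)).
  by rewrite -[_ + _]/(repr q1 * repr q2)%g morphM ?nD //= !coset_reprK.
- by move=> x; rewrite repr_coset1 -[1%g]/(0 : B) b0r.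
move=> x x' eq_b; apply: val_inj; apply/eqP; rewrite -subr_eq0; apply/eqP; apply: bnd => y.
rewrite bDl -(b_coset x y) eq_b ?b_coset; first by rewrite mulrC bNl.
by rewrite mem_quotient ?inE.
Qed.

End TorsionCounts.

Lemma morphMn (U V : zmodType) (f : U -> V) : {morph f : x y / x + y} ->
  forall x d, f (x *+ d) = f x *+ d.
Proof.
move=> fD x; have f0 : f 0 = 0 by apply: (addrI (f 0)); rewrite -fD !addr0.
by elim=> [|d IH]; rewrite ?mulr0n // !mulrS fD IH.
Qed.

Lemma pair_mulrn (U V : zmodType) (x : U * V) d : x *+ d = (x.1 *+ d, x.2 *+ d).
Proof. by elim: d => [|d IH]; rewrite ?mulr0n // !mulrS IH. Qed.

Section RecoverH.

Variable (F : closedFieldType).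

Lemma card_torsion_dual (H C : finZmodType) (c : C -> charGroup F H) d :
    #|H|%:R != 0 :> F -> bijective c -> {morph c : x y / x + y} -> #|C| = #|H| ->
  #|torsion C d| = #|torsion H d|.
Proof.
move=> H0 c_bij cD cardC; have c0 : c 0 = 0.
  by apply: (addrI (c 0)); rewrite -cD !addr0.
apply/eqP; rewrite eqn_leq; apply/andP; split.
  apply: (@pairing_torsion_leq F C H (fun k h => c k h)) => //.
  - by move=> x y h; rewrite cD char_mulE.
  - by move=> x y h; rewrite charD.
  - by move=> x y; apply: char_neq0.
  move=> x cx1; apply: (bij_inj c_bij); rewrite c0; apply: char_ext => h.
  by rewrite cx1 char_oneE.
apply: (@pairing_torsion_leq F H C (fun h k => c k h)) => //.
- by rewrite cardC.
- by move=> x y h; rewrite charD.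
- by move=> x y h; rewrite cD char_mulE.
- by move=> x y; apply: char_neq0.
move=> x cx1; apply/eqP/negPn/negP => x0.
have [chi /eqP[]] := char_separates H0 c_bij cardC x0.
by have [c' _ cK] := c_bij; rewrite -(cK chi).
Qed.

(** H and its dual have equally many elements of order dividing [d], so the count for T is the
    square of the count for H, and squares can be compared. *)
Lemma T_group_torsion_leq (H H' : finZmodType) (tau : T_group F H -> T_group F H') d :
    #|H|%:R != 0 :> F -> #|H'|%:R != 0 :> F -> injective tau -> {morph tau : x y / x + y} ->
  (#|torsion H d| <= #|torsion H' d|)%N.
Proof.
move=> H0 H0' tau_inj tauD.
have [C [c [c_bij cD cardC]]] := char_finZmod H0.
have [C' [c' [c'_bij c'D cardC']]] := char_finZmod H0'.
have [i' i'K c'K] := c'_bij.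
have tau0 : tau 0 = 0 by apply: (addrI (tau 0)); rewrite -tauD !addr0.
pose f (u : H * C) : H' * C' := let v := tau (u.1, c u.2) in (v.1, i' v.2).
have f_inj : injective f.
  move=> [h k] [h' k'] /= [e1 /(can_inj c'K) e2].
  have /tau_inj[-> /(bij_inj c_bij)->] // : tau (h, c k) = tau (h', c k').
  by move: e1 e2; case: (tau _) => ? ?; case: (tau _) => ? ? /= -> ->.
have : (#|setX (torsion H d) (torsion C d)| <= #|setX (torsion H' d) (torsion C' d)|)%N.
  rewrite -(card_imset _ f_inj); apply: subset_leq_card; apply/subsetP=> _ /imsetP[[h k] + ->].
  rewrite !inE /= => /andP[/eqP hd /eqP kd].
  have : tau (h, c k) *+ d = 0.
    rewrite -(morphMn tauD) pair_mulrn /= hd -(morphMn cD) kd.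
    by rewrite (_ : (0, c 0) = 0) //; congr (_, _); apply: (addrI (c 0)); rewrite -cD !addr0.
  rewrite pair_mulrn => -[-> v2]; rewrite eqxx /=.
  apply/eqP; apply: (can_inj i'K); rewrite (morphMn c'D) c'K v2.
  by apply: (addrI (c' 0)); rewrite -c'D !addr0.
rewrite !cardsX (card_torsion_dual d H0 c_bij cD cardC).
rewrite (card_torsion_dual d H0' c'_bij c'D cardC').
by rewrite -[(_ * _)%N]/(_ ^ 2)%N -[X in (_ <= X)%N]/(_ ^ 2)%N leq_exp2r.
Qed.

(** Injections in both directions are enough for equal torsion counts, so the map on degrees induced
    by an equivalence need not be shown to be onto. *)
Lemma T_group_recover (H H' : finZmodType) (tau : T_group F H -> T_group F H')
    (tau' : T_group F H' -> T_group F H) :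
    #|H|%:R != 0 :> F -> #|H'|%:R != 0 :> F ->
    injective tau -> {morph tau : x y / x + y} ->
    injective tau' -> {morph tau' : x y / x + y} ->
  isomorphic H H'.
Proof.
move=> H0 H0' tau_inj tauD tau'_inj tau'D.
have : ([set: H] \isog [set: H'])%g.
  apply: abelian_isog_Ldiv => [||d]; rewrite ?FinRing.zmod_abelian //.
  have LdivE (A : finZmodType) : 'Ldiv_d([set: A])%g = torsion A d.
    by apply/setP=> x; rewrite !inE.
  rewrite !LdivE; apply/eqP; rewrite eqn_leq.
  by rewrite (T_group_torsion_leq d H0 H0' tau_inj tauD) (T_group_torsion_leq d H0' H0 tau'_inj
    tau'D).
case/isogP=> f injf fH; exists f; split; last by move=> x y; apply: morphM; rewrite inE.
have f_inj : injective f by move=> x y; apply: (injmP injf); rewrite inE.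
apply: inj_card_bij f_inj _.
by rewrite -[#|H|]cardsT -[#|H'|]cardsT -fH card_injm.
Qed.

End RecoverH.

(** * Recovering T from the equivalence class of [GammaH] *)

Section EquivalentRecover.

Variables (F : closedFieldType) (m n : nat) (H H' : finZmodType).
Hypotheses (dvdH : (#|H| %| gcdn m n)%N) (dvdH' : (#|H'| %| gcdn m n)%N).
Hypotheses (H0 : #|H|%:R != 0 :> F) (H0' : #|H'|%:R != 0 :> F).
Hypotheses (m_gt0 : (0 < m)%N).
Local Notation M := 'M[F]_(m + n).

(* The element 1 (x) X_t spanning an invertible part of the component of degree (t, 0). *)
Definition std_X (t : T_group F H) : M := \sum_i std_E dvdH i i (X t).

Lemma std_X_in t : std_X t \in @GammaH F m n H (t, 0).
Proof.
apply: memv_suml => i _; have := GammaH_in dvdH i i t.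
by rewrite subrr.
Qed.

Lemma std_X_mul t u : std_X t *m std_X u = (t.2 u.1) *: std_X (t + u).
Proof.
rewrite /std_X mulmx_suml scaler_sumr; apply: eq_bigr => i _.
rewrite mulmx_sumr (bigD1 i) //= big1 ?addr0 => [|j /negPf ji].
  by rewrite std_E_mul eqxx X_mul /std_E -scalemxAr -scalemxAl.
by rewrite std_E_mul eq_sym ji.
Qed.

Lemma std_X0 : std_X 0 = 1%:M.
Proof.
rewrite -(std_frame F dvdH).2; apply: eq_bigr => i _.
by rewrite X0 /std_E mulmx1.
Qed.

Lemma std_X_inv t : exists y, std_X t *m y = 1%:M.
Proof.
exists ((t.2 (- t.1))^-1 *: std_X (- t)).
by rewrite -scalemxAr std_X_mul scalerA mulVf ?char_neq0 // scale1r subrr std_X0.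
Qed.

Lemma one_neq0 : (1%:M : M) != 0.
Proof.
have N0 : (0 < m + n)%N by rewrite addn_gt0 m_gt0.
by apply/matrix0Pn; exists (Ordinal N0), (Ordinal N0); rewrite mxE eqxx oner_neq0.
Qed.

Lemma std_X_neq0 t : std_X t != 0.
Proof.
have [y ty] := std_X_inv t; apply: contraNneq one_neq0 => t0.
by rewrite -ty t0 mul0mx.
Qed.

Lemma GammaH_off_diag_nilpotent (g : ambient_group F m n H') a :
  g.2 != 0 -> a \in @GammaH F m n H' g -> a *m a = 0.
Proof.
move=> g2 ag; have [[i [j gij]]|none] := classic (exists i j, g.2 = delta_mx 0 i - delta_mx 0 j).
  have ij : i != j by apply: contraNneq g2 => ij; rewrite gij ij subrr.
  have /subvP/(_ a ag)/vlineP[x ->] :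
      (@GammaH F m n H' g <= <[std_E dvdH' i j (X g.1)]>)%VS.
    apply: (@GammaH_subP F m n H' dvdH' g) => i' j'; rewrite gij => /basis_diffP[[<- <-]|[ij' _]].
      exact: memv_line.
    by rewrite ij' eqxx in ij.
  by rewrite -scalemxAl -scalemxAr std_E_mul eq_sym (negPf ij) !scaler0.
have /subvP/(_ a ag) : (@GammaH F m n H' g <= 0)%VS.
  by apply: (@GammaH_subP F m n H' dvdH' g) => i j gij; case: none; exists i, j.
by rewrite memv0 => /eqP->; rewrite mul0mx.
Qed.

(** The components of degree [(t, 0)] contain invertible elements, whereas those with nonzero second
    coordinate consist of elements of square zero, so an equivalence sends the former degrees to
    degrees of the same kind. An equivalence gives only a bijection of supports; additivity is read
    off the nonzero products of the [std_X]. *)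
Lemma equivalent_T_group : equivalent (@GammaH F m n H) (@GammaH F m n H') ->
  exists tau : T_group F H -> T_group F H', injective tau /\ {morph tau : x y / x + y}.
Proof.
case=> phi [alpha [[phi_bij phi1 phiM _] alpha_bij phiG]].
have gradG' := GammaH_mx_grading dvdH' H0'.
have nz t : @GammaH F m n H (t, 0) != 0%VS.
  by apply: contraNneq (std_X_neq0 t) => G0; rewrite -memv0 -G0 std_X_in.
pose s t : supp (@GammaH F m n H) := exist _ (t, 0) (nz t).
have phi_in t : phi (std_X t) \in @GammaH F m n H' (val (alpha (s t))).
  by rewrite -phiG; apply: memv_img; apply: std_X_in.
have phi_n0 (a : M) : a != 0 -> phi a != 0.
  by apply: contraNneq => pa; apply/eqP/(bij_inj phi_bij); rewrite pa linear0.
have alpha2 t : (val (alpha (s t))).2 = 0.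
  apply/eqP/negPn/negP => a2; have nil := GammaH_off_diag_nilpotent a2 (phi_in t).
  have [y ty] := std_X_inv t; case/eqP: (phi_n0 _ (std_X_neq0 t)).
  by rewrite -[phi _]mulmx1 -phi1 -ty phiM mulmxA nil mul0mx.
exists (fun t => (val (alpha (s t))).1); split=> [t u eq_tu|t u].
  have /(bij_inj alpha_bij) : alpha (s t) = alpha (s u).
    apply: val_inj; move: eq_tu (alpha2 t) (alpha2 u).
    by case: (val (alpha (s t))) => ? ?; case: (val (alpha (s u))) => ? ? /= -> -> ->.
  by move/(congr1 val) => -[].
have tu : phi (std_X t *m std_X u) \in @GammaH F m n H' (val (alpha (s (t + u)))).
  by rewrite std_X_mul linearZ /=; apply: memvZ; apply: phi_in.
have tu' : phi (std_X t *m std_X u) \in @GammaH F m n H' (val (alpha (s t)) + val (alpha (s u))).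
  by rewrite phiM; apply: (grading_mul gradG') (phi_in t) (phi_in u).
have tu0 : phi (std_X t *m std_X u) != 0.
  by apply: phi_n0; rewrite std_X_mul scaler_eq0 (negPf (char_neq0 _ _)) (negPf (std_X_neq0 _)).
by have := grading_disjoint gradG' tu tu' tu0 => ->.
Qed.

End EquivalentRecover.

Section Equivalences.

Variables (F : fieldType) (m n : nat).
Local Notation M := 'M[F]_(m + n).

Lemma equivalent_sym (G G' : zmodType) (Gam : G -> {vspace M}) (Gam' : G' -> {vspace M}) :
  equivalent Gam Gam' -> equivalent Gam' Gam.
Proof.
case=> phi [alpha [[phi_bij phi1 phiM phip] [beta alphaK betaK] phiG]].
have ker0 : lker phi == 0%VS by apply/lker0P; apply: bij_inj.
have [phiK phiVK] := (lker0_lfunK ker0, lker0_lfunVK ker0).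
have imgV (U W : {vspace M}) : (phi @: U)%VS = W -> (phi^-1 @: W)%VS = U.
  move=> <-; rewrite -limg_comp (_ : (phi^-1 \o phi)%VF = \1%VF) ?lim1g //.
  by apply/lfunP=> x; rewrite comp_lfunE id_lfunE phiK.
exists (phi^-1)%VF, beta; split.
- split.
  + by exists phi.
  + by apply: (bij_inj phi_bij); rewrite phiVK phi1.
  + by move=> a b; apply: (bij_inj phi_bij); rewrite phiM !phiVK.
  by move=> p; apply: imgV.
- by exists alpha.
by move=> t; apply: imgV; rewrite -{2}(betaK t).
Qed.

Lemma equivalent_trans (G G' G'' : zmodType) (Gam : G -> {vspace M}) (Gam' : G' -> {vspace M})
    (Gam'' : G'' -> {vspace M}) :
  equivalent Gam Gam' -> equivalent Gam' Gam'' -> equivalent Gam Gam''.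
Proof.
case=> phi [alpha [[phi_bij phi1 phiM phip] alpha_bij phiG]].
case=> psi [beta [[psi_bij psi1 psiM psip] beta_bij psiG]].
exists (psi \o phi)%VF, (beta \o alpha); split.
- split.
  + have h : bijective (psi \o phi)%FUN by apply: bij_comp.
    by apply: (eq_bij h) => x; rewrite comp_lfunE.
  + by rewrite comp_lfunE phi1.
  + by move=> a b; rewrite !comp_lfunE phiM psiM.
  by move=> p; rewrite limg_comp phip psip.
- exact: bij_comp.
by move=> s; rewrite limg_comp phiG psiG.
Qed.

End Equivalences.

Lemma inj_surj_bij (A B : Type) (f : A -> B) :
  injective f -> (forall y, exists x, f x = y) -> bijective f.
Proof.
move=> f_inj f_surj.
pose g y := proj1_sig (constructive_indefinite_description _ (f_surj y)).
have gK : cancel g f by move=> y; apply: (proj2_sig (constructive_indefinite_description _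
  (f_surj y))).
by exists g => // x; apply: f_inj; rewrite gK.
Qed.

Section TransportGrading.

Variables (F : fieldType) (n : nat) (G : zmodType).
Local Notation M := 'M[F]_n.
Variables (phi psi : 'End(M)).
Hypotheses (phiK : cancel phi psi) (psiK : cancel psi phi).
Hypothesis phiM : forall a b, phi (a *m b) = phi a *m phi b.

Lemma mem_limg_can (U : {vspace M}) a : (a \in (phi @: U)%VS) = (psi a \in U).
Proof.
apply/idP/idP => [/memv_imgP[b bU ->]|aU]; first by rewrite phiK.
by rewrite -[a]psiK memv_img.
Qed.

Lemma transport_mx_grading (Gam : G -> {vspace M}) :
  mx_grading Gam -> mx_grading (fun g => (phi @: Gam g)%VS).
Proof.
move=> gradG; have [s [p projG]] := mx_grading_proj gradG.
have [Us pV pS pE] := projG; split; last first.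
  move=> g h a b /memv_imgP[x xg ->] /memv_imgP[y yh ->]; rewrite -phiM.
  by rewrite memv_img // grading_mul.
apply: (@is_direct_sum_intro _ _ _ _ _ s (fun g a => phi (p g (psi a)))) => //.
- move=> g gs; apply/eqP; rewrite -subv0; apply/subvP=> a; rewrite mem_limg_can memv0 => ag.
  have := pE g g _ ag; rewrite eqxx (proj_out projG) // => /esym a0.
  by rewrite -[a]psiK a0 linear0.
- by move=> g; apply: subvf.
- by move=> g a _; rewrite memv_img.
- by move=> a _; rewrite -{1}[a]psiK [psi a in LHS]pS linear_sum.
move=> u uV sum0 g gs; have := congr1 (fun a => p g (psi a)) sum0.
rewrite !linear0 !linear_sum /= (bigD1_seq g) //= big1 ?addr0 => [|h /negPf hg].
  by rewrite (pE g) -?mem_limg_can // eqxx => ug; rewrite -[u g]psiK ug linear0.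
by rewrite (pE h) -?mem_limg_can // hg.
Qed.

End TransportGrading.

(** * Fine gradings and their equivalence with [GammaH] *)

Section FineGradings.

Variables (F : closedFieldType) (m n : nat).
Hypotheses (m_gt0 : (0 < m)%N) (n_gt0 : (0 < n)%N).
Local Notation M := 'M[F]_(m + n).
Local Notation blk := (block_idem F m n).

Lemma equivalent_refl (G : zmodType) (Gam : G -> {vspace M}) : equivalent Gam Gam.
Proof.
exists \1%VF, id; split; first split.
- by exists id => x; rewrite id_lfunE.
- by rewrite id_lfunE.
- by move=> a b; rewrite !id_lfunE.
- by move=> p; apply: lim1g.
- by exists id.
by move=> s; apply: lim1g.
Qed.

(** The refinement is pulled back along the equivalence, where [GammaH_refinement] puts each
    component of [GammaH] inside one of the refinement; a strict inclusion would then nest two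
    different components of the refinement. *)
Lemma equivalent_GammaH_not_refinable (H : finZmodType) (G G' : zmodType)
    (Gam : G -> {vspace M}) (Gam' : G' -> {vspace M}) :
    (#|H| %| gcdn m n)%N -> #|H|%:R != 0 :> F ->
  equivalent (@GammaH F m n H) Gam -> mx_grading Gam' -> ~ proper_refinement Gam' Gam.
Proof.
move=> dvdH H0 [phi [alpha [[phi_bij phi1 phiM _] [beta alphaK betaK] phiG]]] gradG' [ref].
have ker0 : lker phi == 0%VS by apply/lker0P; apply: bij_inj.
have [phiK phiVK] := (lker0_lfunK ker0, lker0_lfunVK ker0).
have phiVM a b : (phi^-1)%VF (a *m b) = (phi^-1)%VF a *m (phi^-1)%VF b.
  by apply: (bij_inj phi_bij); rewrite phiM !phiVK.
have GamE g : Gam g != 0%VS -> exists g', Gam g = (phi @: @GammaH F m n H g')%VS.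
  by move=> gn0; exists (val (beta (exist _ g gn0))); rewrite phiG betaK.
pose Gam3 h := ((phi^-1)%VF @: Gam' h)%VS.
have grad3 : mx_grading Gam3 by apply: (transport_mx_grading phiVK phiK phiVM gradG').
have ref3 h : exists g', (Gam3 h <= @GammaH F m n H g')%VS.
  have [g hg] := ref h; have [h0|hn0] := eqVneq (Gam' h) 0%VS.
    by exists 0; rewrite /Gam3 h0 limg0 sub0v.
  have /GamE[g' gE] : Gam g != 0%VS.
    by apply: contraNneq hn0 => g0; rewrite -subv0 -g0.
  exists g'; apply/subvP=> a; rewrite (mem_limg_can phiVK phiK) => /(subvP hg).
  by rewrite gE (mem_limg_can phiK phiVK) phiK.
have coarse := GammaH_refinement dvdH m_gt0 n_gt0 (GammaH_mx_grading dvdH H0) grad3 ref3.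
case=> h [g [hn0 hg neq_hg]]; case/eqP: neq_hg; apply: subv_anti; rewrite hg /=.
have /GamE[g' gE] : Gam g != 0%VS by apply: contraNneq hn0 => g0; rewrite -subv0 -g0.
have [h2 gh2] := coarse g'.
have gh : (Gam g <= Gam' h2)%VS.
  apply/subvP=> a; rewrite gE (mem_limg_can phiK phiVK) => /(subvP gh2).
  by rewrite (mem_limg_can phiVK phiK) phiVK.
suff -> : h = h2 by [].
have a0 : vpick (Gam' h) != 0 by rewrite vpick0.
apply: (grading_disjoint gradG' (memv_pick _) _ a0).
by apply: (subvP gh); apply: (subvP hg); apply: memv_pick.
Qed.

(** Conjugation by [P] keeps the block idempotent in degree 0, so the conjugate of [GammaH] is a
    refinement of [Gam] within the class in which [Gam] is fine. Its nonzero components are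
    therefore those of [Gam]. *)
Lemma fine_equivalent (G : zmodType) (Gam : G -> {vspace M}) :
  is_fine (@is_Zsuper_grading F m n) Gam ->
  exists K : finZmodType, [/\ (#|K| %| gcdn m n)%N, #|K|%:R != 0 :> F
    & forall H : finZmodType, isomorphic K H -> equivalent (@GammaH F m n H) Gam].
Proof.
case=> ZG fineG; have [gradG e00] := (Zsuper_gradingP Gam m_gt0 n_gt0).1 ZG.
have [K [dvdK K0 KH]] := GammaH_coarsening m_gt0 gradG e00.
exists K; split=> // H KHiso; have [P [P' [psi [PP' Pe sub]]]] := KH H KHiso.
have cardH : #|H| = #|K| by case: KHiso => i [ib _]; rewrite (bij_eq_card ib).
have dvdH : (#|H| %| gcdn m n)%N by rewrite cardH.
have H0 : #|H|%:R != 0 :> F by rewrite cardH.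
have P'P := mulmx1C PP'.
have P'e : P' *m blk false = blk false *m P'.
  by rewrite -[LHS]mulmx1 -PP' !mulmxA -[P' *m _ *m P]mulmxA -Pe !mulmxA P'P mul1mx.
pose phi : 'End(M) := linfun (mulmxr P' \o mulmx P).
pose phi' : 'End(M) := linfun (mulmxr P \o mulmx P').
have phiE a : phi a = P *m a *m P' by rewrite lfunE.
have phi'E a : phi' a = P' *m a *m P by rewrite lfunE.
have phiK : cancel phi phi'.
  by move=> a; rewrite phiE phi'E !mulmxA P'P mul1mx -mulmxA P'P mulmx1.
have phi'K : cancel phi' phi.
  by move=> a; rewrite phiE phi'E !mulmxA PP' mul1mx -mulmxA PP' mulmx1.
have phiM a b : phi (a *m b) = phi a *m phi b.
  by rewrite !phiE !mulmxA -[_ *m P' *m P]mulmxA P'P mulmx1.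
pose Gam2 g := (phi @: @GammaH F m n H g)%VS.
have grad2 : mx_grading Gam2 := transport_mx_grading phiK phi'K phiM (GammaH_mx_grading dvdH H0).
have Z2 : is_Zsuper_grading Gam2.
  apply: (Zsuper_gradingP Gam2 m_gt0 n_gt0).2; split=> //.
  rewrite (mem_limg_can phiK phi'K) phi'E P'e -mulmxA P'P mulmx1.
  exact: (GammaH_block F dvdH).
have sub2 g : (Gam2 g <= Gam (psi g))%VS.
  apply/subvP=> a; rewrite (mem_limg_can phiK phi'K) => /sub.
  by rewrite -phiE phi'K.
have eq2 g : Gam2 g != 0%VS -> Gam2 g = Gam (psi g).
  move=> gn0; apply/eqP/negPn/negP => neq; case: (fineG _ _ Z2); split.
    by move=> g'; exists (psi g').
  by exists g, (psi g).
have nz2 g : (Gam2 g == 0%VS) = (@GammaH F m n H g == 0%VS).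
  apply/eqP/eqP => [G20|G0]; last by rewrite /Gam2 G0 limg0.
  apply/eqP; rewrite -subv0; apply/subvP=> a ag.
  have : phi a \in Gam2 g by rewrite memv_img.
  by rewrite G20 [phi a \in _]memv0 => /eqP pa; rewrite -[a]phiK pa linear0 mem0v.
have alphaP (s : supp (@GammaH F m n H)) : Gam (psi (val s)) != 0%VS.
  by rewrite -eq2 nz2 (valP s).
exists phi, (fun s => exist _ (psi (val s)) (alphaP s)); split.
- split=> //.
  + by exists phi'.
  + by rewrite phiE mulmx1.
  have par (Q Q' : M) p a : Q *m blk false = blk false *m Q -> Q' *m blk false = blk false *m Q' ->
      a \in parity_part F m n p -> Q *m a *m Q' \in parity_part F m n p.
    move=> Qe Q'e /parity_partP ap; apply/parity_partP.
    have Q'p : Q' *m blk (p != 0) = blk (p != 0) *m Q'.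
      case: (p != 0) => //; have := block_idem_sum F m n.
      move/(canRL (addKr _)) => ->; rewrite mulmxDr mulmxDl mulmxN mulNmx Q'e.
      by rewrite mulmx1 mul1mx.
    by rewrite !mulmxA -Qe -[Q *m _ *m a]mulmxA ap mulmxA -[LHS]mulmxA -Q'p mulmxA.
  move=> p; apply/vspaceP=> a; rewrite (mem_limg_can phiK phi'K) phi'E.
  apply/idP/idP => [|ap]; last exact: par.
  by move/(par P P' p _ Pe P'e); rewrite -phi'E -phiE phi'K.
- apply: inj_surj_bij => [s t [eq_st]|[g gn0]].
    have nzs : Gam2 (val s) != 0%VS by rewrite nz2; apply: (valP s).
    have nzt : Gam2 (val t) != 0%VS by rewrite nz2; apply: (valP t).
    have Gst : Gam2 (val t) = Gam2 (val s) by rewrite (eq2 _ nzt) -eq_st (eq2 _ nzs).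
    have an0 : vpick (Gam2 (val s)) != 0 by rewrite vpick0.
    apply: val_inj; apply: (grading_disjoint grad2 (memv_pick _) _ an0).
    by rewrite Gst memv_pick.
  have [s [p [_ pV pS pE]]] := mx_grading_proj gradG.
  have [s2 [p2 [_ p2V p2S p2E]]] := mx_grading_proj grad2.
  have a0 : vpick (Gam g) != 0 by rewrite vpick0.
  (* Surjectivity on supports: a nonzero homogeneous element of degree [g] is a sum of components in
     the conjugate of [GammaH], and one of those must survive in degree [g]. *)
  have [h [hn0 hg]] : exists h, @GammaH F m n H h != 0%VS /\ psi h = g.
    apply: NNPP => none; case/eqP: a0; set a := vpick _.
    have := pE g g a (memv_pick _); rewrite eqxx => <-; rewrite [a]p2S linear_sum big1 // => h _ /=.
    have [->|pn0] := eqVneq (p2 h a) 0; first exact: linear0.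
    rewrite (pE (psi h)) ?(subvP (sub2 h)) //; case: eqP => // hg; case: none; exists h.
    split=> //; rewrite -nz2; apply: contraNneq pn0 => G20.
    by rewrite -memv0 -G20 p2V.
  by exists (exist _ h hn0); apply: val_inj.
move=> s; apply: eq2; rewrite nz2; apply: (valP s).
Qed.

End FineGradings.

Section Representatives.

Variables (F : closedFieldType) (m n : nat) (Theta : nat -> finZmodType -> Prop).
Hypothesis hTheta : forall l : nat, is_representatives l (Theta l).

Lemma parameterP (H : finZmodType) : is_parameter F m n Theta H <->
  [/\ (#|H| %| gcdn m n)%N, #|H|%:R != 0 :> F & Theta #|H| H].
Proof.
split=> [[l [dvd_l char_l HTheta]]|[dvdH H0 HTheta]].
  have [cardH _] := hTheta l; rewrite (cardH H HTheta).
  by split=> //; rewrite natf_neq0_pchar.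
by exists #|H|; rewrite -natf_neq0_pchar.
Qed.

Lemma isomorphic_parameter (H H' : finZmodType) :
  is_parameter F m n Theta H -> is_parameter F m n Theta H' -> isomorphic H H' -> H = H'.
Proof.
move=> /parameterP[_ _ tH] /parameterP[_ _ tH'] isoHH'.
have [_ /(_ H erefl)[K [_ uniqK]]] := hTheta #|H|.
rewrite -(uniqK H) ?(uniqK H') //; split=> //.
  by have [f [f_bij _]] := isoHH'; rewrite (bij_eq_card f_bij).
by exists id; split=> //; exists id.
Qed.

End Representatives.

Theorem theorem4p22 (F : closedFieldType) (m n : nat)
    (hm : (1 <= m)%N) (hn : (1 <= n)%N)
    (Theta : nat -> finZmodType -> Prop)
    (hTheta : forall l : nat, is_representatives l (Theta l)) :
  [/\ forall (G : zmodType) (Gam : G -> {vspace 'M[F]_(m + n)}),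
        is_fine (@is_Zsuper_grading F m n) Gam <->
        is_even Gam /\ is_fine (@is_super_grading F m n) Gam,
      forall (G : zmodType) (Gam : G -> {vspace 'M[F]_(m + n)}),
        is_fine (@is_Zsuper_grading F m n) Gam ->
        exists! H : finZmodType,
          is_parameter F m n Theta H /\ equivalent Gam (@GammaH F m n H),
      forall H : finZmodType, is_parameter F m n Theta H ->
        is_fine (@is_Zsuper_grading F m n) (@GammaH F m n H)
    & forall H : finZmodType, is_parameter F m n Theta H ->
        is_universal_group (@GammaH F m n H) (@G_H F m n H)].
Proof.
have param_equiv (G : zmodType) (Gam : G -> {vspace 'M[F]_(m + n)}) :
    is_fine (@is_Zsuper_grading F m n) Gam ->
    exists H : finZmodType, is_parameter F m n Theta H /\ equivalent (@GammaH F m n H) Gam.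
  case/(fine_equivalent hm hn) => K [dvdK K0 Kequiv].
  have [_ /(_ K erefl)[H [[tH isoKH] _]]] := hTheta #|K|.
  exists H; split; last exact: Kequiv.
  have cardH : #|H| = #|K| by have [f [f_bij _]] := isoKH; rewrite (bij_eq_card f_bij).
  by apply: (parameterP F m n hTheta H).2; rewrite cardH.
split=> [G Gam|G Gam fineG|H /(parameterP F m n hTheta H)[dvdH H0 _]|H /(parameterP F m n hTheta
  H)[dvdH H0 _]].
- split=> [fineG|[evenG [superG fineG]]].
    have [ZG _] := fineG; have [gradG e00] := (Zsuper_gradingP Gam hm hn).1 ZG.
    have [fd _] := frame_data_exists hm gradG e00.
    split; first exact: Zsuper_is_even gradG e00 fd.
    split=> [|G' Gam' [gradG' _]]; first by case: ZG.
    (* A competing refinement is now only a super grading; [Gam] is equivalent to some [GammaH],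
       which no algebra grading properly refines. *)
    have [H [/(parameterP F m n hTheta H)[dvdH H0 _] equivH]] := param_equiv G Gam fineG.
    exact: (equivalent_GammaH_not_refinable hm hn dvdH H0 equivH gradG').
  (* Here the class shrinks, so fineness is inherited; membership in the smaller class is what
     evenness provides. *)
  split; last by move=> G' Gam' [superG' _]; apply: fineG.
  apply: (Zsuper_gradingP Gam hm hn).2; split; first by case: superG.
  exact: even_block_idem.
- have [H [paramH equivH]] := param_equiv G Gam fineG.
  exists H; split=> [|H' [paramH' equivH']]; first by split=> //; apply: equivalent_sym.
  apply: (isomorphic_parameter hTheta paramH paramH').
  have equivHH' := equivalent_trans equivH equivH'.
  have [dvdH H0 _] := (parameterP F m n hTheta H).1 paramH.
  have [dvdH' H0' _] := (parameterP F m n hTheta H').1 paramH'.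
  have [tau [tau_inj tauD]] := equivalent_T_group dvdH dvdH' H0' hm equivHH'.
  have [tau' [tau'_inj tau'D]] := equivalent_T_group dvdH' dvdH H0 hm (equivalent_sym equivHH').
  exact: (T_group_recover H0 H0' tau_inj tauD tau'_inj tau'D).
- split; first exact: (GammaH_Zsuper dvdH H0 hm hn).
  move=> G' Gam' [[gradG' _] _].
  exact: (equivalent_GammaH_not_refinable hm hn dvdH H0 (equivalent_refl _) gradG').
exact: (GammaH_universal dvdH H0 hm hn).
Qed.
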